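(* Let $0<c<d<\infty$, and let $\mu_0$ be a continuous nonincreasing function on $[0,1]$, continuously differentiable on $[0,1]$ with $c<|\mu_0'(t)|<d$ for all $t\in[0,1]$. Let $x_0\in(0,1)$, $a=\mu_0(x_0)$, and let $\epsilon_0>0$ be small (so that $(x_0-\epsilon_0,x_0+\epsilon_0)\subset(0,1)$). Let $\mathcal M_0$ be the class of all continuous nonincreasing functions $\mu$ on $[0,1]$ that are continuously differentiable on $[0,1]$, coincide with $\mu_0$ outside $(x_0-\epsilon_0,x_0+\epsilon_0)$, and satisfy $c<|\mu'(t)|<d$ for all $t\in[0,1]$. For $\mu\in\mathcal M_0$, let $\mathbb E_\mu$ denote expectation when one observes $N$ i.i.d. copies of $(X,Y)$ with $Y=\mu(X)+\varepsilon$, $X\sim\mathrm{Uniform}(0,1)$ independent of $\varepsilon\sim N(0,v^2)$, $v>0$ fixed. Let $\hat\theta_N=\hat\mu_N^{-1}(a)$ be the inverse isotonic least squares estimator of $\mu^{-1}(a)$ based on all $N$ observations and, for $N=m\times n$, let $\bar\theta_m=\frac1m\sum_{j=1}^m\hat\mu_{n,j}^{-1}(a)$, where $\hat\mu_{n,j}$ is the isotonic least squares estimator from the $j$-th of $m$ disjoint subsamples of size $n$. Let $$E:=\limsup_{N\to\infty}\ \sup_{\mu\in\mathcal M_0}\mathbb E_\mu\left[N^{2/3}(\hat\theta_N-\mu^{-1}(a))^2\right]$$ and, for fixed $m$, $$E_m:=\liminf_{N\to\infty}\ \sup_{\mu\in\mathcal M_0}\mathbb E_\mu\left[N^{2/3}(\bar\theta_m-\mu^{-1}(a))^2\right]$$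 (the limit being along $N=m\times n$, $n\to\infty$). Then $E<\infty$, while there is $c_0>0$, not depending on $m$, such that $E_m\ge m^{2/3}c_0$. Moreover, when $m=m_n$ diverges to infinity (with $N=m_n\times n$, $n\to\infty$), $$\liminf_{N\to\infty}\ \sup_{\mu\in\mathcal M_0}\mathbb E_\mu\left[N^{2/3}(\bar\theta_{m_n}-\mu^{-1}(a))^2\right]=\infty.$$
   Context: Isotonic least squares estimator from a sample $(X_1,Y_1),\dots,(X_n,Y_n)$: let $X_{(1)}<\dots<X_{(n)}$ be the order statistics and $Y_{(i)}$ the observation corresponding to $X_{(i)}$; $\Lambda_n$ is the continuous function on $[0,1]$, linear on each $[(i-1)/n,i/n]$, with $\Lambda_n(i/n)=\frac1n\sum_{j\le i}Y_{(j)}$; $\hat\lambda_n$ is the left-hand slope of the least concave majorant of $\Lambda_n$ on $[0,1]$. The nonincreasing least squares estimator $\hat\mu_n$ is the left-continuous piecewise constant function with $\hat\mu_n(X_{(i)})=\hat\lambda_n(i/n)$, $i=1,\dots,n$, constant on $[0,X_{(1)}]$ and on $(X_{(i-1)},X_{(i)}]$ for $i=2,\dots,n$, and equal to $\hat\lambda_n(1)$ on $(X_{(n)},1]$. For a nonincreasing left-continuous $h:[0,1]\to\mathbb R$, $h^{-1}(a)$ is the greatest $t\in[0,1]$ with $h(t)\ge a$, with the convention that the supremum of the empty set is $0$. *)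

(* Defs.v *)
From HB Require Import structures.
From mathcomp Require Export all_boot all_order all_algebra.
From mathcomp Require Export finmap.
From mathcomp Require Export all_classical all_reals all_analysis.

Set Implicit Arguments.
Unset Strict Implicit.
Unset Printing Implicit Defensive.

Import Order.TTheory GRing.Theory Num.Theory.
Import numFieldNormedType.Exports.

Local Open Scope classical_set_scope.
Local Open Scope ring_scope.

Section functions_on_the_unit_interval.
Variable R : realType.
Implicit Types (f h L : R -> R) (D : set R).

(* Functions on [0, 1] are represented by functions on R of which only the
   values on [0, 1] are used. *)
Notation I01 := `[0%R : R, 1%R : R].

(* Difference quotients with increments inside D: at an end point of a segment
   D this is the one-sided derivative. *)
Definition has_derivative_within D f f' :=
  forall t, D t ->
    (fun s => (f s - f t) / (s - t)) @ within D t^' --> (f' t : R).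

Definition smooth_nonincreasing (c d : R) f :=
  [/\ {within [set` I01], continuous f},
      {in I01 &, nonincreasing_fun f} &
      exists f' : R -> R,
        [/\ has_derivative_within [set` I01] f f',
            {within [set` I01], continuous f'} &
            forall t, t \in I01 -> c < `|f' t| < d]].

Definition local_class (c d : R) (mu0 : R -> R) (x0 eps0 : R) : set (R -> R) :=
  [set mu | smooth_nonincreasing c d mu /\
    forall t, t \in I01 -> t \notin `]x0 - eps0, x0 + eps0[ -> mu t = mu0 t].

(* [sup set0] is 0 in the library, as the convention requires. *)
Definition gen_inv h (a : R) : R := sup [set t | t \in I01 /\ a <= h t].

Definition concave_on D f :=
  @convex_function R R^o D (\- f).

(* The least concave majorant of L on [0, 1]. *)
Definition concave_majorant01 L (t : R) : R :=
  inf [set g t | g in [set g : R -> R |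
    concave_on [set` I01] g /\ forall s, s \in I01 -> L s <= g s]].

Definition left_slope f (t : R) : R :=
  lim ((fun s => (f t - f s) / (t - s)) @ t^'-).

End functions_on_the_unit_interval.

Section isotonic_estimator.
Variable R : realType.
Implicit Types s : seq (R * R).

(* A sample (X_1, Y_1), ..., (X_n, Y_n) sorted by increasing X; the
   observation Y_(i) is the entry of index i - 1. *)
Definition sort_sample s := sort (fun p q => p.1 <= q.1) s.
Definition ordered_obs s (i : nat) : R := (nth (0, 0) (sort_sample s) i).2.

(* Lambda_n: on [k/n, (k+1)/n] it interpolates linearly the partial sums
   Lambda_n(k/n) = (Y_(1) + ... + Y_(k)) / n. *)
Definition cusum s (t : R) : R :=
  let n := (size s)%:R in
  let k := Num.truncn (n * t) in
  (\sum_(j < k) ordered_obs s j + (n * t - k%:R) * ordered_obs s k) / n.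

Definition lambda_hat s (t : R) : R := left_slope (concave_majorant01 (cusum s)) t.

(* If k sample points are strictly smaller than t, then t lies in
   (X_(k), X_(k+1)] (in [0, X_(1)] if k = 0, in (X_(n), 1] if k = n), and the
   value is lambda_hat((k+1)/n), resp. lambda_hat(1) if k = n. *)
Definition mu_hat s (t : R) : R :=
  let n := size s in
  lambda_hat s ((minn (count (fun p => p.1 < t) s).+1 n)%:R / n%:R).

End isotonic_estimator.

Section regression_model.
Context {R : realType} {d : measure_display} {T : measurableType d}.
Variable P : probability T R.

(* Only finite subfamilies matter; the events A i with i outside J are
   irrelevant. *)
Definition mutually_independent (I : choiceType) (Z : I -> {RV P >-> R}) :=
  forall (J : {fset I}) (A : I -> set R),
    (forall i, i \in J -> measurable (A i)) ->
    P (\bigcap_(i in [set` J]) (Z i @^-1` A i)) =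
    (\prod_(i <- J) P (Z i @^-1` A i))%E.

(* All X_i and all errors are mutually independent, with X_i ~ Uniform(0, 1)
   and errors ~ N(0, v^2); the last argument of [normal_prob] is the standard
   deviation. Laws are compared on measurable sets only, since measures are
   unspecified elsewhere. *)
Definition regression_noise (v : R) (X eps : nat -> {RV P >-> R}) :=
  [/\ forall i A, measurable A ->
        distribution P (X i) A = uniform_prob (@ltr01 R) A,
      forall i A, measurable A ->
        distribution P (eps i) A = normal_prob 0 v A &
      mutually_independent (fun k : nat + nat =>
        match k with inl i => X i | inr i => eps i end)].

Variables (X eps : nat -> {RV P >-> R}).

(* The observations (X_i, mu(X_i) + eps_i), for k <= i < k + n. The same
   (X_i, eps_i) serve for all mu, so that E_mu is an expectation under P. *)
Definition sample (mu : R -> R) (w : T) (k n : nat) : seq (R * R) :=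
  [seq (X i w, mu (X i w) + eps i w) | i <- iota k n].

Definition theta_hat (a : R) (N : nat) (mu : R -> R) (w : T) : R :=
  gen_inv (mu_hat (sample mu w 0 N)) a.

Definition theta_bar (a : R) (m n : nat) (mu : R -> R) (w : T) : R :=
  m%:R^-1 * \sum_(j < m) gen_inv (mu_hat (sample mu w (j * n) n)) a.

Definition max_risk (M : set (R -> R)) (a : R) (N : nat)
    (theta : (R -> R) -> T -> R) : \bar R :=
  ereal_sup
    [set 'E_P[(fun w => N%:R `^ (2 / 3) * (theta mu w - gen_inv mu a) ^+ 2)%R]%E
      | mu in M].

End regression_model.

(* Main.v *)
(* Let theta_hat be the inverse estimator of theta = mu^{-1}(a). By the switch
   relation for least concave majorants, theta_hat sits at the last maximizer of
   the partial sums of Y_(i) - a, which are a noise sum plus a drift with slope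
   at most -c away from theta.

   Upper bound. With r = n^{-1/3}, cut |theta_hat - theta| into dyadic slices
   (tau, 2 tau], tau = 2^l r. On such a slice the maximum of the noise over the
   observations within 2 tau of theta exceeds c tau / 2 times the number of
   observations at distance between tau / 2 and tau. A pathwise form of Doob's
   L^2 inequality and the variance of that number give a slice probability at
   most C / (n tau) + C / (n tau^3); summing against tau^2 gives C r^2,
   uniformly over the class.

   Lower bound. Add to mu0 a bump of height kappa h and width h = beta^2 r at
   x0. This moves the target by at least kappa h / d, whereas the expectation of
   theta_hat moves by O(beta^3 r) only: the chi-square divergence between the two
   samples is O(beta^6) by the Gaussian shift formula, and the risk is O(r^2). For
   small beta one of the two regression functions therefore yields a bias of
   order r, and averaging over the m subsamples leaves that bias unchanged,
   while (m n)^{2/3} r^2 = m^{2/3}. *)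
From HB Require Import structures.
Require Import Defs.
From mathcomp Require Import ring lra zify.
From mathcomp Require Import measurable_realfun.

Set Implicit Arguments.
Unset Strict Implicit.
Unset Printing Implicit Defensive.

Import Order.TTheory GRing.Theory Num.Theory.
Import numFieldNormedType.Exports.

Local Open Scope classical_set_scope.
Local Open Scope ring_scope.


(** * Concave majorants and the switch relation *)

(** After sorting, the errors stay independent of the ranks, because the order depends on the X_i
    alone. No conditional laws are formed for this: everything rests on integrating out one variable
    against the sigma-algebra generated by all the others. A function is free of [eps i] when it is
    measurable on [other_type]; such a function times [eps i] has expectation 0, which removes the
    martingale part of Doob's inequality. The same device removes the Gaussian shifts one
    observation at a time.

    Members of the class are arbitrary outside [0, 1], so an integrand may fail to be measurable.
    Upper bounds tolerate this, the integral of a nonnegative function being a lower integral. Lower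
    bounds replace [mu0] by its composition with [clamp01], which is Borel and still lies in the
    class.

    The bump width is beta^2 r rather than beta r so that the square root of the chi-square order
    beta^6 is the polynomial beta^3; the change of expectation, of order beta^3 r, then loses to the
    target shift, of order beta^2 r. *)

Section concave_majorant.
Variable R : realType.
Implicit Types (f g L : R -> R) (s t u a b : R).

Lemma concave_on_convP f :
  concave_on [set` `[0, 1]] f <->
  forall q s u, 0 <= q <= 1 -> s \in `[0, 1] -> u \in `[0, 1] ->
    q * f s + (1 - q) * f u <= f (q * s + (1 - q) * u).
Proof.
split=> [cf q s u /andP[q0 q1] sI uI | H p x y].
  have := cf (Itv01 q0 q1) s u (mem_set sI) (mem_set uI).
  change (- f (q * s + (1 - q) * u) <= q * (- f s) + (1 - q) * (- f u) ->
    q * f s + (1 - q) * f u <= f (q * s + (1 - q) * u)).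
  by rewrite !mulrN -opprD lerN2.
move=> /set_mem xI /set_mem yI.
have p01 : 0 <= p%:num <= 1 by apply/andP; split.
have := H p%:num x y p01 xI yI.
change (p%:num * f x + (1 - p%:num) * f y <= f (p%:num * x + (1 - p%:num) * y) ->
  - f (p%:num * x + (1 - p%:num) * y) <= p%:num * (- f x) + (1 - p%:num) * (- f y)).
by rewrite !mulrN -opprD lerN2.
Qed.

(** The chord inequality cleared of denominators, for strictly ordered points: slope comparisons
    then become linear arithmetic. *)
Lemma concave_onP f :
  concave_on [set` `[0, 1]] f <->
  forall s t u, 0 <= s -> s < t -> t < u -> u <= 1 ->
    (u - t) * f s + (t - s) * f u <= (u - s) * f t.
Proof.
split=> [/concave_on_convP cf s t u s0 st tu u1 | H].
- have su : 0 < u - s by lra.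
  pose q := (u - t) / (u - s).
  have q01 : 0 <= q <= 1.
    by rewrite divr_ge0 ?ler_pdivrMr //=; lra.
  have sI : s \in `[0, 1] by rewrite in_itv /=; lra.
  have uI : u \in `[0, 1] by rewrite in_itv /=; lra.
  have := cf q s u q01 sI uI.
  have -> : q * s + (1 - q) * u = t by rewrite /q; field; lra.
  rewrite -(ler_pM2l su) => h.
  have e1 : (u - s) * q = u - t by rewrite /q; field; lra.
  apply: le_trans h; rewrite le_eqVlt; apply/orP; left; apply/eqP.
  rewrite mulrDr (mulrA _ q) e1 (mulrA _ (1 - q)).
  by have -> : (u - s) * (1 - q) = t - s by rewrite mulrBr mulr1 e1; ring.
- apply/concave_on_convP => q x y /andP[q0 q1].
  rewrite !in_itv /= => /andP[x0 x1] /andP[y0 y1].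
  have [->|q0'] := eqVneq q 0.
    by rewrite !mul0r !add0r !subr0 !mul1r.
  have [->|q1'] := eqVneq q 1.
    by rewrite subrr !mul0r !addr0 !mul1r.
  have {}q0 : 0 < q by rewrite lt_neqAle eq_sym q0'.
  have {}q1 : q < 1 by rewrite lt_neqAle q1'.
  have [xy|yx|->] := ltgtP x y.
  + have := H x (q * x + (1 - q) * y) y x0 _ _ y1; set z := f (_ + _) => h.
    have {h} := h ltac:(nra) ltac:(nra) => h.
    have d0 : 0 < y - x by lra.
    rewrite -(ler_pM2l d0); apply: le_trans h; rewrite le_eqVlt; apply/orP; left; apply/eqP; ring.
  + have := H y (q * x + (1 - q) * y) x y0 _ _ x1; set z := f (_ + _) => h.
    have {h} := h ltac:(nra) ltac:(nra) => h.
    have d0 : 0 < x - y by lra.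
    rewrite -(ler_pM2l d0); apply: le_trans h; rewrite le_eqVlt; apply/orP; left; apply/eqP; ring.
  + have -> : q * y + (1 - q) * y = y by ring.
    by rewrite le_eqVlt; apply/orP; left; apply/eqP; ring.
Qed.

Lemma concave_on_min_affine A a b u :
  concave_on [set` `[0, 1]] (fun t => Num.min (A + a * (t - u)) (A + b * (t - u))).
Proof.
apply/concave_onP => x y z x0 xy yz z1.
rewrite /Num.min; case: ifP => h1; case: ifP => h2; case: ifP => h3;
  move/negbT: h1 || idtac; move/negbT: h2 || idtac; move/negbT: h3 || idtac;
  rewrite -?leNgt; nra.
Qed.

Variable L : R -> R.
Local Notation C := (concave_majorant01 L).

Lemma concave_majorant_le g t : concave_on [set` `[0, 1]] g ->
  (forall s, s \in `[0, 1] -> L s <= g s) -> t \in `[0, 1] -> C t <= g t.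
Proof.
move=> cg Lg tI; apply: ge_inf; last by exists g.
by exists (L t) => _ [h [_ Lh] <-]; exact: Lh.
Qed.

(** A concave majorant has to be exhibited, since the infimum of an empty family would be a default
    value. *)
Lemma le_concave_majorant t c : t \in `[0, 1] ->
  (exists2 g, concave_on [set` `[0, 1]] g & forall s, s \in `[0, 1] -> L s <= g s) ->
  (forall g, concave_on [set` `[0, 1]] g ->
    (forall s, s \in `[0, 1] -> L s <= g s) -> c <= g t) -> c <= C t.
Proof.
move=> tI [g0 cg0 Lg0] H; apply: lb_le_inf; first by exists (g0 t), g0.
by move=> _ [h [ch Lh] <-]; exact: H.
Qed.

Variables (u a : R).
Hypothesis u01 : u \in `[0, 1].
Hypothesis line : forall t, t \in `[0, 1] -> L t <= L u + a * (t - u).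

Let majorant_exists : exists2 g, concave_on [set` `[0, 1]] g &
  forall s, s \in `[0, 1] -> L s <= g s.
Proof.
exists (fun t => Num.min (L u + a * (t - u)) (L u + a * (t - u))).
  exact: concave_on_min_affine.
by move=> s sI; rewrite minxx; exact: line.
Qed.

(** An infimum of concave functions is concave: for each majorant g, the chord of g lies above the
    chord of the infimum. *)
Lemma concave_majorant_concave s t x : 0 <= s -> s < t -> t < x -> x <= 1 ->
  (x - t) * C s + (t - s) * C x <= (x - s) * C t.
Proof.
move=> s0 st tx x1.
have sx : 0 < x - s by lra.
rewrite [leRHS]mulrC -ler_pdivrMr //; apply: le_concave_majorant => //.
  by rewrite in_itv /=; lra.
move=> g cg Lg; rewrite ler_pdivrMr // [leRHS]mulrC.
apply: le_trans ((concave_onP g).1 cg s t x s0 st tx x1).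
by apply: lerD; rewrite ler_pM2l ?subr_gt0 //; apply: concave_majorant_le => //;
  rewrite in_itv /=; lra.
Qed.

Lemma concave_majorant_le_line t : t \in `[0, 1] -> C t <= L u + a * (t - u).
Proof.
(* A line is seen as the minimum of two equal lines, so that [concave_on_min_affine] gives its
   concavity. *)
move=> tI; rewrite -[leRHS]minxx.
apply: (@concave_majorant_le (fun t => Num.min (L u + a * (t - u)) (L u + a * (t - u)))) => //.
  exact: concave_on_min_affine.
by move=> s sI; rewrite minxx; exact: line.
Qed.

Lemma concave_majorant_touch : C u = L u.
Proof.
apply/eqP; rewrite eq_le; apply/andP; split.
  by apply: (le_trans (concave_majorant_le_line u01)); rewrite subrr mulr0 addr0.
by apply: le_concave_majorant => // g _ Lg; exact: Lg.
Qed.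

(** The majorant meets the supporting line at u and lies below it at s, so its slope from s to u is
    at least a; by concavity the slope from s to t is no smaller. *)
Lemma concave_majorant_slope_ge s t : 0 <= s -> s < t -> t <= u ->
  a <= (C t - C s) / (t - s).
Proof.
move=> s0 st tu; move: (u01); rewrite in_itv /= => /andP[u0 u1].
have ts : 0 < t - s by lra.
rewrite ler_pdivlMr //.
have sI : s \in `[0, 1] by rewrite in_itv /=; lra.
have := concave_majorant_le_line sI; have := concave_majorant_touch.
move: tu; rewrite le_eqVlt => /orP[/eqP-> Cu Cs | tu Cu Cs].
  by rewrite Cu; lra.
have := concave_majorant_concave s0 st tu u1.
rewrite Cu => h.
have us : 0 < u - s by lra.
rewrite -(ler_pM2l us); nra.
Qed.

Lemma concave_majorant_slope_mono x s t : 0 <= x -> x < s -> s < t -> t <= 1 ->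
  (C t - C s) / (t - s) <= (C t - C x) / (t - x).
Proof.
move=> x0 xs st t1; have := concave_majorant_concave x0 xs st t1 => h.
by rewrite ler_pdivrMr ?subr_gt0 // mulrAC ler_pdivlMr; nra.
Qed.

End concave_majorant.

Section left_slopes.
Variable R : realType.
Variables (L : R -> R) (b : R).
(* A supporting line at the right end point makes all left slopes finite. *)
Hypothesis line1 : forall t, t \in `[0, 1] -> L t <= L 1 + b * (t - 1).
Local Notation C := (concave_majorant01 L).

Let in1 : (1 : R) \in `[0, 1]. Proof. by rewrite in_itv /= ler01 lexx. Qed.

(** By concavity the difference quotients are monotone in s, and the supporting line at 1 bounds
    them below. Without convergence the [lim] in [left_slope] would carry no information. *)
Lemma is_cvg_left_slope (t : R) : 0 < t -> t <= 1 ->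
  cvg ((fun s => (C t - C s) / (t - s)) @ t^'-).
Proof.
move=> t0 t1.
rewrite -[X in X @ _]opprK; apply: is_cvgN.
apply: nondecreasing_at_left_is_cvgr.
  apply: filterS (nbhs_left_ge t0) => x x0 y z; rewrite !in_itv /= => /andP[xy yt] /andP[xz zt].
  rewrite le_eqVlt => /orP[/eqP->//|yz].
  rewrite lerN2 /=; apply: (concave_majorant_slope_mono line1) => //.
  exact: le_trans (ltW xy).
apply: filterS (nbhs_left_ge t0) => x x0.
exists (- b) => _ [y /= +] <-; rewrite in_itv /= => /andP[xy yt].
rewrite lerN2; apply: (concave_majorant_slope_ge in1 line1) => //.
exact: le_trans (ltW xy).
Qed.

Lemma left_slope_ge (t a : R) : 0 < t -> t <= 1 ->
  (forall s, 0 <= s -> s < t -> a <= (C t - C s) / (t - s)) -> a <= left_slope C t.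
Proof.
move=> t0 t1 H; apply: limr_ge; first exact: is_cvg_left_slope.
by near=> s; apply: H; near: s; [exact: nbhs_left_ge|exact: nbhs_left_lt].
Unshelve. all: by end_near. Qed.

Lemma left_slope_le (t x : R) : 0 <= x -> x < t -> t <= 1 ->
  left_slope C t <= (C t - C x) / (t - x).
Proof.
move=> x0 xt t1; apply: limr_le.
  by apply: is_cvg_left_slope => //; exact: le_lt_trans xt.
near=> s; have xs : x < s by near: s; exact: nbhs_left_gt.
exact: (concave_majorant_slope_mono line1).
Unshelve. all: by end_near. Qed.

End left_slopes.

Section last_argmax.
Variable R : realType.
Implicit Type S : nat -> R.

(** Ties go to the larger index. This matches the greatest t in the definition of the inverse and
    makes later values strictly smaller. *)
Fixpoint last_argmax S n : nat :=
  if n is n'.+1 then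
    let K := last_argmax S n' in if S K <= S n'.+1 then n'.+1 else K
  else 0.

Lemma last_argmax_le S n : (last_argmax S n <= n)%N.
Proof. by elim: n => //= n IH; case: ifP => // _; exact: leqW. Qed.

Lemma last_argmax_max S n k : (k <= n)%N -> S k <= S (last_argmax S n).
Proof.
elim: n => [|n IH] /=; first by rewrite leqn0 => /eqP->.
rewrite leq_eqVlt => /orP[/eqP->|/IH kK]; case: ifP => //.
- by move/negbT; rewrite -ltNge => /ltW.
- exact: le_trans.
Qed.

Lemma last_argmax_lt S n k : (k <= n)%N -> (last_argmax S n < k)%N ->
  S k < S (last_argmax S n).
Proof.
elim: n => [|n IH] /=; first by rewrite leqn0 => /eqP->.
rewrite leq_eqVlt => /orP[/eqP->|kn]; case: ifP => //.
- by rewrite ltnn.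
- by move/negbT; rewrite -ltNge.
- by move=> _ nk; move: kn; rewrite ltnS leqNgt (ltnW nk).
- by move=> _; exact: IH.
Qed.

Lemma eq_last_argmax S1 S2 n : (forall k, (k <= n)%N -> S1 k = S2 k) ->
  last_argmax S1 n = last_argmax S2 n.
Proof.
elim: n => //= n IH H; rewrite IH; last by move=> k /leqW; exact: H.
by rewrite !H // (leq_trans (last_argmax_le _ _)).
Qed.

End last_argmax.

Section switch_relation.
Variable R : realType.
Variables (s : seq (R * R)).
Hypothesis s0 : (0 < size s)%N.
Local Notation n := (size s).
Local Notation L := (cusum s).
Implicit Types (a b t : R) (k : nat).

Let n0 : 0 < (n%:R : R). Proof. by rewrite ltr0n. Qed.

Definition obs_sum k : R := \sum_(j < k) ordered_obs s j.

Definition centered_sum a k : R := \sum_(j < k) (ordered_obs s j - a).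

Lemma centered_sumE a k : centered_sum a k = obs_sum k - k%:R * a.
Proof.
by rewrite /centered_sum sumrB sumr_const card_ord mulr_natl.
Qed.

Lemma obs_sumS k : obs_sum k.+1 = obs_sum k + ordered_obs s k.
Proof. by rewrite /obs_sum big_ord_recr. Qed.

Lemma cusum_grid k : L (k%:R / n%:R) = obs_sum k / n%:R.
Proof.
rewrite /cusum mulrCA divff ?mulr1; last by rewrite gt_eqF.
by rewrite natrK subrr mul0r addr0.
Qed.

(** A linear interpolation stays below a line as soon as its nodes do. *)
Lemma cusum_le_line A b :
  (forall k, (k <= n)%N -> L (k%:R / n%:R) <= A + b * (k%:R / n%:R)) ->
  forall t, t \in `[0, 1] -> L t <= A + b * t.
Proof.
move=> H t; rewrite in_itv /= => /andP[t0 t1].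
have nt0 : 0 <= n%:R * t by rewrite mulr_ge0 // ltW.
have /andP[kt tk] := truncn_itv nt0.
rewrite /cusum; set k := Num.truncn _ in kt tk *.
rewrite -/(obs_sum k) ler_pdivrMr //.
have kn : (k <= n)%N.
  by rewrite -(ler_nat R) (le_trans kt) // ler_piMr // ltW.
have := H k kn; rewrite cusum_grid ler_pdivrMr // => h1.
have e1 : b * (k%:R / n%:R) * n%:R = b * k%:R.
  by rewrite -mulrA divfK // gt_eqF.
have e2 : b * (k.+1%:R / n%:R) * n%:R = b * k.+1%:R.
  by rewrite -mulrA divfK // gt_eqF.
move: h1; rewrite mulrDl e1 => h1.
(* For k = n the point is t = 1: there is no node of index k + 1, and the interpolation weight is
   0. *)
move: kn; rewrite leq_eqVlt => /orP[/eqP kn|kn].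
  have -> : n%:R * t = k%:R.
    by apply/eqP; rewrite eq_le kt andbT kn ler_piMr // ltW.
  rewrite subrr mul0r addr0; apply: (le_trans h1).
  have -> : t = 1; last by rewrite mulr1 kn mulrDl.
  apply/eqP; rewrite eq_le t1 /= -(ler_pM2l n0) mulr1.
  by apply: le_trans kt; rewrite kn.
have := H k.+1 kn; rewrite cusum_grid ler_pdivrMr // mulrDl e2 obs_sumS.
move: tk kt; rewrite -natr1; set x := n%:R * t => tk kt h2.
have -> : (A + b * t) * n%:R = A * n%:R + b * x by rewrite /x; ring.
nra.
Qed.

(** Subtracting a line of slope a from the cumulative sums produces the centered sums, so a
    maximizer of the latter is a point of support. *)
Lemma cusum_support a k : (k <= n)%N ->
  (forall j, (j <= n)%N -> centered_sum a j <= centered_sum a k) ->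
  forall t, t \in `[0, 1] ->
    L t <= L (k%:R / n%:R) + a * (t - k%:R / n%:R).
Proof.
move=> kn H t tI.
have -> : L (k%:R / n%:R) + a * (t - k%:R / n%:R) =
  (L (k%:R / n%:R) - a * (k%:R / n%:R)) + a * t by ring.
apply: cusum_le_line => // j jn.
have := H j jn; rewrite !centered_sumE !cusum_grid => h.
rewrite ler_pdivrMr // !mulrDl mulNr !mulrA !divfK ?gt_eqF //.
by rewrite (mulrC a) (mulrC a); lra.
Qed.

Lemma cusum_support_right : exists b, forall t, t \in `[0, 1] ->
  L t <= L 1 + b * (t - 1).
Proof.
(* This slope is below every observation, so the centered sums are nondecreasing and maximal at
   n. *)
pose b := - \sum_(j < n) `|ordered_obs s j|; exists b => t tI.
have := @cusum_support b n (leqnn _) _ t tI.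
rewrite divff ?gt_eqF //; apply=> j jn.
rewrite /centered_sum -!(big_mkord xpredT (fun i => ordered_obs s i - b)).
rewrite (big_cat_nat (leq0n j) jn) /= lerDl.
rewrite big_seq; apply: sumr_ge0 => i; rewrite mem_index_iota => /andP[_ iN].
rewrite /b opprK (bigD1 (Ordinal iN)) //= addrA addr_ge0 //; last exact: sumr_ge0.
by rewrite addrC -lerBlDr sub0r -normrN ler_norm.
Qed.

Let grid01 k : (k <= n)%N -> k%:R / n%:R \in (`[0, 1] : interval R).
Proof.
by move=> kn; rewrite in_itv /= divr_ge0 //= ler_pdivrMr // mul1r ler_nat.
Qed.

Let grid_gt0 k : (0 < k)%N -> 0 < k%:R / n%:R :> R.
Proof. by move=> k0; rewrite divr_gt0 // ltr0n. Qed.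

(** To the left of the last maximizer K, a line of slope a supports at K and forces left slopes of
    at least a. To the right of K, strict maximality leaves room for a supporting line of slightly
    smaller slope, which bounds the slope from K to k strictly below a. *)
Lemma lambda_hat_switch a k : (0 < k <= n)%N ->
  (a <= lambda_hat s (k%:R / n%:R)) = (k <= last_argmax (centered_sum a) n)%N.
Proof.
move=> /andP[k0 kn]; set K := last_argmax _ _.
have Kn : (K <= n)%N := last_argmax_le _ _.
have [b line1] := cusum_support_right.
have /andP[_ k1] : 0 <= (k%:R / n%:R : R) <= 1 by have := grid01 kn; rewrite in_itv.
have /andP[K0 _] : 0 <= (K%:R / n%:R : R) <= 1 by have := grid01 Kn; rewrite in_itv.
have [kK|Kk] := leqP k K.
  have supp := cusum_support Kn (fun j => @last_argmax_max _ (centered_sum a) n j).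
  apply: (left_slope_ge line1) => //; first exact: grid_gt0.
  move=> x x0 xk; apply: (concave_majorant_slope_ge (grid01 Kn) supp) => //.
  by rewrite ler_pM2r ?invr_gt0 // ler_nat.
apply/negbTE; rewrite -ltNge.
(* Only finitely many indices follow K, so the strict inequalities hold with a common gap e. *)
have [e e0 He] : exists2 e, 0 < e & forall j, (K < j <= n)%N ->
    centered_sum a j + e <= centered_sum a K.
  have H j : (K < j <= n)%N -> centered_sum a j < centered_sum a K.
    by move=> /andP[Kj jn]; exact: last_argmax_lt.
  have: forall j, (K < j <= n)%N -> centered_sum a j < centered_sum a K := H.
  move: {H}(n) => p; elim: p => [|p IH] H.
    by exists 1 => // j /andP[Kj]; rewrite leqn0 => /eqP j0; rewrite j0 in Kj.
  have [e e0 He] := IH (fun j h => H j ltac:(lia)).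
  have [Kp|pK] := ltnP K p.+1; last by exists e => // j h; apply: He; lia.
  exists (Num.min e (centered_sum a K - centered_sum a p.+1)).
    by rewrite lt_min e0 subr_gt0 H // Kp leqnn.
  move=> j /andP[Kj]; rewrite leq_eqVlt => /orP[/eqP->|jp].
    by rewrite -lerBrDl ge_min lexx orbT.
  have := He j; rewrite Kj -ltnS jp => /(_ isT) h.
  by rewrite -lerBrDl ge_min; apply/orP; left; rewrite lerBrDl.
(* Lowering the slope by e / n raises a centered sum, relative to the one at K, by at most e, as j -
   K <= n; the gap absorbs this. *)
pose eta := e / n%:R.
have eta0 : 0 < eta by rewrite divr_gt0.
have supp := @cusum_support (a - eta) K Kn.
have {}supp : forall t, t \in `[0, 1] ->
    L t <= L (K%:R / n%:R) + (a - eta) * (t - K%:R / n%:R).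
  apply: supp => j jn.
  have eE : e = eta * n%:R by rewrite /eta divfK // gt_eqF.
  have [Kj|jK] := ltnP K j.
    have := He j; rewrite Kj jn => /(_ isT); rewrite !centered_sumE eE.
    have : j%:R - K%:R <= n%:R :> R.
      by rewrite lerBlDr -natrD ler_nat; lia.
    nra.
  have := @last_argmax_max _ (centered_sum a) n j jn; rewrite -/K !centered_sumE.
  have : j%:R <= K%:R :> R by rewrite ler_nat.
  nra.
have Kk' : K%:R / n%:R < k%:R / n%:R :> R by rewrite ltr_pM2r ?invr_gt0 // ltr_nat.
apply: (le_lt_trans (left_slope_le line1 K0 Kk' k1)).
rewrite (concave_majorant_touch (grid01 Kn) supp) ltr_pdivrMr ?subr_gt0 //.
have := concave_majorant_le_line supp (grid01 kn).
move: Kk'; set x := k%:R / _; set y := K%:R / _ => yx; nra.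
Qed.

End switch_relation.

(** * The inverse estimator as an order statistic *)

Section inverse_estimator.
Variable R : realType.
Implicit Types (s : seq (R * R)) (a t : R).

(** [gen_inv] searches [0, 1] only, whereas an order statistic may leave it on a null event. The
    same map later cuts regression functions off outside [0, 1]. *)
Definition clamp01 (x : R) : R := Num.max 0 (Num.min 1 x).

Lemma clamp01_id x : 0 <= x <= 1 -> clamp01 x = x.
Proof. by move=> /andP[x0 x1]; rewrite /clamp01 (min_r x1) max_r. Qed.

Lemma clamp01_itv x : 0 <= clamp01 x <= 1.
Proof.
by rewrite /clamp01 le_max lexx /= ge_max ler01 /= ge_min lexx.
Qed.

Definition order_stat s j : R := (nth (0, 0) (sort_sample s) j).1.

Lemma size_sort_sample s : size (sort_sample s) = size s.
Proof. exact: size_sort. Qed.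

Lemma sort_sample_sorted s : sorted <=%R (unzip1 (sort_sample s)).
Proof.
rewrite /unzip1 sorted_map; apply: sort_sorted => x y; exact: le_total.
Qed.

Lemma count_lt_order_stat s t j : (j < size s)%N ->
  (count (fun p : R * R => (p.1 < t)%R) s <= j)%N = (t <= order_stat s j).
Proof.
move=> js; have ss := sort_sample_sorted s.
have -> : count (fun p : R * R => p.1 < t) s =
    count (fun x => x < t) (unzip1 (sort_sample s)).
  rewrite count_map; apply/permP; rewrite perm_sym; exact: permEl (perm_sort _ _).
have -> : order_stat s j = nth 0 (unzip1 (sort_sample s)) j.
  by rewrite (nth_map (0, 0)) // size_sort_sample.
apply/idP/idP => h.
  by apply: nth_count_ge => //; rewrite h size_map size_sort_sample.
rewrite leqNgt; apply/negP => jc; have := nth_count_lt 0 ss jc.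
by rewrite ltNge h.
Qed.

(** By the switch relation, [a <= mu_hat s t] says that the level index of t is at most K. This set
    is empty for K = 0, all of [0, 1] for K = n, and otherwise reaches up to X_(K), whose zero-based
    index is K - 1. *)
Lemma gen_inv_mu_hat s a : (0 < size s)%N ->
  let K := last_argmax (centered_sum s a) (size s) in
  gen_inv (mu_hat s) a =
    if K == 0%N then 0 else if K == size s then 1 else clamp01 (order_stat s K.-1).
Proof.
move=> s0 K; have Kn : (K <= size s)%N := last_argmax_le _ _.
have muE t : (a <= mu_hat s t) =
    (minn (count (fun p : R * R => (p.1 < t)%R) s).+1 (size s) <= K)%N.
  rewrite /mu_hat lambda_hat_switch //.
  by rewrite leq_min s0 /= geq_minr.
rewrite /gen_inv; case: ifP => [/eqP K0|/negbT K0].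
  rewrite [X in sup X](_ : _ = set0) ?sup0 //; apply/seteqP; split => t //=.
  by rewrite muE K0 leqn0; lia.
have I01 : has_sup [set t : R | t \in `[0, 1] /\ a <= mu_hat s t] ->
  sup [set t : R | t \in `[0, 1] /\ a <= mu_hat s t] <= 1.
  move=> h; apply: ge_sup; first by case: h.
  by move=> t [/=]; rewrite in_itv /= => /andP[].
have ub : has_ubound [set t : R | t \in `[0, 1] /\ a <= mu_hat s t].
  by exists 1 => t /= [+ _]; rewrite in_itv /= => /andP[].
case: ifP => [/eqP KN|/negbT KN].
  have h1 : [set t : R | t \in `[0, 1] /\ a <= mu_hat s t] 1.
    by split; [rewrite in_itv /= ler01 lexx | rewrite muE KN geq_minr].
  by apply/eqP; rewrite eq_le I01 ?ub_le_sup //; split => //; exists 1.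
have K0' : (0 < K)%N by rewrite lt0n.
have KN' : (K < size s)%N by rewrite ltn_neqAle KN.
have {}muE t : (a <= mu_hat s t) = (t <= order_stat s K.-1).
  rewrite muE -count_lt_order_stat; last by rewrite prednK // ltnW.
  by rewrite geq_min (leqNgt (size s)) KN' orbF -{1}(prednK K0') ltnS.
have [x0|x0] := ltP (order_stat s K.-1) 0.
  rewrite [X in sup X](_ : _ = set0) ?sup0.
    by rewrite /clamp01 max_l // ge_min (ltW x0) orbT.
  apply/seteqP; split => t //=; rewrite muE in_itv /= => -[/andP[t0 _] tx].
  by have := le_trans t0 tx; rewrite leNgt x0.
rewrite /clamp01 max_r; last by rewrite le_min ler01 x0.
have h1 : [set t : R | t \in `[0, 1] /\ a <= mu_hat s t]
    (Num.min 1 (order_stat s K.-1)).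
  by split; rewrite ?muE ?in_itv /= ?ge_min ?le_min ?lexx ?ler01 ?x0 ?orbT.
apply/eqP; rewrite eq_le ub_le_sup // andbT; apply: ge_sup.
  by exists (Num.min 1 (order_stat s K.-1)).
by move=> t [/=]; rewrite muE in_itv /= le_min => /andP[_ ->].
Qed.

Lemma gen_inv_itv (h : R -> R) a : 0 <= gen_inv h a <= 1.
Proof.
rewrite /gen_inv; set A := [set _ | _].
have ubA : ubound A 1 by move=> t /= [+ _]; rewrite in_itv /= => /andP[].
have [->|/set0P[t At]] := eqVneq A set0; first by rewrite sup0 lexx ler01.
apply/andP; split; last by apply: ge_sup => //; exists t.
apply: le_trans (ub_le_sup _ At); last by exists 1.
by case: At => /=; rewrite in_itv /= => /andP[].
Qed.

Lemma sorted_order_stat s i j : (i <= j)%N -> (j < size s)%N ->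
  order_stat s i <= order_stat s j.
Proof.
move=> ij js; have ss := sort_sample_sorted s.
have e l : (l < size s)%N -> order_stat s l = nth 0 (unzip1 (sort_sample s)) l.
  by move=> ls; rewrite (nth_map (0, 0)) // size_sort_sample.
rewrite !e //; last exact: leq_ltn_trans js.
apply: sorted_leq_nth => //; first exact: le_trans.
- by rewrite inE size_map size_sort_sample (leq_ltn_trans ij).
- by rewrite inE size_map size_sort_sample.
Qed.

(* The inverse estimator separates the sorted sample at an index maximizing the
   centered partial sums. *)
Lemma gen_inv_mu_hat_split s a : (0 < size s)%N ->
  (forall j, (j < size s)%N -> 0 <= order_stat s j <= 1) ->
  exists K, [/\ (K <= size s)%N,
    forall j, (j <= size s)%N -> centered_sum s a j <= centered_sum s a K,
    forall j, (j < K)%N -> order_stat s j <= gen_inv (mu_hat s) a &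
    forall j, (K <= j < size s)%N -> gen_inv (mu_hat s) a <= order_stat s j].
Proof.
move=> s0 s01; have := gen_inv_mu_hat a s0 => /=.
set K := last_argmax _ _ => gE; exists K.
have Kn : (K <= size s)%N := last_argmax_le _ _.
split => // [j|j jK|j /andP[Kj js]]; first exact: last_argmax_max.
- have js : (j < size s)%N by exact: leq_trans Kn.
  rewrite gE; case: ifP => [/eqP K0|/negbT K0]; first by rewrite K0 in jK.
  case: ifP => [_|/negbT KN]; first by case/andP: (s01 j js).
  rewrite clamp01_id; last by apply: s01; lia.
  by apply: sorted_order_stat; lia.
- rewrite gE; case: ifP => [_|/negbT K0]; first by case/andP: (s01 j js).
  case: ifP => [/eqP KN|/negbT KN]; first by lia.
  rewrite clamp01_id; last by apply: s01; lia.
  by apply: sorted_order_stat; lia.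
Qed.

End inverse_estimator.

(** * Pathwise inequalities for partial sums *)

Section partial_sums.
Variable R : realType.
Implicit Types (W e u z : nat -> R).

Fixpoint running_max W n : R :=
  if n is m.+1 then Num.max (running_max W m) (W n) else W 0%N.

Lemma running_max_ge W n k : (k <= n)%N -> W k <= running_max W n.
Proof.
elim: n => [|n IH] /=; first by rewrite leqn0 => /eqP->.
by rewrite leq_eqVlt le_max => /orP[/eqP->|/IH->//]; rewrite lexx orbT.
Qed.

Lemma eq_running_max W1 W2 n : (forall k, (k <= n)%N -> W1 k = W2 k) ->
  running_max W1 n = running_max W2 n.
Proof.
elim: n => [|n IH] /= H; first exact: H.
by rewrite H // IH // => k /leqW; exact: H.
Qed.

Definition partial_sum e n : R := \sum_(0 <= j < n) e j.

Lemma running_max_partial_sum_ge0 e n : 0 <= running_max (partial_sum e) n.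
Proof.
by apply: le_trans (running_max_ge (partial_sum e) (leq0n n)); rewrite /partial_sum big_geq.
Qed.

(* Pathwise form of Doob's maximal inequality: the second sum is a martingale
   transform of e. *)
Lemma running_max_sqr_le e n :
  running_max (partial_sum e) n ^+ 2 <= 4 * (\sum_(j < n) e j ^+ 2) +
    \sum_(j < n) (8 * partial_sum e j - 4 * running_max (partial_sum e) j) * e j.
Proof.
set W := partial_sum e; set M := running_max W.
have WS k : W k.+1 = W k + e k by rewrite /W /partial_sum big_nat_recr.
have W0 : W 0%N = 0 by rewrite /W /partial_sum big_geq.
(* Summation by parts. The induction step is an equality when the maximum is not raised; otherwise
   the square of its jump is discarded. *)
have h1 : M n ^+ 2 <= 2 * M n * W n - 2 * \sum_(j < n) M j * e j.
  elim: n => [|n IH]; first by rewrite big_ord0 /M /= W0; lra.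
  rewrite big_ord_recr /= {1 2}/M /= -/M; move: IH; rewrite WS.
  set S := \sum_(_ < _) _; move: (M n) (W n) S (e n) => m w S x IH.
  rewrite /Num.max; case: ifP => _; last by nra.
  have : 0 <= (m - (w + x)) ^+ 2 by exact: sqr_ge0.
  nra.
have h2 : W n ^+ 2 = \sum_(j < n) e j ^+ 2 + 2 * \sum_(j < n) W j * e j.
  elim: {h1}n => [|n IH]; first by rewrite !big_ord0 W0; ring.
  by rewrite !big_ord_recr /= WS sqrrD IH; ring.
have -> : \sum_(j < n) (8 * W j - 4 * M j) * e j =
    8 * \sum_(j < n) W j * e j - 4 * \sum_(j < n) M j * e j.
  rewrite !mulr_sumr -sumrB; apply: eq_bigr => j _; ring.
move: h1 h2; set A := \sum_(_ < _) _; set B := \sum_(_ < _) _; set D := \sum_(_ < _) _.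
(* This bounds 2 M W by M^2 / 2 + 2 W^2, whence M^2 <= 4 W^2 - 4 sum M e: the constant 4 of Doob's
   inequality. *)
have : 0 <= (M n - 2 * W n) ^+ 2 by exact: sqr_ge0.
by move: (M n) (W n) => m w; nra.
Qed.

(* If the maximizer K of the partial sums of u = e - c z is located at distance
   D in (tau, 2 tau], then the noise e has to beat the drift c z. *)
Lemma argmax_drift_le n K z e u (D c tau : R) : 0 < c -> 0 < tau -> (K <= n)%N ->
  (forall j, (j <= n)%N -> partial_sum u j <= partial_sum u K) ->
  (forall i j, (i <= j)%N -> (j < n)%N -> z i <= z j) ->
  (forall j, (j < K)%N -> z j <= D) ->
  (forall j, (K <= j < n)%N -> D <= z j) ->
  (forall j, (j < n)%N -> 0 < z j -> u j <= e j - c * z j) ->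
  tau < D -> D <= 2 * tau ->
  c * (tau / 2) * \sum_(j < n) (tau / 2 < z j <= tau)%R%:R <=
  partial_sum (fun j => e j * (0 < z j <= 2 * tau)%R%:R) K.
Proof.
move=> c0 tau0 Kn umax zmono zK Kz ue tauD Dtau.
(* Comparing K with the first index k0 where z is positive shows that the sum of u over the window
   is nonnegative; there the drift bound applies to each term. *)
have [k0 [k0K zk0 k0z]] : exists k0, [/\ (k0 <= K)%N,
    forall j, (j < k0)%N -> z j <= 0 & forall j, (k0 <= j < K)%N -> 0 < z j].
  exists (find (fun j => 0 < z j) (iota 0 K)); split.
  - by rewrite -[leqRHS](size_iota 0) find_size.
  - move=> j jf; have := before_find 0%N jf; rewrite nth_iota ?add0n.
      by move=> /negbT; rewrite -leNgt.
    by rewrite (leq_trans jf) // -[leqRHS](size_iota 0) find_size.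
  - move=> j /andP[fj jK].
    have : has (fun j => 0 < z j) (iota 0 K).
      by rewrite has_find size_iota (leq_ltn_trans fj).
    move=> /(nth_find 0%N); rewrite nth_iota ?add0n; last exact: leq_ltn_trans jK.
    by move=> h; apply: lt_le_trans h _; apply: zmono => //; exact: leq_trans Kn.
have h0 : 0 <= partial_sum (fun j => u j * (0 < z j <= 2 * tau)%R%:R) K.
  have := umax k0 (leq_trans k0K Kn).
  rewrite /partial_sum (big_cat_nat (leq0n k0) k0K) /=.
  rewrite [X in _ -> 0 <= X](big_cat_nat (leq0n k0) k0K) /= lerDl => h.
  rewrite addr_ge0 //.
    rewrite big_nat big1 // => j /andP[_ jk]; rewrite ltNge zk0 //= mulr0 //.
  rewrite big_nat (eq_bigr u) -?big_nat // => j /andP[kj jK].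
  rewrite k0z ?kj // (le_trans (zK j jK) Dtau) mulr1 //.
rewrite mulr_sumr -(big_mkord xpredT (fun j => c * (tau / 2) * (tau / 2 < z j <= tau)%R%:R)).
(* From K on, z is at least D > tau, so nothing is counted there. *)
rewrite (big_cat_nat (leq0n K) Kn) /= [X in _ + X]big_nat [X in _ + X]big1; last first.
  move=> j /Kz Dz; have -> : z j <= tau = false; last by rewrite andbF mulr0.
  by apply/negbTE; rewrite -ltNge (lt_le_trans tauD).
rewrite addr0 -subr_ge0; apply: le_trans h0 _.
rewrite /partial_sum -sumrB big_nat [leRHS]big_nat.
apply: ler_sum => j /andP[_ jK].
have := ue j (leq_trans jK Kn).
have [z0|] := ltP 0 (z j); last first.
  move=> z0 _; rewrite /= !mulr0 ltNge (le_trans z0) ?mulr0 ?subr0 //.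
  by rewrite divr_ge0 // ltW.
move=> /(_ isT) uj.
have -> : z j <= 2 * tau by exact: le_trans (zK _ jK) Dtau.
rewrite !mulr1.
have cz : 0 <= c * z j by rewrite mulr_ge0 // ltW.
have [/andP[h1 h2]|_] := boolP (tau / 2 < z j <= tau); last by rewrite mulr0; lra.
have : c * (tau / 2) <= c * z j by rewrite ler_pM2l // ltW.
rewrite mulr1; lra.
Qed.

End partial_sums.

(** * Measurability and independence *)

Section countably_valued_functions.
Context d (S : measurableType d).

(** Sample orders and maximizing indices are countably valued. Level sets express their
    measurability without a sigma-algebra on the target type. *)
Definition measurable_level_sets (I : Type) (f : S -> I) :=
  forall i, measurable [set w | f w = i].

Lemma measurable_level_sets_cst (I : Type) (i : I) :
  measurable_level_sets (fun=> i).
Proof.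
move=> j; have [ij|ij] := pselect (i = j).
  by rewrite [X in measurable X](_ : _ = setT) //; apply/seteqP; split.
by rewrite [X in measurable X](_ : _ = set0) //; apply/seteqP; split.
Qed.

Lemma measurable_countable_cases d' (T' : measurableType d') (I : countType)
    (f : S -> I) (g : I -> S -> T') : measurable_level_sets f ->
  (forall i, measurable_fun setT (g i)) ->
  measurable_fun setT (fun w => g (f w) w).
Proof.
move=> mf mg _ A mA; rewrite setTI.
rewrite [X in measurable X](_ : _ =
    \bigcup_i ([set w | f w = i] `&` (g i @^-1` A))); last first.
  by apply/seteqP; split=> w /= => [h|[i _ [<-]]//]; exists (f w).
apply: countable_bigcupT_measurable => // i.
by apply: measurableI => //; rewrite -[X in measurable X]setTI; exact: mg.
Qed.

Lemma measurable_level_sets_cases (I : countType) (J : Type)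
    (f : S -> I) (g : I -> S -> J) : measurable_level_sets f ->
  (forall i, measurable_level_sets (g i)) ->
  measurable_level_sets (fun w => g (f w) w).
Proof.
move=> mf mg j.
rewrite [X in measurable X](_ : _ =
    \bigcup_i ([set w | f w = i] `&` [set w | g i w = j])); last first.
  by apply/seteqP; split=> w /= => [h|[i _ [<-]]//]; exists (f w).
apply: countable_bigcupT_measurable => // i.
by apply: measurableI => //; exact: mg.
Qed.

Lemma measurable_level_sets_bool (f : S -> bool) :
  measurable_fun setT f -> measurable_level_sets f.
Proof.
by move=> mf b; rewrite -[X in measurable X]setTI; exact: (mf measurableT [set b]).
Qed.

Lemma measurable_level_sets_ffun (I : finType) (f : I -> S -> bool) :
  (forall i, measurable_fun setT (f i)) ->
  measurable_level_sets (fun w => [ffun i => f i w]).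
Proof.
move=> mf b.
rewrite [X in measurable X](_ : _ = \bigcap_(i in setT) [set w | f i w = b i]).
  apply: fin_bigcap_measurable => // i _.
  exact: measurable_level_sets_bool.
apply/seteqP; split=> w /= => [<- i _ /=|h]; first by rewrite ffunE.
by apply/ffunP => i; rewrite ffunE; exact: h.
Qed.

End countably_valued_functions.

Section sample_order.
Variable R : realType.

Definition sample_order (x : nat -> R) k n : seq nat :=
  sort (fun i j => x i <= x j) (iota k n).

Lemma sample_order_perm x k n : perm_eq (sample_order x k n) (iota k n).
Proof. exact: permEl (perm_sort _ _). Qed.

Lemma size_sample_order x k n : size (sample_order x k n) = n.
Proof. by rewrite size_sort size_iota. Qed.

Lemma sort_sampleE (x y : nat -> R) k n :
  sort_sample [seq (x i, y i) | i <- iota k n] =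
  [seq (x i, y i) | i <- sample_order x k n].
Proof. exact: sort_map. Qed.

Lemma order_statE (x y : nat -> R) k n j : (j < n)%N ->
  order_stat [seq (x i, y i) | i <- iota k n] j = x (nth 0%N (sample_order x k n) j).
Proof.
by move=> jn; rewrite /order_stat sort_sampleE (nth_map 0%N) ?size_sample_order.
Qed.

Lemma ordered_obsE (x y : nat -> R) k n j : (j < n)%N ->
  ordered_obs [seq (x i, y i) | i <- iota k n] j = y (nth 0%N (sample_order x k n) j).
Proof.
by move=> jn; rewrite /ordered_obs sort_sampleE (nth_map 0%N) ?size_sample_order.
Qed.

Lemma centered_sum_sample (x y : nat -> R) a k n j : (j <= n)%N ->
  centered_sum [seq (x i, y i) | i <- iota k n] a j =
  partial_sum (fun i => y (nth 0%N (sample_order x k n) i) - a) j.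
Proof.
move=> jn; rewrite /centered_sum /partial_sum big_mkord; apply: eq_bigr => i _.
by rewrite ordered_obsE // (leq_trans (ltn_ord i)).
Qed.

End sample_order.

Section measurability_of_the_estimator.
Context d (S : measurableType d) (R : realType).
Implicit Types x y : nat -> S -> R.

Lemma measurable_last_argmax (W : nat -> S -> R) n :
  (forall i, measurable_fun setT (W i)) ->
  measurable_level_sets (fun w => last_argmax (W ^~ w) n).
Proof.
move=> mW; elim: n => [|n IH] /=; first exact: measurable_level_sets_cst.
apply: (measurable_level_sets_cases
  (g := fun K w => if W K w <= W n.+1 w then n.+1 else K) IH) => K.
apply: (measurable_level_sets_cases
  (f := fun w => W K w <= W n.+1 w) (g := fun b _ => if b then n.+1 else K)).
  by apply: measurable_level_sets_bool; exact: measurable_fun_ler.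
by move=> b; exact: measurable_level_sets_cst.
Qed.

(** The order is a function of the finite table of comparisons x_i <= x_j. Indices are moved to
    ordinals so that this table is a finite function. *)
Lemma measurable_sample_order x k n : (forall i, measurable_fun setT (x i)) ->
  measurable_level_sets (fun w => sample_order (x ^~ w) k n).
Proof.
move=> mx; pose N := (k + n)%N.
have iotaE : iota k n = [seq nat_of_ord i | i <- [seq inord i : 'I_N.+1 | i <- iota k n]].
  rewrite -map_comp -[LHS]map_id; apply/eq_in_map => i.
  by rewrite mem_iota /N => /andP[_ ik] /=; rewrite inordK // ltnS ltnW.
pose C w := [ffun p : 'I_N.+1 * 'I_N.+1 => x p.1 w <= x p.2 w].
rewrite [X in measurable_level_sets X](_ : _ = (fun w =>
    [seq nat_of_ord i | i <- sort (fun i j => C w (i, j))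
      [seq inord i : 'I_N.+1 | i <- iota k n]])); last first.
  apply/funext => w; rewrite /sample_order {1}iotaE sort_map; congr map.
  by congr sort; apply/funext => i; apply/funext => j; rewrite /C ffunE.
apply: (measurable_level_sets_cases (f := C) (g := fun b _ =>
    [seq nat_of_ord i | i <- sort (fun i j => b (i, j))
      [seq inord i : 'I_N.+1 | i <- iota k n]])) => [|b].
  by apply: measurable_level_sets_ffun => i; exact: measurable_fun_ler.
exact: measurable_level_sets_cst.
Qed.

Lemma measurable_clamp01 (f : S -> R) : measurable_fun setT f ->
  measurable_fun setT (fun w => clamp01 (f w)).
Proof. by move=> mf; apply: measurable_maxr => //; exact: measurable_minr. Qed.

(** Once the sample order and the maximizing index are frozen, the estimator is a constant or a
    clamped coordinate; both take countably many values. *)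
Lemma measurable_gen_inv_mu_hat x y a k n :
  (forall i, measurable_fun setT (x i)) -> (forall i, measurable_fun setT (y i)) ->
  measurable_fun setT
    (fun w => gen_inv (mu_hat [seq (x i w, y i w) | i <- iota k n]) a).
Proof.
move=> mx my; have [->|n0] := posnP n.
  rewrite /=; exact: (@measurable_cst _ _ _ _ setT (gen_inv (mu_hat [::]) a)).
pose KK q w := last_argmax (partial_sum (fun i => y (nth 0%N q i) w - a)) n.
rewrite [X in measurable_fun _ X](_ : _ = (fun w =>
    let q := sample_order (x ^~ w) k n in
    let K := KK q w in
    if K == 0%N then 0 else if K == n then 1 else clamp01 (x (nth 0%N q K.-1) w))).
  apply: (measurable_countable_cases (f := fun w => sample_order (x ^~ w) k n)
    (g := fun q w => let K := KK q w in
    if K == 0%N then 0 else if K == n then 1 else clamp01 (x (nth 0%N q K.-1) w))).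
    exact: measurable_sample_order.
  move=> q; apply: (measurable_countable_cases (f := KK q) (g := fun K w =>
    if K == 0%N then 0 else if K == n then 1 else clamp01 (x (nth 0%N q K.-1) w))).
    apply: (measurable_last_argmax (W := fun j w => partial_sum (fun i => y (nth 0%N q i) w - a) j)).
    by move=> j; rewrite /partial_sum; apply: measurable_sum => i; apply: measurable_funB.
  move=> K; case: (K == 0%N); first exact: measurable_cst.
  case: (K == n); first exact: measurable_cst.
  exact: measurable_clamp01.
apply/funext => w /=; rewrite gen_inv_mu_hat ?size_map ?size_iota //=.
have KE : last_argmax (centered_sum [seq (x i w, y i w) | i <- iota k n] a) n =
    KK (sample_order (x ^~ w) k n) w.
  apply: eq_last_argmax => j jn.
  exact: (@centered_sum_sample _ (x ^~ w) (y ^~ w)).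
rewrite KE; set K := KK _ _; case: ifP => // /negbT K0; case: ifP => // /negbT KN.
rewrite (@order_statE _ (x ^~ w) (y ^~ w)) //.
have : (K <= n)%N by exact: last_argmax_le.
by move: K0 KN; clearbody K; lia.
Qed.

End measurability_of_the_estimator.

(** * Integrating out one independent variable *)

Section integrating_out_one_variable.
Context {R : realType} {d : measure_display} {T : measurableType d}.
Variable P : probability T R.
Variables (I : choiceType) (Z : I -> {RV P >-> R}).
Hypothesis ind : mutually_independent Z.
Variable k : I.

Definition other_rectangles : set (set T) :=
  [set B | exists (J : {fset I}) (A : I -> set R),
    [/\ k \notin J, forall i, measurable (A i) &
        B = \bigcap_(i in [set` J]) (Z i @^-1` A i)]].

Local Notation G := other_rectangles.

(** The space T with the sigma-algebra generated by the [Z i], i != k. Measurability of a function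
    on this type encodes that it does not involve [Z k]. *)
Definition other_type := g_sigma_algebraType G.

Lemma other_rectangles_setI : setI_closed G.
Proof.
move=> _ _ [J1 [A1 [k1 mA1 ->]]] [J2 [A2 [k2 mA2 ->]]].
exists (J1 `|` J2)%fset, (fun i => (if i \in J1 then A1 i else setT) `&`
  (if i \in J2 then A2 i else setT)); split.
- by rewrite in_fsetU negb_or k1.
- by move=> i; apply: measurableI; case: ifP.
- apply/seteqP; split=> w /=.
    move=> [h1 h2] i /= _; split; case: ifP => // iJ; [exact: h1|exact: h2].
  move=> h; split=> i /= iJ; have := h i; rewrite /= in_fsetU iJ ?orbT => /(_ isT).
    by case.
  by case.
Qed.

Lemma other_rectanglesT : G setT.
Proof.
exists fset0, (fun=> setT); split => //.
by apply/seteqP; split=> // w _ i; rewrite /= in_fset0.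
Qed.

Lemma other_rectangles_measurable : G `<=` measurable.
Proof.
move=> _ [J [A [_ mA ->]]]; apply: fin_bigcap_measurable => //.
by move=> i _; rewrite -[X in measurable X]setTI; exact: measurable_funP.
Qed.

Lemma sub_other_measurable : <<s G >> `<=` (measurable : set (set T)).
Proof.
exact: (smallest_sub (@sigma_algebra_measurable _ T) other_rectangles_measurable).
Qed.

Lemma measurable_other i : i != k -> measurable_fun setT (Z i : other_type -> R).
Proof.
move=> ik _ A mA; rewrite setTI; apply: sub_sigma_algebra.
exists [fset i]%fset, (fun=> A); split => //; first by rewrite in_fset1 eq_sym.
by apply/seteqP; split=> w /= => [h j|]; [rewrite /= in_fset1 => /eqP->|apply; rewrite /= in_fset1].
Qed.

(** For fixed A both sides are finite measures in B, and they agree on the rectangles, which are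
    stable under intersection and generate the sigma-algebra. *)
Lemma other_independent B A : <<s G >> B -> measurable A ->
  P (B `&` (Z k @^-1` A)) = (P B * P (Z k @^-1` A))%E.
Proof.
move=> sB mA.
have mkA : measurable (Z k @^-1` A).
  by rewrite -[X in measurable X]setTI; exact: measurable_funP.
have p0 : (0 <= fine (P (Z k @^-1` A)))%R by exact: fine_ge0.
have pE : (fine (P (Z k @^-1` A)))%:E = P (Z k @^-1` A).
  by rewrite fineK // fin_num_measure.
transitivity (mscale (NngNum p0) P B); last first.
  by rewrite muleC -[X in _ = (X * _)%E]pE.
apply: (@g_sigma_algebra_measure_unique d R T G other_rectangles_measurable
  (fun=> setT) (fun=> other_rectanglesT) _ (mrestr P mkA)
  (mscale (NngNum p0) P) other_rectangles_setI _ _ B sB).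
- by apply/seteqP; split => // w _; exists 0%N.
- move=> _ [J [A' [kJ mA' ->]]];
  transitivity (P (Z k @^-1` A) * P (\bigcap_(i in [set` J]) (Z i @^-1` A' i)))%E;
    last by rewrite -[X in (X * _)%E = _]pE.
  rewrite /mrestr /=.
  (* Independence is used for J and for J together with k; comparing the two products gives the
     factorization. *)
  have := ind (J := J) (fun i _ => mA' i).
  have mA'' i : i \in (k |` J)%fset ->
      measurable ((fun i => if i == k then A else A' i) i).
    by move=> _ /=; case: ifP.
  have := ind mA''.
  have -> : \bigcap_(i in [set` (k |` J)%fset])
      (Z i @^-1` (if i == k then A else A' i)) =
      \bigcap_(i in [set` J]) (Z i @^-1` A' i) `&` (Z k @^-1` A).
    apply/seteqP; split=> w /= => [h|[h1 h2] i].
      split=> [i /= iJ|]; last by have := h k; rewrite /= fset1U1 eqxx => /(_ isT).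
      have := h i; rewrite /= in_fset1U iJ orbT => /(_ isT).
      by case: eqP => // ik; move: kJ; rewrite -ik iJ.
    rewrite /= in_fset1U => /orP[/eqP->|iJ]; first by rewrite eqxx.
    case: eqP => [ik|_]; last exact: h1.
    by move: kJ; rewrite -ik iJ.
  rewrite big_fsetU1 //= eqxx => e1 e2; apply: (etrans e1).
  rewrite e2; congr (_ * _)%E.
  rewrite big_seq [RHS]big_seq; apply: eq_bigr => i iJ.
  by case: eqP => // ik; move: kJ; rewrite -ik iJ.
- by move=> _; exact: (le_lt_trans (probability_le1 P (measurableI _ _ measurableT mkA)) (ltry 1)).
Qed.

(** The identity into the coarser space; its distribution is the restriction of P to events that do
    not involve [Z k]. *)
Let id_other : T -> other_type := id.

Let measurable_id_other : measurable_fun setT id_other.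
Proof. by move=> _ A mA; rewrite setTI; exact: sub_other_measurable. Qed.

Let id_mfun := isMeasurableFun.Build _ _ _ _ _ measurable_id_other.
Let id_pack : {mfun T >-> other_type} := HB.pack id_other id_mfun.

Let joint (w : T) : other_type * R := (w, Z k w).

Let measurable_joint : measurable_fun setT joint.
Proof.
apply: measurable_fun_pair; first exact: measurable_id_other.
exact: measurable_funP.
Qed.

Let joint_mfun := isMeasurableFun.Build _ _ _ _ _ measurable_joint.
Let joint_pack : {mfun T >-> (other_type * R)%type} := HB.pack joint joint_mfun.

Local Open Scope ereal_scope.

(** The joint law of the other variables and of [Z k] is the product of the two laws, so Tonelli's
    theorem plays the part of conditioning. *)
Lemma integral_other (H : other_type * R -> \bar R) :
  measurable_fun setT H -> (forall z, 0 <= H z) ->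
  \int[P]_w H (w, Z k w) = \int[P]_w \int[distribution P (Z k)]_e H (w, e).
Proof.
move=> mH H0.
pose P1 := distribution P id_pack : probability other_type R.
pose P2 := distribution P joint_pack : probability (other_type * R)%type R.
pose Q := distribution P (Z k) : probability R R.
have h1 : \int[P2]_z H z = \int[P]_w H (w, Z k w).
  by rewrite ge0_integral_pushforward.
have h2 : \int[P1]_w \int[Q]_e H (w, e) = \int[P]_w \int[Q]_e H (w, e).
  rewrite ge0_integral_pushforward //.
  - exact: (@measurable_fun_fubini_tonelli_F _ _ _ _ R Q H mH H0).
  - by move=> w _; exact: integral_ge0.
rewrite -h1 -h2 -(@fubini_tonelli1 _ _ _ _ R P1 Q H mH H0).
apply: eq_measure_integral => X mX _.
apply/esym; apply: product_measure_unique => // A B mA mB.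
exact: other_independent.
Qed.

End integrating_out_one_variable.

(** * The normal law and the noise *)

Section lower_integral.
Local Open Scope ereal_scope.
Context d (T : measurableType d) (R : realType).
Variable mu : {measure set T -> \bar R}.

Import HBNNSimple.

(* f need not be measurable: its integral is a lower integral. *)
Lemma le_lower_integral (N : set T) (f g : T -> \bar R) :
  measurable N -> mu N = 0 -> measurable_fun setT g ->
  (forall x, 0 <= f x) -> (forall x, 0 <= g x) ->
  (forall x, ~ N x -> f x <= g x) -> \int[mu]_x f x <= \int[mu]_x g x.
Proof.
move=> mN N0 mg f0 g0 fg; rewrite (ge0_integralTE mu f0).
apply: ge_ereal_sup => _ [h /= hf <-].
have -> : sintegral mu h = \int[mu]_x (h x)%:E by rewrite integralT_nnsfun.
apply: ae_ge0_le_integral => //.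
- by move=> x _; rewrite lee_fin.
- exact/measurable_EFinP.
- exists N; split => // x /=; apply: contra_notP => Nx _.
  exact: le_trans (hf x) (fg x Nx).
Qed.

End lower_integral.

Section normal_law.
Context {R : realType}.
Variable v : R.
Hypothesis v0 : 0 < v.
Local Notation mu := (@lebesgue_measure R).
Local Notation N := (normal_prob 0 v).
Local Open Scope ereal_scope.
Implicit Type f : R -> \bar R.

Let v_neq0 : v != 0%R. Proof. by rewrite gt_eqF. Qed.

(** The Radon-Nikodym derivative and the explicit density have the same integrals over measurable
    sets, hence agree almost everywhere. *)
Lemma integral_normal f : measurable_fun setT f -> (forall x, 0 <= f x) ->
  \int[N]_x f x = \int[mu]_x (f x * (normal_pdf 0 v x)%:E).
Proof.
move=> mf f0; have dom := normal_prob_dominates 0 v.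
rewrite -(Radon_Nikodym_SigmaFinite.change_of_variables dom) //.
have mpdf : measurable_fun setT (fun x : R => (normal_pdf 0 v x)%:E).
  by apply/measurable_EFinP; exact: measurable_normal_pdf.
have iRN := Radon_Nikodym_SigmaFinite.f_integrable dom.
apply: ae_eq_integral => //.
- by apply: emeasurable_funM => //; exact: measurable_int iRN.
- exact: emeasurable_funM.
- apply: ae_eqe_mul2l; apply: integral_ae_eq => // E _ mE.
  by rewrite -Radon_Nikodym_SigmaFinite.f_integral.
Qed.

Lemma lebesgue_integral_shift f t : measurable_fun setT f -> (forall x, 0 <= f x) ->
  \int[mu]_x f (x + t)%R = \int[mu]_x f x.
Proof.
move=> mf f0; pose s (x : R) : measurableTypeR R := (x + t)%R.
have ms : measurable_fun setT s by exact: measurable_funD.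
transitivity (\int[pushforward mu s]_x f x); first by rewrite ge0_integral_pushforward.
apply: eq_measure_integral => A mA _.
apply/esym/lebesgue_measure_unique => //= _ [[a b]] _ <-.
rewrite /pushforward (_ : s @^-1` _ = `](a - t)%R, (b - t)%R]%classic); last first.
  by apply/seteqP; split=> x; rewrite /s /= !in_itv /= ltrBlDr lerBrDr.
by rewrite /= !lebesgue_measure_itv /= !lte_fin ltrD2r -!EFinB; case: ifP => // _; congr (_%:E); lra.
Qed.

Lemma lebesgue_integral_opp f : measurable_fun setT f -> (forall x, 0 <= f x) ->
  \int[mu]_x f (- x)%R = \int[mu]_x f x.
Proof.
move=> mf f0; pose s (x : R) : measurableTypeR R := (- x)%R.
have ms : measurable_fun setT s by exact: measurable_funN.
transitivity (\int[pushforward mu s]_x f x); first by rewrite ge0_integral_pushforward.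
by apply: eq_measure_integral => A mA _; exact: lebesgue_measureN.
Qed.

(** The density of N(t, v^2) with respect to N(0, v^2). *)
Definition shift_density (t x : R) : R := expR (x * t / v ^+ 2 - t ^+ 2 / (2 * v ^+ 2)).

Lemma measurable_shift_density (t : R) : measurable_fun setT (shift_density t).
Proof. by apply: measurableT_comp => //; apply: measurable_funB => //; do 2 apply: measurable_funM => //. Qed.

Lemma normal_pdf_shift (t x : R) :
  normal_pdf 0 v (x - t) = (shift_density t x * normal_pdf 0 v x)%R.
Proof.
rewrite !normal_pdfE // mulrCA /normal_fun /shift_density -expRD; congr (_ * expR _)%R.
by field.
Qed.

Lemma normal_shift f (t : R) : measurable_fun setT f -> (forall x, 0 <= f x) ->
  \int[N]_x f (x + t)%R = \int[N]_x (f x * (shift_density t x)%:E).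
Proof.
move=> mf f0.
have msh : measurable_fun setT (fun x : R => f (x + t)%R).
  by apply: measurableT_comp => //; exact: measurable_funD.
have msd : measurable_fun setT (fun x : R => (shift_density t x)%:E).
  by apply/measurable_EFinP; exact: measurable_shift_density.
rewrite !integral_normal //; first last.
- by move=> x; rewrite mule_ge0 // lee_fin expR_ge0.
- exact: emeasurable_funM.
transitivity (\int[mu]_x (f (x + t)%R * (normal_pdf 0 v (x + t - t)%R)%:E)).
  by apply: eq_integral => x _; rewrite addrK.
rewrite (@lebesgue_integral_shift (fun x : R => f x * (normal_pdf 0 v (x - t)%R)%:E)).
- by apply: eq_integral => x _; rewrite normal_pdf_shift EFinM muleA.
- apply: emeasurable_funM => //; apply/measurable_EFinP.
  by apply: measurableT_comp; [exact: measurable_normal_pdf|exact: measurable_funB].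
- by move=> x; rewrite mule_ge0 // lee_fin normal_pdf_ge0.
Qed.

Lemma normal_symmetric f : measurable_fun setT f -> (forall x, 0 <= f x) ->
  \int[N]_x f (- x)%R = \int[N]_x f x.
Proof.
move=> mf f0.
have mop : measurable_fun setT (fun x : R => f (- x)%R) by exact: measurableT_comp.
rewrite !integral_normal //.
rewrite -(@lebesgue_integral_opp (fun x : R => f x * (normal_pdf 0 v x)%:E)).
- apply: eq_integral => x _; congr (_ * _%:E).
  by rewrite !normal_pdfE // /normal_fun !subr0 sqrrN.
- by apply: emeasurable_funM => //; apply/measurable_EFinP; exact: measurable_normal_pdf.
- by move=> x; rewrite mule_ge0 // lee_fin normal_pdf_ge0.
Qed.

Lemma integral_shift_density (t : R) : \int[N]_x (shift_density t x)%:E = 1.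
Proof.
transitivity (\int[N]_x (1 * (shift_density t x)%:E)).
  by apply: eq_integral => x _; rewrite mul1e.
rewrite -(@normal_shift (fun=> 1)) //.
have := integral_cst N measurableT 1; rewrite /cst => ->.
by rewrite mul1e; exact: probability_setT.
Qed.

Lemma integral_shift_density_sqr (t : R) :
  \int[N]_x (shift_density t x ^+ 2)%:E = (expR (t ^+ 2 / v ^+ 2))%:E.
Proof.
(* Completing the square: the squared density at t is a constant times the density at 2 t, whose
   integral is 1. *)
transitivity (\int[N]_x ((expR (t ^+ 2 / v ^+ 2))%:E * (shift_density (2 * t) x)%:E)).
  apply: eq_integral => x _; rewrite -EFinM /shift_density -expRD -expRM_natl.
  by congr (expR _)%:E; field.
rewrite ge0_integralZl //.
- by rewrite integral_shift_density mule1.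
- by apply/measurable_EFinP; exact: measurable_shift_density.
- by move=> x _; rewrite lee_fin expR_ge0.
Qed.

Lemma sqr_le_expRD (x : R) : (x ^+ 2 <= 2 * (expR x + expR (- x)))%R.
Proof.
wlog x0 : x / (0 <= x)%R.
  move=> H; have [/H//|x0] := leP 0%R x.
  have := H (- x)%R; rewrite sqrrN opprK addrC; apply; lra.
have := expR_ge1Dxn 1 x0; have := expR_gt0 (- x).
rewrite (_ : 2`!%:R = 2%R :> R) //; lra.
Qed.

(* Comparison with the exponential moments, [t = v ^+ 2] in the density. *)
Lemma integral_normal_sqr : \int[N]_x (x ^+ 2)%:E <= (4 * expR (v ^+ 2 / 2))%:E.
Proof.
have msd t : measurable_fun setT (fun x : R => (shift_density t x)%:E).
  by apply/measurable_EFinP; exact: measurable_shift_density.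
have sd0 t x : 0 <= (shift_density t x)%:E by rewrite lee_fin expR_ge0.
pose c := (2 * expR (v ^+ 2 / 2))%R.
have c0 : (0 <= c)%R by rewrite mulr_ge0 // expR_ge0.
apply: (@le_trans _ _ (\int[N]_x (c%:E * ((shift_density (v ^+ 2) x)%:E +
    (shift_density (- v ^+ 2) x)%:E)))).
  apply: ge0_le_integral => //.
  - by move=> x _; rewrite lee_fin sqr_ge0.
  - by apply/measurable_EFinP; exact: (@measurable_funX _ _ R setT id 2).
  - by apply: emeasurable_funM => //; apply: emeasurable_funD; exact: msd.
  - move=> x _; rewrite -EFinD -EFinM lee_fin /c -mulrA mulrDr /shift_density -!expRD.
    apply: le_trans (sqr_le_expRD x) _; rewrite ler_pM2l // lerD //.
      by rewrite ler_expR le_eqVlt; apply/orP; left; apply/eqP; field.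
    by rewrite ler_expR le_eqVlt; apply/orP; left; apply/eqP; field.
rewrite ge0_integralZl //; first last.
- by move=> x _; rewrite adde_ge0.
- apply: emeasurable_funD; exact: msd.
rewrite (ge0_integralD N measurableT (fun x _ => sd0 _ x) (msd _) (fun x _ => sd0 _ x) (msd _)).
rewrite !integral_shift_density -EFinD -EFinM lee_fin /c; lra.
Qed.

End normal_law.

Lemma integral_probability_cst d (T : measurableType d) (R : realType)
  (P : probability T R) (r : R) : (\int[P]_w r%:E = r%:E)%E.
Proof.
have := integral_cst P measurableT r%:E; rewrite /cst => ->.
by rewrite (_ : _ setT = 1%E) ?mule1 //; exact: probability_setT.
Qed.

Section noise.
Context {R : realType} {d : measure_display} {T : measurableType d}.
Variables (P : probability T R) (X eps : nat -> {RV P >-> R}) (v : R).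
Hypothesis v0 : 0 < v.
Hypothesis noise : regression_noise v X eps.

Definition noise_family (k : nat + nat) : {RV P >-> R} :=
  match k with inl i => X i | inr i => eps i end.

Lemma noise_family_independent : mutually_independent noise_family.
Proof. by case: noise. Qed.

Local Open Scope ereal_scope.

(* [normal_prob] and [uniform_prob] live on [measurableTypeR R], whose display
   differs from that of [R]. *)
Lemma integral_display_change (m : {measure set (measurableTypeR R) -> \bar R})
    (Q : {measure set R -> \bar R}) (f : R -> \bar R) :
  (forall A : set R, measurable A -> Q A = m A) ->
  measurable_fun setT f -> (forall x, 0 <= f x) ->
  \int[Q]_x f x = \int[m]_x f x.
Proof.
move=> Qm mf f0; pose s (x : measurableTypeR R) : R := x.
have ms : measurable_fun setT s by exact: measurable_id.
transitivity (\int[pushforward m s]_x f x); last by rewrite ge0_integral_pushforward.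
by apply: eq_measure_integral => A mA _; rewrite Qm.
Qed.

Lemma integral_out_eps i (H : other_type noise_family (inr i) * R -> \bar R) :
  measurable_fun setT H -> (forall z, 0 <= H z) ->
  \int[P]_w H (w, eps i w) = \int[P]_w \int[normal_prob 0 v]_e H (w, e).
Proof.
move=> mH H0; rewrite (integral_other noise_family_independent mH H0).
apply: eq_integral => w _; apply: integral_display_change => //.
- by case: noise => _ h _; exact: h.
- exact: (@measurable_fun_pair2 _ _ _ _ _ _ H w mH).
Qed.

Lemma integral_out_X i (H : other_type noise_family (inl i) * R -> \bar R) :
  measurable_fun setT H -> (forall z, 0 <= H z) ->
  \int[P]_w H (w, X i w) = \int[P]_w \int[uniform_prob (@ltr01 R)]_e H (w, e).
Proof.
move=> mH H0; rewrite (integral_other noise_family_independent mH H0).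
apply: eq_integral => w _; apply: integral_display_change => //.
- by case: noise => h _ _; exact: h.
- exact: (@measurable_fun_pair2 _ _ _ _ _ _ H w mH).
Qed.

Lemma measurable_other_eps_X i j :
  measurable_fun setT (X j : other_type noise_family (inr i) -> R).
Proof. exact: (@measurable_other _ _ _ _ _ noise_family (inr i) (inl j)). Qed.

Lemma measurable_other_eps_eps i j : j != i ->
  measurable_fun setT (eps j : other_type noise_family (inr i) -> R).
Proof.
by move=> ji; apply: (@measurable_other _ _ _ _ _ noise_family (inr i) (inr j)).
Qed.

Lemma measurable_other_X_X i j : j != i ->
  measurable_fun setT (X j : other_type noise_family (inl i) -> R).
Proof.
by move=> ji; apply: (@measurable_other _ _ _ _ _ noise_family (inl i) (inl j)).
Qed.

Lemma measurable_other_X_eps i j :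
  measurable_fun setT (eps j : other_type noise_family (inl i) -> R).
Proof. exact: (@measurable_other _ _ _ _ _ noise_family (inl i) (inr j)). Qed.

(* By symmetry of the normal law, (g eps_i)^+ and (g eps_i)^- have the same
   expectation when g does not depend on eps_i. *)
Lemma integral_other_mul_eps i (g : T -> R) :
  measurable_fun setT (g : other_type noise_family (inr i) -> R) ->
  P.-integrable setT (fun w => (g w * eps i w)%:E) ->
  \int[P]_w (g w * eps i w)%:E = 0.
Proof.
move=> mg int_ge.
pose H (s : R) (z : other_type noise_family (inr i) * R) : \bar R :=
  (Num.max (s * (g z.1 * z.2)) 0)%:E.
have mH s : measurable_fun setT (H s).
  apply/measurable_EFinP; apply: measurable_maxr => //.
  apply: measurable_funM => //; apply: measurable_funM => //.
  exact: (measurableT_comp mg measurable_fst).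
have H0 s z : 0 <= H s z by rewrite lee_fin le_max lexx orbT.
have HE (s : R) : \int[P]_w H s (w, eps i w) =
    \int[P]_w \int[normal_prob 0 v]_e H s (w, e).
  by rewrite (@integral_out_eps i (H s)).
have pE : \int[P]_w ((fun w => (g w * eps i w)%:E)^\+ w) =
    \int[P]_w H 1%R (w, eps i w).
  by apply: eq_integral => w _; rewrite funeposE /H mul1r EFin_max.
have fin : \int[P]_w H 1%R (w, eps i w) \is a fin_num.
  by rewrite -pE; exact: integrable_pos_fin_num.
transitivity (\int[P]_w H 1%R (w, eps i w) - \int[P]_w H (-1)%R (w, eps i w)).
  rewrite integralE pE; congr (_ - _).
  by apply: eq_integral => w _; rewrite funenegE /H mulN1r EFin_max.
have -> : \int[P]_w H (-1)%R (w, eps i w) = \int[P]_w H 1%R (w, eps i w).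
  rewrite !HE; apply: eq_integral => w _.
  rewrite -(normal_symmetric v0 (f := fun e => H 1%R (w, e))) //.
    by apply: eq_integral => e _; rewrite /H /= mulN1r mul1r mulrN.
  exact: (@measurable_fun_pair2 _ _ _ _ _ _ (H 1%R) w (mH 1%R)).
by rewrite subee.
Qed.

Let V : R := (4 * expR (v ^+ 2 / 2))%R.

Lemma integral_eps_sqr_mul i (h : R -> R) (q : R) : measurable_fun setT h ->
  (forall x, 0 <= h x)%R -> \int[P]_w (h (X i w))%:E <= q%:E ->
  \int[P]_w (eps i w ^+ 2 * h (X i w))%:E <= (V * q)%:E.
Proof.
move=> mh h0 hq.
pose H (z : other_type noise_family (inr i) * R) : \bar R := (z.2 ^+ 2 * h (X i z.1))%:E.
have mhX : measurable_fun setT (fun w : other_type noise_family (inr i) => h (X i w)).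
  by apply: (measurableT_comp mh); exact: measurable_other_eps_X.
have mhX' : measurable_fun setT (fun w => h (X i w)).
  by apply: (measurableT_comp mh); exact: measurable_funP.
have mH : measurable_fun setT H.
  apply/measurable_EFinP; apply: measurable_funM; first exact: measurable_funX.
  exact: (measurableT_comp mhX measurable_fst).
have H0 z : 0 <= H z by rewrite lee_fin mulr_ge0 // sqr_ge0.
have msq : measurable_fun setT (fun x : R => (x ^+ 2)%:E).
  by apply/measurable_EFinP; exact: measurable_funX.
have hX0 w : 0 <= (h (X i w))%:E by rewrite lee_fin.
have sq0 (e : R) : 0 <= (e ^+ 2)%:E by rewrite lee_fin sqr_ge0.
have V0 : 0 <= V%:E by rewrite lee_fin mulr_ge0 // expR_ge0.
have intH w : \int[normal_prob 0 v]_e H (w, e) =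
    \int[normal_prob 0 v]_e (e ^+ 2)%:E * (h (X i w))%:E.
  rewrite -(ge0_integralZr (normal_prob 0 v) measurableT msq (fun e _ => sq0 e) (hX0 w)).
  by apply: eq_integral => e _; rewrite -EFinM.
rewrite (integral_out_eps mH H0).
under eq_integral do rewrite intH.
apply: (@le_trans _ _ (\int[P]_w (V%:E * (h (X i w))%:E))).
  apply: ge0_le_integral => //.
  - by move=> w _; rewrite mule_ge0 // integral_ge0.
  - by apply: emeasurable_funM => //; exact/measurable_EFinP.
  - by apply: emeasurable_funM => //; exact/measurable_EFinP.
  - by move=> w _; rewrite lee_wpmul2r //; exact: integral_normal_sqr.
rewrite ge0_integralZl //; last exact/measurable_EFinP.
by rewrite [leRHS]EFinM lee_wpmul2l.
Qed.

Lemma integrable_eps_sqr i : P.-integrable setT (fun w => (eps i w ^+ 2)%:E).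
Proof.
apply/integrableP; split.
  by apply/measurable_EFinP; apply: measurable_funX; exact: measurable_funP.
have h1 : \int[P]_w (cst 1%R (X i w))%:E <= 1%:E.
  by rewrite integral_probability_cst.
apply: (@le_lt_trans _ _ (V * 1)%:E); last exact: ltry.
apply: le_trans (@integral_eps_sqr_mul i (cst 1%R) 1%R _ _ h1) => //.
rewrite le_eqVlt; apply/orP; left; apply/eqP; apply: eq_integral => w _.
by rewrite gee0_abs /= ?lee_fin ?sqr_ge0 // mulr1.
Qed.

End noise.

(** * Maximal inequality and the risk upper bound *)

Section ordered_increments.
Variable R : realType.
Variables (sg : R) (h : R -> R).

Definition increment (x e : nat -> R) (q : seq nat) (j : nat) : R :=
  sg * e (nth 0%N q j) * h (x (nth 0%N q j)).

Definition doob_weight (x e : nat -> R) (q : seq nat) (j : nat) : R :=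
  8 * partial_sum (increment x e q) j -
  4 * running_max (partial_sum (increment x e q)) j.

(** Predictability: the weight at rank j reads only the errors of earlier ranks. *)
Lemma eq_doob_weight x e1 e2 q j :
  (forall l, (l < j)%N -> e1 (nth 0%N q l) = e2 (nth 0%N q l)) ->
  doob_weight x e1 q j = doob_weight x e2 q j.
Proof.
move=> H; have psE k : (k <= j)%N ->
    partial_sum (increment x e1 q) k = partial_sum (increment x e2 q) k.
  move=> kj; rewrite /partial_sum !big_nat; apply: eq_bigr => l lk.
  by rewrite /increment H //; lia.
by rewrite /doob_weight psE //; congr (_ - 4 * _); exact: eq_running_max.
Qed.

(** A crude bound, with 12 = 8 + 4, that serves for integrability only. *)
Lemma doob_weight_le x e q s j : `|sg| = 1 -> (forall y, 0 <= h y <= 1) ->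
  perm_eq q s -> (j <= size q)%N ->
  `|doob_weight x e q j| <= 12 * \sum_(i <- s) `|e i|.
Proof.
move=> sg1 h01 qs jq.
have incr_le l : `|increment x e q l| <= `|e (nth 0%N q l)|.
  have /andP[h0 h1] := h01 (x (nth 0%N q l)).
  by rewrite /increment !normrM sg1 mul1r ler_piMr // ger0_norm.
have ps_le k : (k <= j)%N ->
    `|partial_sum (increment x e q) k| <= \sum_(i <- s) `|e i|.
  move=> kj; rewrite /partial_sum; apply: le_trans (ler_norm_sum _ _ _) _.
  apply: (@le_trans _ _ (\sum_(0 <= l < k) `|e (nth 0%N q l)|)).
    by apply: ler_sum => l _.
  rewrite -(perm_big _ qs) /= [leRHS](big_nth 0%N) [leRHS](big_cat_nat (leq0n k) (leq_trans kj jq)) /=.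
  by rewrite lerDl sumr_ge0.
have mx_le : `|running_max (partial_sum (increment x e q)) j| <= \sum_(i <- s) `|e i|.
  rewrite ger0_norm ?running_max_partial_sum_ge0 //.
  elim: j {jq} ps_le => [|j IH] ps_le /=.
    by apply: le_trans (ler_norm _) _; exact: ps_le.
  rewrite ge_max IH; last by move=> k kj; apply: ps_le; exact: leqW.
  by apply: le_trans (ler_norm _) _; exact: ps_le.
rewrite /doob_weight; apply: le_trans (ler_normB _ _) _; rewrite !normrM.
have := ps_le j (leqnn j); move: mx_le; rewrite !normr_nat; lra.
Qed.

Lemma sum_increment_sqr x e q s : sg ^+ 2 = 1 -> (forall y, h y ^+ 2 = h y) ->
  perm_eq q s ->
  \sum_(j < size q) increment x e q j ^+ 2 = \sum_(i <- s) e i ^+ 2 * h (x i).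
Proof.
move=> sg1 hh qs; rewrite -(perm_big _ qs) /= [RHS](big_nth 0%N) big_mkord.
by apply: eq_bigr => j _; rewrite /increment !exprMn sg1 hh mul1r.
Qed.

(* The summand with index i on the right does not involve e i but through the
   last factor. *)
Lemma sum_doob_weight x e q s : uniq s -> perm_eq q s ->
  \sum_(j < size q) doob_weight x e q j * increment x e q j =
  \sum_(j < size q) \sum_(i <- s) (nth 0%N q j == i)%:R * (sg * h (x i)) *
     doob_weight x (fun l => if l == i then 0 else e l) q j * e i.
Proof.
move=> us qs; apply: eq_bigr => j _.
have uq : uniq q by rewrite (perm_uniq qs).
have js : nth 0%N q j \in s by rewrite -(perm_mem qs) mem_nth.
rewrite (bigD1_seq _ js us) /= eqxx mul1r big1 ?addr0; last first.
  by move=> i; rewrite eq_sym => /negbTE ->; rewrite !mul0r.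
rewrite (@eq_doob_weight x _ e); first by rewrite /increment; ring.
move=> l lj; rewrite nth_uniq ?(ltn_trans lj) // eqn_leq leqNgt.
by case: ltngtP lj => //=; rewrite ?andbF.
Qed.

Lemma running_max_increment_le x e q s : uniq s -> perm_eq q s ->
  sg ^+ 2 = 1 -> (forall y, h y ^+ 2 = h y) ->
  running_max (partial_sum (increment x e q)) (size q) ^+ 2 <=
  4 * (\sum_(i <- s) e i ^+ 2 * h (x i)) +
  \sum_(j < size s) \sum_(i <- s) (nth 0%N q j == i)%:R * (sg * h (x i)) *
     doob_weight x (fun l => if l == i then 0 else e l) q j * e i.
Proof.
move=> us qs sg1 hh; apply: le_trans (running_max_sqr_le _ _) _.
by rewrite (sum_increment_sqr x e sg1 hh qs) -(perm_size qs) -sum_doob_weight.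
Qed.

End ordered_increments.

Section ordered_increments_measurability.
Context d (S : measurableType d) (R : realType).
Variables (sg : R) (h : R -> R) (mh : measurable_fun setT h).

Section coordinates.
Variables (x e : nat -> S -> R).
Hypothesis mx : forall i, measurable_fun setT (x i).
Hypothesis me : forall i, measurable_fun setT (e i).

Lemma measurable_partial_sum_increment q k : measurable_fun setT
  (fun w => partial_sum (increment sg h (x ^~ w) (e ^~ w) q) k).
Proof.
rewrite /partial_sum; apply: measurable_sum => l; rewrite /increment.
apply: measurable_funM; first exact: measurable_funM.
exact: (measurableT_comp mh).
Qed.

Lemma measurable_running_max_increment q k : measurable_fun setT
  (fun w => running_max (partial_sum (increment sg h (x ^~ w) (e ^~ w) q)) k).
Proof.
elim: k => [|k IH] /=; first exact: measurable_partial_sum_increment.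
by apply: measurable_maxr => //; exact: measurable_partial_sum_increment.
Qed.

Lemma measurable_doob_weight q j :
  measurable_fun setT (fun w => doob_weight sg h (x ^~ w) (e ^~ w) q j).
Proof.
apply: measurable_funB; apply: measurable_funM => //.
- exact: measurable_partial_sum_increment.
- exact: measurable_running_max_increment.
Qed.

End coordinates.

End ordered_increments_measurability.

Section maximal_inequality.
Context {R : realType} {d : measure_display} {T : measurableType d}.
Variables (P : probability T R) (X eps : nat -> {RV P >-> R}) (v : R).
Hypothesis v0 : 0 < v.
Hypothesis noise : regression_noise v X eps.

Local Notation V := (4 * expR (v ^+ 2 / 2)).

Variables (s : seq nat) (p : T -> seq nat) (sg : R) (h : R -> R) (q : R).
Hypothesis us : uniq s.
Hypothesis ps : forall w, perm_eq (p w) s.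
Hypothesis mp : forall i,
  measurable_level_sets (p : other_type (noise_family X eps) (inr i) -> seq nat).
Hypothesis sg1 : `|sg| = 1.
Hypothesis mh : measurable_fun setT h.
Hypothesis h01 : forall y, h y = 0 \/ h y = 1.
Hypothesis hq : forall i, (\int[P]_w (h (X i w))%:E <= q%:E)%E.

Let h_itv y : 0 <= h y <= 1.
Proof. by case: (h01 y) => ->; rewrite ?lexx ler01. Qed.

Let hh y : h y ^+ 2 = h y.
Proof. by case: (h01 y) => ->; rewrite ?expr0n ?expr1n. Qed.

(** Setting [eps i] to 0 makes the factor measurable without it. By predictability this changes
    nothing when observation i has rank j, the only case the indicator keeps. *)
Let g i j (w : T) : R := (nth 0%N (p w) j == i)%:R * (sg * h (X i w)) *
  doob_weight sg h (X ^~ w) (fun l => if l == i then 0 else eps l w) (p w) j.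

Let mg i j : measurable_fun setT
  (g i j : other_type (noise_family X eps) (inr i) -> R).
Proof.
pose G q (w : other_type (noise_family X eps) (inr i)) : R :=
  (nth 0%N q j == i)%:R * (sg * h (X i w)) *
  doob_weight sg h (X ^~ w) (fun l => if l == i then 0 else eps l w) q j.
apply: (measurable_countable_cases (g := G) (@mp i)).
move=> q'; apply: measurable_funM.
  apply: measurable_funM => //; apply: measurable_funM => //.
  by apply: (measurableT_comp mh); exact: measurable_other_eps_X.
apply: (measurable_doob_weight (S := other_type (noise_family X eps) (inr i))
  sg mh (x := fun l => X l) (e := fun l w => if l == i then 0 else eps l w)).
  by move=> l; exact: measurable_other_eps_X.
move=> l; case: eqVneq => li; first exact: measurable_cst.
exact: measurable_other_eps_eps.
Qed.

Let mgT i j : measurable_fun setT (g i j).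
Proof.
move=> _ A mA; have := @mg i j measurableT _ mA; rewrite !setTI.
exact: sub_other_measurable.
Qed.

Let integrable_g i j : (j < size s)%N ->
  P.-integrable setT (fun w => (g i j w * eps i w)%:E).
Proof.
move=> js.
apply: (@le_integrable _ _ _ P setT measurableT _
  (fun w => (12 * \sum_(l <- s) (eps l w ^+ 2 + eps i w ^+ 2))%:E)).
- apply/measurable_EFinP; apply: measurable_funM; first exact: mgT.
  exact: measurable_funP.
- move=> w _; rewrite !abse_EFin lee_fin normrM.
  rewrite [leRHS]ger0_norm; last first.
    by rewrite mulr_ge0 // sumr_ge0 // => l _; rewrite addr_ge0 // sqr_ge0.
  apply: (@le_trans _ _ (12 * (\sum_(l <- s) `|eps l w|) * `|eps i w|)).
    rewrite ler_wpM2r // /g normrM.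
    apply: (@le_trans _ _ (1 * (12 * \sum_(l <- s) `|if l == i then 0 else eps l w|))).
      apply: ler_pM => //; last first.
        by apply: doob_weight_le => //; rewrite (perm_size (ps w)) ltnW.
      rewrite !normrM sg1 mul1r; have /andP[h0 h1] := h_itv (X i w).
      by rewrite (ger0_norm h0); case: (_ == _); rewrite /= ?normr1 ?normr0 ?mul1r ?mul0r.
    rewrite mul1r ler_pM2l //; apply: ler_sum => l _.
    by case: ifP => // _; rewrite normr0.
  rewrite -mulrA ler_pM2l // mulr_suml; apply: ler_sum => l _.
  rewrite -(real_normK (num_real (eps l w))) -(real_normK (num_real (eps i w))).
  have : 0 <= (`|eps l w| - `|eps i w|) ^+ 2 by exact: sqr_ge0.
  have : 0 <= `|eps l w| * `|eps i w| by rewrite mulr_ge0.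
  by move: `|eps l w| `|eps i w| => a b; nra.
- under eq_fun do rewrite EFinM -sumEFin.
  apply: integrableZl => //; apply: (integrable_sum measurableT) => l _.
  under eq_fun do rewrite EFinD.
  by apply: integrableD => //; exact: (integrable_eps_sqr v0 noise).
Qed.

(** The pathwise bound is A + B. Each term of B is [eps i] times a factor free of it and integrates
    to 0; A is a sum of squared errors within the window, each of expectation at most V q by
    independence of [X i] and [eps i]. *)
Lemma maximal_inequality :
  (\int[P]_w (running_max (partial_sum (increment sg h (X ^~ w) (eps ^~ w) (p w)))
     (size s) ^+ 2)%:E <= (4 * (size s)%:R * (V * q))%:E)%E.
Proof.
pose A w := 4 * (\sum_(i <- s) eps i w ^+ 2 * h (X i w)).
pose B w := \sum_(j < size s) \sum_(i <- s) g i j w * eps i w.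
have mhX i : measurable_fun setT (fun w => h (X i w)).
  by apply: (measurableT_comp mh); exact: measurable_funP.
have iA : P.-integrable setT (EFin \o A).
  rewrite (_ : EFin \o A =
      fun w => (4%:E * \sum_(i <- s) (eps i w ^+ 2 * h (X i w))%:E)%E); last first.
    by apply/funext => w; rewrite /A /= EFinM -sumEFin.
  apply: integrableZl => //; apply: (integrable_sum measurableT) => i _.
  apply: (@le_integrable _ _ _ P setT measurableT _ (fun w => (eps i w ^+ 2)%:E)).
  - apply/measurable_EFinP; apply: measurable_funM => //.
    by apply: measurable_funX; exact: measurable_funP.
  - move=> w _; have /andP[h0 h1] := h_itv (X i w).
    by rewrite !abse_EFin lee_fin normrM (ger0_norm h0) ler_piMr.
  - exact: (integrable_eps_sqr v0 noise).
have iB : P.-integrable setT (EFin \o B).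
  rewrite (_ : EFin \o B =
      fun w => (\sum_(j < size s) \sum_(i <- s) (g i j w * eps i w)%:E)%E); last first.
    by apply/funext => w; rewrite /B /= -sumEFin; apply: eq_bigr => j _; rewrite -sumEFin.
  apply: (integrable_sum measurableT) => j _.
  by apply: (integrable_sum measurableT) => i _; exact: integrable_g.
have B0 : (\int[P]_w (B w)%:E = 0)%E.
  rewrite (_ : (fun w => (B w)%:E) =
      fun w => (\sum_(j < size s) \sum_(i <- s) (g i j w * eps i w)%:E)%E); last first.
    by apply/funext => w; rewrite /B /= -sumEFin; apply: eq_bigr => j _; rewrite -sumEFin.
  rewrite integral_sum //; last first.
    by move=> j; apply: (integrable_sum measurableT) => i _; exact: integrable_g.
  rewrite big1 // => j _; rewrite integral_sum //; last by move=> i; exact: integrable_g.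
  rewrite big1 // => i _.
  by apply: (integral_other_mul_eps v0 noise (@mg i j)); exact: integrable_g.
have A_le : (\int[P]_w (A w)%:E <= (4 * (size s)%:R * (V * q))%:E)%E.
  rewrite (_ : (fun w => (A w)%:E) =
      fun w => (4%:E * \sum_(i <- s) (eps i w ^+ 2 * h (X i w))%:E)%E); last first.
    by apply/funext => w; rewrite /A /= EFinM -sumEFin.
  have mf i : measurable_fun setT (fun w => (eps i w ^+ 2 * h (X i w))%:E).
    apply/measurable_EFinP; apply: measurable_funM => //.
    by apply: measurable_funX; exact: measurable_funP.
  have f0 i w : (0 <= (eps i w ^+ 2 * h (X i w))%:E)%E.
    by have /andP[h0 _] := h_itv (X i w); rewrite lee_fin mulr_ge0 // sqr_ge0.
  rewrite ge0_integralZl //; last 2 first.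
  - exact: emeasurable_sum.
  - by move=> w _; exact: sume_ge0.
  rewrite -mulrA [leRHS]EFinM lee_wpmul2l // ge0_integral_sum //.
  apply: (@le_trans _ _ (\sum_(i <- s) (V * q)%:E)%E); last first.
    by rewrite sumEFin big_const_seq count_predT iter_addr addr0 -(mulr_natl (V * q)).
  apply: lee_sum => i _.
  apply: (integral_eps_sqr_mul v0 noise mh) => // y.
  by have /andP[] := h_itv y.
have le_AB w : running_max (partial_sum (increment sg h (X ^~ w) (eps ^~ w) (p w)))
     (size s) ^+ 2 <= A w + B w.
  have sg2 : sg ^+ 2 = 1 by rewrite -(real_normK (num_real sg)) sg1 expr1n.
  have := running_max_increment_le (X ^~ w) (eps ^~ w) us (ps w) sg2 hh.
  by rewrite (perm_size (ps w)).
apply: (@le_trans _ _ (\int[P]_w ((A w)%:E + (B w)%:E))%E).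
  (* Comparison through the lower integral spares a measurability proof for the running maximum
     along the random order. *)
  apply: (le_lower_integral measurable0 (measure0 P)) => //.
  - by apply: emeasurable_funD; [exact: measurable_int iA|exact: measurable_int iB].
  - by move=> w; rewrite lee_fin sqr_ge0.
  - by move=> w; rewrite -EFinD lee_fin (le_trans _ (le_AB w)) // sqr_ge0.
  - by move=> w _; rewrite -EFinD lee_fin.
by rewrite (integralD measurableT iA iB) B0 adde0.
Qed.

End maximal_inequality.

(** * Variance of the number of observations in a window *)

Section counts.
Context {R : realType} {d : measure_display} {T : measurableType d}.
Variables (P : probability T R) (X eps : nat -> {RV P >-> R}) (v : R).
Hypothesis noise : regression_noise v X eps.
Local Open Scope ereal_scope.

Lemma integral_indicator_X i (I : interval R) :
  \int[P]_w (((X i w \in I)%:R : R)%:E) =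
    \int[lebesgue_measure]_(x in [set` I]) (uniform_pdf 0 1 x)%:E.
Proof.
have mI : measurable ([set` I] : set R) by exact: measurable_itv.
have mXI : measurable (X i @^-1` [set` I]).
  by rewrite -[X in measurable X]setTI; exact: measurable_funP.
transitivity (P (X i @^-1` [set` I])); last first.
  by case: noise => h _ _; exact: h.
have := integral_indic P measurableT mXI; rewrite setIT => <-.
apply: eq_integral => w _; rewrite indicE; congr (_%:R%:E); congr (nat_of_bool _).
by apply/idP/idP => [h|/set_mem//]; exact/mem_set.
Qed.

Lemma integral_indicator_X_le i b0 b1 (x y : R) : (x < y)%R ->
  \int[P]_w (((X i w \in Interval (BSide b0 x) (BSide b1 y))%:R : R)%:E) <= (y - x)%:E.
Proof.
move=> xy; rewrite integral_indicator_X.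
have <- : \int[lebesgue_measure]_(z in [set` Interval (BSide b0 x) (BSide b1 y)]) (1%R : R)%:E = (y - x)%:E.
  by rewrite integral_cst //= lebesgue_measure_itv /= lte_fin xy mul1e.
apply: ge0_le_integral => //=.
- by move=> z _; rewrite lee_fin uniform_pdf_ge0.
- by apply: measurable_funTS; apply/measurable_EFinP; exact: measurable_uniform_pdf.
- move=> z _; rewrite lee_fin /uniform_pdf; case: ifP => // _.
  by rewrite subr0 invr1.
Qed.

Lemma integral_indicator_X_eq i b0 b1 (x y : R) : (0 <= x)%R -> (x < y)%R -> (y <= 1)%R ->
  \int[P]_w (((X i w \in Interval (BSide b0 x) (BSide b1 y))%:R : R)%:E) = (y - x)%:E.
Proof.
move=> x0 xy y1; rewrite integral_indicator_X.
have <- : \int[lebesgue_measure]_(z in [set` Interval (BSide b0 x) (BSide b1 y)]) (1%R : R)%:E = (y - x)%:E.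
  by rewrite integral_cst //= lebesgue_measure_itv /= lte_fin xy mul1e.
apply: eq_integral => z; rewrite inE /= => zI; rewrite /uniform_pdf.
have : (x <= z <= y)%R.
  by case: b0 b1 zI => -[]; rewrite in_itv /= => /andP[h1 h2]; rewrite ?h1 ?h2 ?(ltW h1) ?(ltW h2).
move=> /andP[xz zy].
by rewrite (le_trans x0 xz) (le_trans zy y1) /= subr0 invr1.
Qed.

Variables (s : seq nat) (h : R -> R) (p : R).
Hypothesis us : uniq s.
Hypothesis mh : measurable_fun setT h.
Hypothesis h01 : forall y, h y = 0%R \/ h y = 1%R.
Hypothesis hp : forall i, \int[P]_w (h (X i w))%:E = p%:E.

Let h0 y : (0 <= h y)%R. Proof. by case: (h01 y) => ->; rewrite ?lexx ?ler01. Qed.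

Let mhX i : measurable_fun setT (fun w => (h (X i w))%:E).
Proof. by apply/measurable_EFinP; apply: (measurableT_comp mh); exact: measurable_funP. Qed.

Let hX0 i w : 0 <= (h (X i w))%:E. Proof. by rewrite lee_fin. Qed.

Let p0 : (0 <= p)%R.
Proof. by rewrite -lee_fin -(hp 0); exact: integral_ge0. Qed.

Let pair_integral i j : j != i ->
  \int[P]_w (h (X i w) * h (X j w))%:E = (p ^+ 2)%:E.
Proof.
move=> ji.
pose H (z : other_type (noise_family X eps) (inl i) * R) : \bar R :=
  (h z.2 * h (X j z.1))%:E.
have mH : measurable_fun setT H.
  apply/measurable_EFinP; apply: measurable_funM; first exact: (measurableT_comp mh).
  apply: (measurableT_comp mh).
  exact: (measurableT_comp (@measurable_other_X_X _ _ _ P X eps i j ji) measurable_fst).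
have H0 z : 0 <= H z by rewrite lee_fin mulr_ge0.
rewrite (integral_out_X noise mH H0).
pose U := uniform_prob (@ltr01 R).
have mhE : measurable_fun setT (fun e : R => (h e)%:E) by exact/measurable_EFinP.
have hE0 (e : R) : 0 <= (h e)%:E by rewrite lee_fin.
have UE : \int[U]_e (h e)%:E = p%:E.
  rewrite -(hp i).
  rewrite -(@integral_display_change R U (distribution P (X i)) (fun e => (h e)%:E)) //.
    by rewrite ge0_integral_distribution.
  by case: noise => hX _ _; exact: hX.
transitivity (\int[P]_w (p%:E * (h (X j w))%:E)).
  apply: eq_integral => w _.
  rewrite -UE -(ge0_integralZr U measurableT mhE (fun e _ => hE0 e) (hX0 j w)).
  by apply: eq_integral => e _; rewrite /H /= EFinM.
by rewrite ge0_integralZl // hp -EFinM expr2.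
Qed.

(** Pairwise independence of Bernoulli variables: the off-diagonal terms contribute at most n^2 p^2
    to the second moment and the diagonal n p. *)
Lemma count_variance_le :
  \int[P]_w ((\sum_(i <- s) h (X i w) - (size s)%:R * p) ^+ 2)%:E <=
  ((size s)%:R * p)%:E.
Proof.
set n := size s.
pose S w := (\sum_(i <- s) h (X i w))%R.
have mS : measurable_fun setT S.
  by apply: measurable_sum => i; apply: (measurableT_comp mh); exact: measurable_funP.
have mD : measurable_fun setT (fun w => ((S w - n%:R * p) ^+ 2)%:E).
  by apply/measurable_EFinP; apply: measurable_funX; exact: measurable_funB.
have D0 w : 0 <= ((S w - n%:R * p) ^+ 2)%:E by rewrite lee_fin sqr_ge0.
have ESum : \int[P]_w (S w)%:E = (n%:R * p)%:E.
  rewrite (_ : (fun w => (S w)%:E) = fun w => \sum_(i <- s) (h (X i w))%:E); last first.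
    by apply/funext => w; rewrite sumEFin.
  rewrite ge0_integral_sum // (eq_bigr (fun=> p%:E)) => [|i _]; last exact: hp.
  by rewrite sumEFin big_const_seq count_predT iter_addr addr0 mulr_natl.
have mhh i j : measurable_fun setT (fun w => (h (X i w) * h (X j w))%:E).
  apply/measurable_EFinP; apply: measurable_funM; apply: (measurableT_comp mh);
    exact: measurable_funP.
have hh0 i j w : 0 <= (h (X i w) * h (X j w))%:E by rewrite lee_fin mulr_ge0.
have ESqr : \int[P]_w (S w ^+ 2)%:E <= (n%:R ^+ 2 * p ^+ 2 + n%:R * p)%:E.
  rewrite (_ : (fun w => (S w ^+ 2)%:E) =
      fun w => \sum_(i <- s) \sum_(j <- s) (h (X i w) * h (X j w))%:E); last first.
    apply/funext => w; rewrite expr2 mulr_suml -sumEFin; apply: eq_bigr => i _.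
    by rewrite mulr_sumr sumEFin.
  rewrite ge0_integral_sum //; last 2 first.
  - by move=> i; exact: emeasurable_sum.
  - by move=> i w _; exact: sume_ge0.
  apply: (@le_trans _ _ (\sum_(i <- s) (n%:R * p ^+ 2 + p)%:E)); last first.
    rewrite sumEFin big_const_seq count_predT iter_addr addr0 lee_fin.
    by rewrite -(mulr_natl (_ + _)) mulrDr mulrA -expr2.
  rewrite big_seq [leRHS]big_seq; apply: lee_sum => i si.
  rewrite ge0_integral_sum //.
  rewrite (bigD1_seq i) //= [leRHS]EFinD [leLHS]addeC; apply: leeD.
    rewrite (eq_bigr (fun=> (p ^+ 2)%:E)) => [|j ji]; last exact: pair_integral.
    apply: (@le_trans _ _ (\sum_(j <- s) (p ^+ 2)%:E)).
      rewrite !sumEFin lee_fin [leRHS](bigD1_seq i) //= lerDr exprn_ge0 //.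
    by rewrite sumEFin big_const_seq count_predT iter_addr addr0 lee_fin -(mulr_natl (p ^+ 2)).
  rewrite -(hp i); apply: ge0_le_integral => // w _.
  by rewrite lee_fin; case: (h01 (X i w)) => ->; rewrite ?mulr0 ?mulr1.
(* The square is expanded with nonnegative terms on both sides, where the integral is additive;
   subtraction waits until finiteness is known. *)
have key : \int[P]_w ((S w - n%:R * p) ^+ 2)%:E + (2 * (n%:R * p) * (n%:R * p))%:E =
    \int[P]_w (S w ^+ 2)%:E + ((n%:R * p) ^+ 2)%:E.
  have np0 : (0 <= n%:R * p)%R by rewrite mulr_ge0.
  have S0 w : (0 <= S w)%R by exact: sumr_ge0.
  rewrite [(2 * (n%:R * p) * _)%:E]EFinM -ESum -ge0_integralZl //; last 3 first.
  - exact/measurable_EFinP.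
  - by move=> w _; rewrite lee_fin.
  - by rewrite lee_fin mulr_ge0.
  rewrite -ge0_integralD //; last 2 first.
  - by move=> w _; rewrite mule_ge0 // lee_fin // mulr_ge0.
  - by apply: emeasurable_funM => //; exact/measurable_EFinP.
  rewrite -(integral_probability_cst P ((n%:R * p) ^+ 2)).
  rewrite -ge0_integralD //; last 3 first.
  - by move=> w _; rewrite lee_fin sqr_ge0.
  - by apply/measurable_EFinP; exact: measurable_funX.
  - by move=> w _; rewrite lee_fin sqr_ge0.
  apply: eq_integral => w _; rewrite -EFinM -!EFinD; congr (_%:E); ring.
have fin : \int[P]_w ((S w - n%:R * p) ^+ 2)%:E \is a fin_num.
  rewrite ge0_fin_numE; last exact: integral_ge0.
  have : \int[P]_w ((S w - n%:R * p) ^+ 2)%:E <=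
      \int[P]_w (S w ^+ 2)%:E + ((n%:R * p) ^+ 2)%:E.
    by rewrite -key leeDl // lee_fin !mulr_ge0.
  move=> /le_lt_trans; apply.
  by apply: lte_add_pinfty; [exact: le_lt_trans ESqr (ltry _)|exact: ltry].
have : \int[P]_w ((S w - n%:R * p) ^+ 2)%:E + (2 * (n%:R * p) * (n%:R * p))%:E <=
    (n%:R ^+ 2 * p ^+ 2 + n%:R * p)%:E + ((n%:R * p) ^+ 2)%:E.
  by rewrite key leeD2r.
move: fin; rewrite -/S; case: (\int[P]_w ((S w - n%:R * p) ^+ 2)%:E) => // z _.
rewrite -!EFinD !lee_fin; nra.
Qed.

End counts.

(** * Deviations to one side of the target *)

Section one_sided_deviation.
Variable R : realType.
Implicit Types (x e : nat -> R) (b : bool).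

(* Deviations to the right ([b = false]) and to the left ([b = true]) of the
   target are treated simultaneously; the latter read the sample backwards. *)
Definition side b : R := if b then -1 else 1.

Definition side_order b x k n : seq nat :=
  if b then rev (sample_order x k n) else sample_order x k n.

Definition noise_window b (theta tau y : R) : R :=
  (0 < side b * (y - theta) <= 2 * tau)%R%:R.

Definition count_window b (theta tau y : R) : R :=
  (tau / 2 < side b * (y - theta) <= tau)%R%:R.

Lemma size_side_order b x k n : size (side_order b x k n) = n.
Proof. by case: b; rewrite /= ?size_rev size_sample_order. Qed.

Lemma side_order_perm b x k n : perm_eq (side_order b x k n) (iota k n).
Proof. by case: b => /=; rewrite ?perm_rev sample_order_perm. Qed.

Lemma partial_sum_rev (u : nat -> R) n j : (j <= n)%N ->
  partial_sum (fun l => u (n - l.+1)%N) j = partial_sum u n - partial_sum u (n - j)%N.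
Proof.
elim: j => [|j IH] jn; first by rewrite subn0 subrr /partial_sum big_geq.
rewrite {1}/partial_sum big_nat_recr //= -/(partial_sum _ _) IH; last exact: ltnW.
have -> : (n - j = (n - j.+1).+1)%N by lia.
by rewrite {2}/partial_sum big_nat_recr //= -/(partial_sum _ _); ring.
Qed.

(** A left deviation becomes a right one when the sample is read backwards with opposite signs;
    [argmax_drift_le] then covers both sides. *)
Lemma one_sided_drift b x e (mu : R -> R) (a theta c tau : R) k n :
  0 < c -> 0 < tau -> (0 < n)%N ->
  (forall i, i \in iota k n -> 0 <= x i <= 1) ->
  (forall t, 0 <= t <= 1 -> 0 < side b * (t - theta) ->
    side b * (mu t - a) <= - (c * (side b * (t - theta)))) ->
  let est := gen_inv (mu_hat [seq (x i, mu (x i) + e i) | i <- iota k n]) a in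
  tau < side b * (est - theta) -> side b * (est - theta) <= 2 * tau ->
  c * (tau / 2) * \sum_(i <- iota k n) count_window b theta tau (x i) <=
  running_max (partial_sum
    (increment (side b) (noise_window b theta tau) x e (side_order b x k n))) n.
Proof.
move=> c0 tau0 n0 x01 drift est tauD Dtau.
set q := side_order b x k n.
have qperm := side_order_perm b x k n.
have sq : size q = n := size_side_order b x k n.
pose o := sample_order x k n.
have so : size o = n := size_sample_order x k n.
pose s := [seq (x i, mu (x i) + e i) | i <- iota k n].
have sn : size s = n by rewrite size_map size_iota.
have osE j : (j < n)%N -> order_stat s j = x (nth 0%N o j).
  exact: (@order_statE _ x (fun i => mu (x i) + e i)).
have oin j : (j < n)%N -> nth 0%N o j \in iota k n.
  by move=> jn; rewrite -(perm_mem (sample_order_perm x k n)) mem_nth // so.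
have qin j : (j < n)%N -> nth 0%N q j \in iota k n.
  by move=> jn; rewrite -(perm_mem qperm) mem_nth // sq.
have os01 j : (j < size s)%N -> 0 <= order_stat s j <= 1.
  by rewrite sn => jn; rewrite osE // x01 // oin.
have s0 : (0 < size s)%N by rewrite sn.
have [K [Kn Kmax Kl Kr]] := gen_inv_mu_hat_split a s0 os01.
rewrite -/est in Kl Kr; rewrite sn in Kn Kmax Kr.
pose u i := mu (x (nth 0%N o i)) + e (nth 0%N o i) - a.
have {}Kmax j : (j <= n)%N -> partial_sum u j <= partial_sum u K.
  move=> jn; have := Kmax j jn.
  by rewrite !(@centered_sum_sample _ x (fun i => mu (x i) + e i)).
have xmono i j : (i <= j)%N -> (j < n)%N -> x (nth 0%N o i) <= x (nth 0%N o j).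
  move=> ij jn; rewrite -!osE // ?(leq_ltn_trans ij jn) //.
  by apply: sorted_order_stat => //; rewrite sn.
(* The backward sums with opposite sign equal the forward sum up to n - l minus the total, so they
   are maximal at l = n - K. *)
pose L := if b then (n - K)%N else K.
have qE j : (j < n)%N -> nth 0%N q j = nth 0%N o (if b then n - j.+1 else j)%N.
  by rewrite /q /side_order -/o; case: (b) => // jn; rewrite nth_rev so.
have sum_eq : \sum_(i <- iota k n) count_window b theta tau (x i) =
    \sum_(j < n) (tau / 2 < side b * (x (nth 0%N q j) - theta) <= tau)%R%:R.
  by rewrite -(perm_big _ qperm) /= [LHS](big_nth 0%N) sq big_mkord.
have Ln : (L <= n)%N by rewrite /L; case: (b) => //; exact: leq_subr.
rewrite sum_eq.
apply: (le_trans _ (running_max_ge _ Ln)).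
apply: (@argmax_drift_le _ n L (fun j => side b * (x (nth 0%N q j) - theta))
  (fun j => side b * e (nth 0%N q j))
  (fun j => side b * (mu (x (nth 0%N q j)) + e (nth 0%N q j) - a))
  (side b * (est - theta)) c tau) => //.
- move=> j jn.
  have psE l : (l <= n)%N -> partial_sum (fun j => side b *
      (mu (x (nth 0%N q j)) + e (nth 0%N q j) - a)) l =
      if b then partial_sum u (n - l)%N - partial_sum u n else partial_sum u l.
    move=> ln.
    rewrite (_ : partial_sum _ l =
        partial_sum (fun j => side b * u (if b then n - j.+1 else j)%N) l); last first.
      rewrite /partial_sum !big_nat; apply: eq_bigr => i il.
      by rewrite qE //; lia.
    case: (b) => /=; last first.
      by rewrite /partial_sum; apply: eq_bigr => i _; rewrite mul1r.
    rewrite (_ : partial_sum _ l = - partial_sum (fun j => u (n - j.+1)%N) l).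
      by rewrite partial_sum_rev //; ring.
    by rewrite /partial_sum -sumrN; apply: eq_bigr => i _; rewrite mulN1r.
  rewrite !psE // /L; case: (b); last exact: Kmax.
  by rewrite subKn // lerD2r; apply: Kmax; exact: leq_subr.
- move=> i j ij jn; rewrite !qE ?(leq_ltn_trans ij jn) //; case: (b) => /=.
    rewrite !mulN1r lerN2 lerD2r; apply: xmono; lia.
  by rewrite !mul1r lerD2r; exact: xmono.
- move=> j jL; have jn : (j < n)%N by exact: leq_trans Ln.
  rewrite qE //; move: jL; rewrite /L; case: (b) => /= jL.
    rewrite !mulN1r lerN2 lerD2r -osE; last by lia.
    by apply: Kr; lia.
  by rewrite !mul1r lerD2r -osE //; exact: Kl.
- move=> j /andP[Lj jn]; rewrite qE //; move: Lj; rewrite /L; case: (b) => /= jL.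
    rewrite !mulN1r lerN2 lerD2r -osE; last by lia.
    by apply: Kl; lia.
  by rewrite !mul1r lerD2r -osE //; apply: Kr; rewrite jL.
- move=> j jn z0.
  have := drift (x (nth 0%N q j)) (x01 _ (qin j jn)) z0.
  set m := mu _; set el := e _ => h.
  have -> : side b * (m + el - a) = side b * (m - a) + side b * el by ring.
  by rewrite addrC lerD2l.
Qed.

(** The squared deviation is at most 4 tau^2. A count of at most n tau / 4 misses its mean by n tau
    / 4, and 64 / n^2 * (n tau / 4)^2 = 4 tau^2. A larger count forces a running maximum of at least
    c tau^2 n / 8, and the second coefficient again yields 4 tau^2. *)
Lemma deviation_sqr_le b x e (mu : R -> R) (a theta c tau : R) k n :
  0 < c -> 0 < tau -> (0 < n)%N ->
  (forall i, i \in iota k n -> 0 <= x i <= 1) ->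
  (forall t, 0 <= t <= 1 -> 0 < side b * (t - theta) ->
    side b * (mu t - a) <= - (c * (side b * (t - theta)))) ->
  let est := gen_inv (mu_hat [seq (x i, mu (x i) + e i) | i <- iota k n]) a in
  tau < side b * (est - theta) -> side b * (est - theta) <= 2 * tau ->
  (est - theta) ^+ 2 <=
  64 / n%:R ^+ 2 * (\sum_(i <- iota k n) count_window b theta tau (x i) -
     n%:R * (tau / 2)) ^+ 2 +
  256 / (c ^+ 2 * n%:R ^+ 2 * tau ^+ 2) * running_max (partial_sum
    (increment (side b) (noise_window b theta tau) x e (side_order b x k n))) n ^+ 2.
Proof.
move=> c0 tau0 n0 x01 drift est tauD Dtau.
have := one_sided_drift c0 tau0 n0 x01 drift tauD Dtau.
set N := \sum_(_ <- _) _; set M := running_max _ _ => NM.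
have n0' : 0 < n%:R :> R by rewrite ltr0n.
have D4 : (est - theta) ^+ 2 <= 4 * tau ^+ 2.
  have -> : (est - theta) ^+ 2 = (side b * (est - theta)) ^+ 2.
    by rewrite exprMn /side; case: (b); rewrite ?sqrrN expr1n mul1r.
  have -> : 4 * tau ^+ 2 = (2 * tau) ^+ 2 by ring.
  by rewrite ler_sqr ?nnegrE //; lra.
apply: le_trans D4 _.
have [Nle|Ngt] := leP N (n%:R * tau / 4).
  apply: ler_wpDr.
    apply: mulr_ge0; last exact: sqr_ge0.
    by rewrite divr_ge0 ?ler0n // -!exprMn sqr_ge0.
  rewrite mulrAC ler_pdivlMr ?exprn_gt0 //.
  move: NM Nle n0' ; set m := n%:R => NM Nle m0.
  have h1 : m * tau / 4 <= m * (tau / 2) - N by lra.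
  have h0 : 0 <= m * tau / 4 by rewrite divr_ge0 // mulr_ge0 // ltW.
  have -> : 4 * tau ^+ 2 * m ^+ 2 = 64 * (m * tau / 4) ^+ 2 by field.
  by rewrite ler_pM2l // -(sqrrN (N - _)) opprB ler_sqr ?nnegrE // (le_trans h0).
apply: ler_wpDl.
  by apply: mulr_ge0; [rewrite divr_ge0 ?ler0n ?sqr_ge0|exact: sqr_ge0].
have M_ge : c * tau ^+ 2 * n%:R / 8 <= M.
  apply: le_trans NM.
  have -> : c * tau ^+ 2 * n%:R / 8 = c * (tau / 2) * (n%:R * tau / 4) by field.
  by rewrite ler_pM2l ?ltW // mulr_gt0 // divr_gt0.
rewrite mulrAC ler_pdivlMr; last by rewrite !mulr_gt0 // exprn_gt0.
have -> : 4 * tau ^+ 2 * (c ^+ 2 * n%:R ^+ 2 * tau ^+ 2) = 256 * (c * tau ^+ 2 * n%:R / 8) ^+ 2.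
  by field.
rewrite ler_pM2l // ler_sqr // nnegrE; first by rewrite !mulr_ge0 // ltW // exprn_gt0.
by apply: running_max_partial_sum_ge0.
Qed.

End one_sided_deviation.

Section windows.
Variable R : realType.
Implicit Types (b : bool) (theta tau : R).

Lemma noise_windowE b theta tau y : noise_window b theta tau y =
  (y \in if b then `[theta - 2 * tau, theta[ else `]theta, theta + 2 * tau])%:R.
Proof.
rewrite /noise_window /side; congr (nat_of_bool _)%:R.
by case: b; rewrite in_itv /=; apply/andP/andP => -[]; split; lra.
Qed.

Lemma count_windowE b theta tau y : count_window b theta tau y =
  (y \in if b then `[theta - tau, theta - tau / 2[
         else `]theta + tau / 2, theta + tau])%:R.
Proof.
rewrite /count_window /side; congr (nat_of_bool _)%:R.
by case: b; rewrite in_itv /=; apply/andP/andP => -[]; split; lra.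
Qed.

Let measurable_indicator (I : interval R) :
  measurable_fun setT (fun y : R => (y \in I)%:R : R).
Proof.
rewrite [X in measurable_fun _ X](_ : _ = \1_[set` I]).
  by apply: measurable_indic; exact: measurable_itv.
apply/funext => y; rewrite indicE; congr (nat_of_bool _)%:R.
by apply/idP/idP => [h|/set_mem//]; exact/mem_set.
Qed.

Lemma measurable_noise_window b theta tau :
  measurable_fun setT (noise_window b theta tau).
Proof.
rewrite -[X in measurable_fun _ X]/(fun y => noise_window b theta tau y).
under eq_fun do rewrite noise_windowE.
exact: measurable_indicator.
Qed.

Lemma measurable_count_window b theta tau :
  measurable_fun setT (count_window b theta tau).
Proof.
rewrite -[X in measurable_fun _ X]/(fun y => count_window b theta tau y).
under eq_fun do rewrite count_windowE.
exact: measurable_indicator.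
Qed.

Lemma dyadic_slice (r D : R) n : r < D -> D <= 2 ^+ n * r ->
  exists2 k, (k < n)%N & 2 ^+ k * r < D <= 2 * (2 ^+ k * r).
Proof.
move=> rD; elim: n => [|n IH]; first by rewrite expr0 mul1r leNgt rD.
have [/IH[k kn kD]|Dn] := leP D (2 ^+ n * r); first by exists k => //; exact: leqW.
by exists n => //; rewrite Dn mulrA -exprS.
Qed.

Lemma geometric_sum_le n : \sum_(k < n) (2 ^+ k)^-1 <= 2 :> R.
Proof.
have -> : \sum_(k < n) (2 ^+ k)^-1 = 2 - 2 * (2 ^+ n)^-1 :> R.
  elim: n => [|n IH]; first by rewrite big_ord0 expr0 invr1 mulr1 subrr.
  rewrite big_ord_recr /= IH exprS invfM; field.
  by rewrite expf_neq0.
by rewrite gerBl mulr_ge0 // invr_ge0 exprn_ge0.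
Qed.

End windows.

(** * Summation over the dyadic slices *)

Section risk_upper_bound.
Context {R : realType} {d : measure_display} {T : measurableType d}.
Variables (P : probability T R) (X eps : nat -> {RV P >-> R}) (v : R).
Hypothesis v0 : 0 < v.
Hypothesis noise : regression_noise v X eps.

(** The count variance gives 64 / n^2 * n tau / 2 <= 32 / (n tau) for tau <= 1. The maximal
    inequality on a window of length 2 tau gives 256 * 4 * 2 = 2048 times the moment bound over c^2
    n tau. *)
Definition slice_constant (c : R) : R :=
  32 + 2048 * (4 * expR (v ^+ 2 / 2)) / c ^+ 2.

Lemma slice_constant_ge0 (c : R) : 0 <= slice_constant c.
Proof.
apply: addr_ge0; first exact: ler0n.
apply: divr_ge0; last exact: sqr_ge0.
apply: mulr_ge0; first exact: ler0n.
by apply: mulr_ge0; [exact: ler0n|exact: expR_ge0].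
Qed.

Variables (c theta r : R) (k n : nat).
Hypothesis c0 : 0 < c.
Hypothesis theta01 : 0 <= theta <= 1.
Hypothesis n0 : (0 < n)%N.
Hypothesis r0 : 0 < r.
Hypothesis rn : r ^+ 3 * n%:R = 1.

(* On the slice this is at least (2 tau)^2: by the first term if the count is
   below half of its expectation n tau / 2, otherwise by the second one. *)
Definition slice_bound b (tau : R) (w : T) : R :=
  64 / n%:R ^+ 2 * (\sum_(i <- iota k n) count_window b theta tau (X i w) -
     n%:R * (tau / 2)) ^+ 2 +
  256 / (c ^+ 2 * n%:R ^+ 2 * tau ^+ 2) * running_max (partial_sum
    (increment (side R b) (noise_window b theta tau) (X ^~ w) (eps ^~ w)
       (side_order b (X ^~ w) k n))) n ^+ 2.

Let n_gt0 : 0 < n%:R :> R. Proof. by rewrite ltr0n. Qed.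

Lemma slice_bound_ge0 b tau w : 0 <= slice_bound b tau w.
Proof.
apply: addr_ge0; apply: mulr_ge0; try exact: sqr_ge0.
  by apply: divr_ge0; [exact: ler0n|exact: sqr_ge0].
by apply: divr_ge0; [exact: ler0n|rewrite -!exprMn; exact: sqr_ge0].
Qed.

Lemma measurable_side_order d' (S : measurableType d') (x : nat -> S -> R) b :
  (forall i, measurable_fun setT (x i)) ->
  measurable_level_sets (fun w => side_order b (x ^~ w) k n).
Proof.
move=> mx; apply: (measurable_level_sets_cases
  (f := fun w => sample_order (x ^~ w) k n)
  (g := fun q _ => if b then rev q else q)).
  exact: measurable_sample_order.
by move=> q; exact: measurable_level_sets_cst.
Qed.

Let C2 b tau (w : T) :=
  (\sum_(i <- iota k n) count_window b theta tau (X i w) - n%:R * (tau / 2)) ^+ 2.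

Let M2 b tau (w : T) := running_max (partial_sum
    (increment (side R b) (noise_window b theta tau) (X ^~ w) (eps ^~ w)
       (side_order b (X ^~ w) k n))) n ^+ 2.

Let mC b tau : measurable_fun setT (C2 b tau).
Proof.
apply: measurable_funX; apply: measurable_funB => //.
apply: measurable_sum => i.
by apply: (measurableT_comp (measurable_count_window _ _ _)); exact: measurable_funP.
Qed.

Let mM b tau : measurable_fun setT (M2 b tau).
Proof.
apply: measurable_funX.
apply: (measurable_countable_cases (f := fun w => side_order b (X ^~ w) k n)
  (g := fun q w => running_max (partial_sum
    (increment (side R b) (noise_window b theta tau) (X ^~ w) (eps ^~ w) q)) n)).
  by apply: (measurable_side_order (x := fun i => X i)) => i; exact: measurable_funP.
move=> q; apply: (measurable_running_max_increment
  (side R b) (measurable_noise_window b theta tau) (x := fun i => X i) (e := fun i => eps i)).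
- by move=> i; exact: measurable_funP.
- by move=> i; exact: measurable_funP.
Qed.

Lemma measurable_slice_bound b tau : measurable_fun setT (slice_bound b tau).
Proof.
apply: measurable_funD; apply: measurable_funM => //; [exact: mC|exact: mM].
Qed.

(** The expected count is n tau / 2 only if the counting window fits in [0, 1]. Slices failing this
    are never visited, the estimator being in [0, 1]. *)
Definition slice_inside b (tau : R) : bool :=
  if b then tau <= theta else theta + tau <= 1.

Lemma integral_slice_bound b tau : 0 < tau -> tau <= 1 -> slice_inside b tau ->
  (\int[P]_w (slice_bound b tau w)%:E <= (slice_constant c / (n%:R * tau))%:E)%E.
Proof.
move=> tau0 tau1 inside.
have /andP[th0 th1] := theta01.
pose k1 : R := 64 / n%:R ^+ 2.
pose k2 : R := 256 / (c ^+ 2 * n%:R ^+ 2 * tau ^+ 2).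
have k10 : 0 <= k1 by apply: divr_ge0; [exact: ler0n|exact: sqr_ge0].
have k20 : 0 <= k2.
  by apply: divr_ge0; [exact: ler0n|rewrite -!exprMn; exact: sqr_ge0].
have hw b' th ta (y : R) : count_window b' th ta y = 0 \/ count_window b' th ta y = 1.
  by rewrite /count_window; case: (_ && _); [right|left].
have hn b' th ta (y : R) : noise_window b' th ta y = 0 \/ noise_window b' th ta y = 1.
  by rewrite /noise_window; case: (_ && _); [right|left].
have hp i : (\int[P]_w (count_window b theta tau (X i w))%:E = (tau / 2)%:E)%E.
  under eq_integral do rewrite count_windowE.
  move: inside; rewrite /slice_inside; case: (b) => inside.
    transitivity (((theta - tau / 2) - (theta - tau))%:E); last by congr (_%:E); lra.
    by apply: (integral_indicator_X_eq noise); lra.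
  transitivity (((theta + tau) - (theta + tau / 2))%:E); last by congr (_%:E); lra.
  by apply: (integral_indicator_X_eq noise); lra.
have hq i : (\int[P]_w (noise_window b theta tau (X i w))%:E <= (2 * tau)%:E)%E.
  under eq_integral do rewrite noise_windowE.
  case: (b).
    apply: (@le_trans _ _ ((theta - (theta - 2 * tau))%:E)); last by rewrite lee_fin; lra.
    by apply: (integral_indicator_X_le noise); lra.
  apply: (@le_trans _ _ ((theta + 2 * tau - theta)%:E)); last by rewrite lee_fin; lra.
  by apply: (integral_indicator_X_le noise); lra.
have C_le := count_variance_le noise (iota_uniq k n)
  (measurable_count_window b theta tau) (hw b theta tau) hp.
have side_norm : `|side R b| = 1 by rewrite /side; case: (b); rewrite ?normrN normr1.
have M_le := maximal_inequality v0 noise (iota_uniq k n)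
  (fun w => side_order_perm b (X ^~ w) k n)
  (fun i => @measurable_side_order _ (other_type (noise_family X eps) (inr i))
     (fun j => X j) b (@measurable_other_eps_X _ _ _ P X eps i))
  side_norm (measurable_noise_window b theta tau) (hn b theta tau) hq.
rewrite size_iota in C_le M_le.
have {}C_le : (\int[P]_w (C2 b tau w)%:E <= (n%:R * (tau / 2))%:E)%E := C_le.
have {}M_le : (\int[P]_w (M2 b tau w)%:E <=
  (4 * n%:R * (4 * expR (v ^+ 2 / 2) * (2 * tau)))%:E)%E := M_le.
have C0 w : (0 <= (C2 b tau w)%:E)%E by rewrite lee_fin sqr_ge0.
have M0 w : (0 <= (M2 b tau w)%:E)%E by rewrite lee_fin sqr_ge0.
have mCE : measurable_fun setT (fun w => (C2 b tau w)%:E) by exact/measurable_EFinP.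
have mME : measurable_fun setT (fun w => (M2 b tau w)%:E) by exact/measurable_EFinP.
apply: (@le_trans _ _ (\int[P]_w (k1%:E * (C2 b tau w)%:E + k2%:E * (M2 b tau w)%:E))%E).
  by rewrite le_eqVlt; apply/orP; left; apply/eqP; apply: eq_integral => w _;
    rewrite -!EFinM -EFinD.
rewrite ge0_integralD //; last 4 first.
- by move=> w _; rewrite mule_ge0.
- exact: emeasurable_funM.
- by move=> w _; rewrite mule_ge0.
- exact: emeasurable_funM.
rewrite !ge0_integralZl //.
apply: (@le_trans _ _ (k1%:E * (n%:R * (tau / 2))%:E +
  k2%:E * (4 * n%:R * (4 * expR (v ^+ 2 / 2) * (2 * tau)))%:E)%E).
  by apply: leeD; rewrite lee_wpmul2l.
rewrite -!EFinM -EFinD lee_fin /k1 /k2 /slice_constant.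
have -> : 64 / n%:R ^+ 2 * (n%:R * (tau / 2)) = 32 * tau ^+ 2 / (n%:R * tau).
  by field; rewrite !gt_eqF.
have -> : 256 / (c ^+ 2 * n%:R ^+ 2 * tau ^+ 2) *
    (4 * n%:R * (4 * expR (v ^+ 2 / 2) * (2 * tau))) =
    2048 * (4 * expR (v ^+ 2 / 2)) / c ^+ 2 / (n%:R * tau).
  by field; rewrite !gt_eqF.
rewrite -mulrDl ler_pM2r ?invr_gt0 ?mulr_gt0 // lerD2r ler_piMr //.
by rewrite expr_le1 // ltW.
Qed.

(** The term r^2 covers deviations up to r, and n slices on each side cover the rest. *)
Definition total_bound (w : T) : R := r ^+ 2 +
  \sum_(l < n) \sum_(b <- [:: false; true])
    (slice_inside b (2 ^+ l * r))%:R * slice_bound b (2 ^+ l * r) w.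

Let tau_gt0 l : 0 < 2 ^+ l * r. Proof. by rewrite mulr_gt0 // exprn_gt0. Qed.

Lemma total_bound_ge0 w : 0 <= total_bound w.
Proof.
rewrite addr_ge0 ?sqr_ge0 //; apply: sumr_ge0 => l _; apply: sumr_ge0 => b _.
by rewrite mulr_ge0 // slice_bound_ge0.
Qed.

Lemma measurable_total_bound : measurable_fun setT total_bound.
Proof.
apply: measurable_funD => //; apply: measurable_sum => l; apply: measurable_sum => b.
by apply: measurable_funM => //; exact: measurable_slice_bound.
Qed.

Lemma integral_total_bound :
  (\int[P]_w (total_bound w)%:E <= ((1 + 4 * slice_constant c) * r ^+ 2)%:E)%E.
Proof.
have /andP[th0 th1] := theta01.
have mS b tau : measurable_fun setT (fun w => (slice_bound b tau w)%:E).
  by apply/measurable_EFinP; exact: measurable_slice_bound.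
have K0 := slice_constant_ge0 c.
have S0 b tau w : (0 <= (slice_bound b tau w)%:E)%E by rewrite lee_fin slice_bound_ge0.
rewrite (_ : (fun w => (total_bound w)%:E) = fun w => ((r ^+ 2)%:E +
  \sum_(l < n) \sum_(b <- [:: false; true])
    ((slice_inside b (2 ^+ l * r))%:R%:E * (slice_bound b (2 ^+ l * r) w)%:E))%E);
  last first.
  apply/funext => w; rewrite /total_bound EFinD -sumEFin; congr (_ + _)%E.
  by apply: eq_bigr => l _; rewrite -sumEFin; apply: eq_bigr => b _; rewrite EFinM.
have mT b l : measurable_fun setT (fun w =>
    ((slice_inside b (2 ^+ l * r))%:R%:E * (slice_bound b (2 ^+ l * r) w)%:E)%E).
  exact: emeasurable_funM.
have T0 b l w : (0 <= (slice_inside b (2 ^+ l * r))%:R%:E *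
    (slice_bound b (2 ^+ l * r) w)%:E)%E.
  by rewrite mule_ge0 // lee_fin.
rewrite ge0_integralD //; last 3 first.
- by move=> w _; rewrite lee_fin sqr_ge0.
- by move=> w _; apply: sume_ge0 => l _; apply: sume_ge0 => b _.
- by apply: emeasurable_sum => l; apply: emeasurable_sum => b.
rewrite ge0_integral_sum //; last 2 first.
- by move=> l; apply: emeasurable_sum => b.
- by move=> l w _; apply: sume_ge0 => b _.
rewrite mulrDl mul1r EFinD; apply: leeD.
  by rewrite integral_probability_cst.
have term (l : 'I_n) b : (\int[P]_w ((slice_inside b (2 ^+ l * r))%:R%:E *
    (slice_bound b (2 ^+ l * r) w)%:E) <=
    (slice_constant c * ((n%:R * r)^-1 * (2 ^+ l)^-1))%:E)%E.
  have C0 : 0 <= slice_constant c * ((n%:R * r)^-1 * (2 ^+ l)^-1).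
    by rewrite mulr_ge0 // mulr_ge0 // invr_ge0 ?exprn_ge0 // mulr_ge0 // ltW.
  rewrite ge0_integralZl ?lee_fin //.
  case: (boolP (slice_inside b (2 ^+ l * r))) => [inside|_]; last first.
    by rewrite mul0e lee_fin.
  rewrite mul1e.
  have tau1 : 2 ^+ l * r <= 1 by move: inside; rewrite /slice_inside; case: (b); lra.
  apply: le_trans (integral_slice_bound (tau_gt0 l) tau1 inside) _.
  rewrite lee_fin le_eqVlt; apply/orP; left; apply/eqP.
  by field; rewrite expf_neq0 // !gt_eqF.
apply: (@le_trans _ _ (\sum_(l < n) (2 * slice_constant c * (n%:R * r)^-1 * (2 ^+ l)^-1)%:E)%E).
  apply: lee_sum => l _; rewrite ge0_integral_sum // big_cons big_seq1.
  apply: (@le_trans _ _ _ _ _ (leeD (term l false) (term l true))).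
  by rewrite -EFinD lee_fin; lra.
rewrite sumEFin -mulr_sumr lee_fin.
(* This is where r = n^(-1/3) balances the slices against r^2; the factor 4 is two sides times the
   geometric sum. *)
have -> : (n%:R * r)^-1 = r ^+ 2.
  have e : n%:R * r * r ^+ 2 = 1 by apply: etrans rn; ring.
  by rewrite -[LHS]mulr1 -[X in _ * X = _]e mulKf // mulf_neq0 // gt_eqF.
apply: (@le_trans _ _ (2 * slice_constant c * r ^+ 2 * 2)); last by lra.
by rewrite ler_wpM2l ?geometric_sum_le // mulr_ge0 ?sqr_ge0 // mulr_ge0.
Qed.

Variables (a : R) (mu : R -> R).
Hypothesis drift : forall b t, 0 <= t <= 1 -> 0 < side R b * (t - theta) ->
    side R b * (mu t - a) <= - (c * (side R b * (t - theta))).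

(** As r^3 n = 1 and n < 8^n, the last slice reaches every possible deviation. *)
Let scale_ge1 : 1 <= 2 ^+ n * r.
Proof.
rewrite leNgt; apply/negP => h.
have h3 : (2 ^+ n * r) ^+ 3 < 1 by rewrite expr_lt1 // ltW.
have : (n%:R : R) < (2 ^+ n) ^+ 3.
  by rewrite -!natrX ltr_nat -expnM (leq_trans (ltn_expl n (ltnSn 1))) // leq_exp2l // leq_pmulr.
have : 0 < r ^+ 3 by rewrite exprn_gt0.
rewrite exprMn in h3; move: rn h3; move: (r ^+ 3) ((2 ^+ n) ^+ 3) => x y.
nra.
Qed.

Lemma total_bound_ge w : (forall i, i \in iota k n -> 0 <= X i w <= 1) ->
  (gen_inv (mu_hat (sample X eps mu w k n)) a - theta) ^+ 2 <= total_bound w.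
Proof.
move=> x01; set est := gen_inv _ _.
have /andP[e0 e1] : 0 <= est <= 1 by exact: gen_inv_itv.
have /andP[th0 th1] := theta01.
have terms_ge0 (l : 'I_n) b : 0 <= (slice_inside b (2 ^+ l * r))%:R * slice_bound b (2 ^+ l * r) w.
  by rewrite mulr_ge0 // slice_bound_ge0.
have far b : r < side R b * (est - theta) -> (est - theta) ^+ 2 <= total_bound w.
  move=> rD.
  have D1 : side R b * (est - theta) <= 2 ^+ n * r.
    by apply: le_trans scale_ge1; rewrite /side; case: (b); lra.
  have [l ln /andP[lD Dl]] := dyadic_slice rD D1.
  have inside : slice_inside b (2 ^+ l * r).
    by move: lD; rewrite /slice_inside /side; case: (b); lra.
  apply: le_trans (@deviation_sqr_le _ b (X ^~ w) (eps ^~ w) mu a theta c _ k n c0 (tau_gt0 l)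
    n0 x01 (@drift b) lD Dl) _.
  rewrite -/(slice_bound b (2 ^+ l * r) w) /total_bound.
  apply: ler_wpDl; first exact: sqr_ge0.
  rewrite (bigD1 (Ordinal ln)) //=; apply: ler_wpDr.
    by apply: sumr_ge0 => l' _; apply: sumr_ge0.
  rewrite big_cons big_seq1.
  have h (b' : bool) := terms_ge0 (Ordinal ln) b'.
  case: b inside {lD Dl rD D1} => inside; rewrite inside mul1r.
    by apply: ler_wpDl => //; exact: (h false).
  by apply: ler_wpDr => //; exact: (h true).
have [/far//|h1] := ltP r (side R false * (est - theta)).
have [/far//|h2] := ltP r (side R true * (est - theta)).
apply: (@le_trans _ _ (r ^+ 2)); last first.
  by rewrite lerDl; apply: sumr_ge0 => l _; apply: sumr_ge0 => b _.
rewrite -[leLHS](real_normK (num_real _)) ler_sqr ?nnegrE ?(ltW r0) //.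
by move: h1 h2; rewrite /side mul1r mulN1r => h1 h2; rewrite ler_norml; lra.
Qed.

Let outsideE i : [set w | ~ (0 <= X i w <= 1)] = ~` (X i @^-1` `[0, 1]%classic).
Proof. by apply/seteqP; split=> w /=; rewrite in_itv. Qed.

Let outside i : P [set w | ~ (0 <= X i w <= 1)] = 0%E.
Proof.
have mI : measurable (`[0, 1]%classic : set R) by exact: measurable_itv.
have mXI : measurable (X i @^-1` `[0, 1]%classic).
  by rewrite -[X in measurable X]setTI; exact: measurable_funP.
have h1 : P (X i @^-1` `[0, 1]%classic) = 1%E.
  have hX : distribution P (X i) `[0, 1]%classic = uniform_prob (@ltr01 R) `[0, 1]%classic.
    by case: noise => hX _ _; exact: hX.
  exact: etrans hX (integral_uniform_pdf1 ltr01 (@subset_refl _ _)).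
by rewrite outsideE probability_setC // h1 subee.
Qed.

(* mu is arbitrary outside [0, 1], so that the integrand need not be measurable. *)
Lemma inverse_risk_le (z : R) : 0 <= z ->
  (\int[P]_w (z * (gen_inv (mu_hat (sample X eps mu w k n)) a - theta) ^+ 2)%:E <=
   (z * ((1 + 4 * slice_constant c) * r ^+ 2))%:E)%E.
Proof.
move=> z0.
apply: (@le_trans _ _ (\int[P]_w (z%:E * (total_bound w)%:E))%E); last first.
  rewrite ge0_integralZl //; first by rewrite EFinM lee_wpmul2l // integral_total_bound.
    by apply/measurable_EFinP; exact: measurable_total_bound.
  by move=> w _; rewrite lee_fin total_bound_ge0.
have [N [mN N0 subN]] : P.-negligible (\bigcup_i [set w | ~ (0 <= X i w <= 1)]).
  apply: negligible_bigcup => i.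
  exists [set w | ~ (0 <= X i w <= 1)]; split => //; last exact: outside.
  rewrite outsideE; apply: measurableC; rewrite -[X in measurable X]setTI.
  by apply: measurable_funP => //; exact: measurable_itv.
apply: (le_lower_integral mN N0).
- apply: emeasurable_funM => //.
  by apply/measurable_EFinP; exact: measurable_total_bound.
- by move=> w; rewrite lee_fin mulr_ge0 // sqr_ge0.
- by move=> w; rewrite mule_ge0 // lee_fin total_bound_ge0.
move=> w Nw; rewrite -EFinM lee_fin ler_wpM2l //; apply: total_bound_ge => i _.
by apply: contrapT => h; apply: Nw; apply: subN; exists i.
Qed.

End risk_upper_bound.

(** * Drift of smooth decreasing functions *)

Section smooth_functions.
Variable R : realType.
Implicit Types (f : R -> R) (c d t x y : R).

Lemma is_derive_within f f' t : 0 < t < 1 ->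
  has_derivative_within [set` `[0, 1]] f f' -> is_derive t 1 f (f' t).
Proof.
move=> /andP[t0 t1] hf.
have tI : [set` `[0, 1]] t by rewrite /= in_itv /= !ltW.
have key : (fun h => h^-1 *: (f (h *: (1 : R) + t) - f t)) @ 0^' --> (f' t : R).
  apply/cvgrPdist_lt => e e0.
  have /cvgrPdist_lt/(_ e e0) := hf t tI.
  rewrite near_withinE /dnbhs near_withinE => /nbhs_ballP[dlt /= dlt0 H].
  near=> h.
  have h0 : h != 0 by near: h; exact: nbhs_dnbhs_neq.
  have hd : `|h| < Num.min dlt (Num.min t (1 - t)).
    near: h; apply: dnbhs0_lt; rewrite !lt_min dlt0 t0 /=; lra.
  move: hd; rewrite !lt_min => /and3P[h1 h2 h3].
  have bh : ball t dlt (h + t).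
    by rewrite /ball /= opprD addrCA subrr addr0 normrN.
  have hne : h + t != t by rewrite -subr_eq0 addrK.
  have hI : [set` `[0, 1]] (h + t).
    by move: h2 h3; rewrite !ltr_norml /= in_itv /=; lra.
  have := H (h + t) bh hne hI.
  by rewrite addrK /GRing.scale /= mulr1 mulrC.
apply: DeriveDef; first by apply/cvg_ex; exists (f' t).
exact: cvg_lim key.
Unshelve. all: by end_near. Qed.

(** At the mean value point monotonicity makes the derivative nonpositive, so the bounds on its
    absolute value bound the decrease. *)
Lemma smooth_slope c d f x y : 0 < c -> smooth_nonincreasing c d f ->
  0 <= x -> x < y -> y <= 1 ->
  c * (y - x) <= f x - f y <= d * (y - x).
Proof.
move=> c0 [fc fni [f' [hf _ f'cd]]] x0 xy y1.
have fxy : {within `[x, y], continuous f}.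
  apply: continuous_subspaceW fc => z /=; rewrite !in_itv /= => /andP[xz zy].
  by rewrite (le_trans x0 xz) (le_trans zy y1).
have df z : z \in `]x, y[ -> is_derive z 1 f (f' z).
  rewrite in_itv /= => /andP[xz zy]; apply: is_derive_within hf.
  by rewrite (le_lt_trans x0 xz) (lt_le_trans zy y1).
have [z + fE] := MVT xy df fxy; rewrite in_itv /= => /andP[xz zy].
have zI : z \in `[0, 1] by rewrite in_itv /= (ltW (le_lt_trans x0 xz)) (ltW (lt_le_trans zy y1)).
have /andP[] := f'cd z zI.
have yx : 0 < y - x by rewrite subr_gt0.
have fyx : f y <= f x.
  apply: fni; rewrite ?in_itv /= ?(ltW xy) //; first by rewrite x0 (le_trans (ltW xy)).
  by rewrite y1 (le_trans x0 (ltW xy)).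
have f'z : f' z <= 0 by rewrite -(ler_pM2r yx) mul0r -fE subr_le0.
rewrite ler0_norm // => f1 f2.
have -> : f x - f y = - f' z * (y - x) by rewrite mulNr -fE opprB.
by rewrite !ler_pM2r // !ltW.
Qed.

(** The level a may lie outside the range of f, so no equation f(theta) = a is available. To the
    left, the slope bound is applied to points of the set close to its supremum; to the right, to
    points just beyond theta, where f < a. *)
Lemma gen_inv_drift c f a :
  0 < c -> (forall x y, 0 <= x -> x < y -> y <= 1 -> c * (y - x) <= f x - f y) ->
  forall b t, 0 <= t <= 1 -> 0 < side R b * (t - gen_inv f a) ->
    side R b * (f t - a) <= - (c * (side R b * (t - gen_inv f a))).
Proof.
move=> c0 slope b t /andP[t0 t1].
have /andP[th0 th1] := gen_inv_itv f a.
set theta := gen_inv f a in th0 th1 *.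
case: b; rewrite /side ?mul1r ?mulN1r => tth.
(* An empty set would give theta = 0 and leave no t in [0, 1] to its left. *)
- have A0 : [set t : R | t \in `[0, 1] /\ a <= f t] !=set0.
    apply/set0P/eqP => A0; move: tth; rewrite /theta /gen_inv A0 sup0 => h; lra.
  have hasA : has_sup [set t : R | t \in `[0, 1] /\ a <= f t].
    by split => //; exists 1 => x /= [+ _]; rewrite in_itv /= => /andP[].
  rewrite leNgt; apply/negP => h.
  pose dl := (f t - a) - c * (theta - t).
  have dl0 : dl < 0 by rewrite /dl; lra.
  have e0 : 0 < Num.min (- dl / c) (theta - t).
    by rewrite lt_min divr_gt0 ?oppr_gt0 //=; lra.
  have [s /= [sI as_]] := sup_adherent e0 hasA.
  rewrite -/(gen_inv f a) -/theta => hs.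
  have s1 : s <= 1 by move: sI; rewrite in_itv /= => /andP[].
  have h1 : theta - (- dl / c) < s.
    by apply: le_lt_trans hs; rewrite lerB // ge_min lexx.
  have h2 : theta - (theta - t) < s.
    by apply: le_lt_trans hs; rewrite lerB // ge_min lexx orbT.
  have ts : t < s by lra.
  have := slope t s t0 ts s1.
  have h3 : c * theta + dl < c * s.
    have -> : c * theta + dl = c * (theta - (- dl / c)) by field; rewrite gt_eqF.
    by rewrite ltr_pM2l.
  by rewrite /dl in h3; lra.
- have above s : theta < s -> s <= 1 -> f s < a.
    move=> ths s1; rewrite ltNge; apply/negP => as_.
    have : s <= theta.
      apply: ub_le_sup; first by exists 1 => x /= [+ _]; rewrite in_itv /= => /andP[].
      by split => //; rewrite in_itv /= s1 (le_trans th0 (ltW ths)).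
    by rewrite leNgt ths.
  rewrite leNgt; apply/negP => h.
  pose dl := (f t - a) + c * (t - theta).
  have dl0 : 0 < dl by rewrite /dl; lra.
  pose e := Num.min (dl / c) (t - theta).
  have e0 : 0 < e by rewrite lt_min divr_gt0 //=; lra.
  have e1 : c * e <= dl.
    rewrite -[leRHS](@divfK _ c) ?gt_eqF // mulrC ler_pM2r // ge_min lexx //.
  have e2 : e <= t - theta by rewrite ge_min lexx orbT.
  have fs := above (theta + e / 2) ltac:(lra) ltac:(lra).
  have := slope (theta + e / 2) t ltac:(lra) ltac:(lra) t1.
  have -> : c * (t - (theta + e / 2)) = c * (t - theta) - c * e / 2 by field.
  by rewrite /dl in e1 dl0; lra.
Qed.

End smooth_functions.

(** * Change of measure and the bias lower bound *)

Section change_of_measure.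
Context {R : realType} {d : measure_display} {T : measurableType d}.
Variables (P : probability T R) (X eps : nat -> {RV P >-> R}) (v : R).
Hypothesis v0 : 0 < v.
Hypothesis noise : regression_noise v X eps.
Local Open Scope ereal_scope.

Local Notation T_eps i := (other_type (noise_family X eps) (inr i)).
Local Notation T_X i := (other_type (noise_family X eps) (inl i)).

Lemma integral_shift_eps i (H : T_eps i * R -> \bar R) (g : T -> R) :
  measurable_fun setT H -> (forall z, 0 <= H z) ->
  measurable_fun setT (g : T_eps i -> R) ->
  \int[P]_w H (w, eps i w + g w)%R =
  \int[P]_w (H (w, eps i w) * (shift_density v (g w) (eps i w))%:E).
Proof.
move=> mH H0 mg.
pose H1 (z : T_eps i * R) := H (z.1, z.2 + g z.1)%R.
pose H2 (z : T_eps i * R) := H z * (shift_density v (g z.1) z.2)%:E.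
have mg1 : measurable_fun setT (fun z : T_eps i * R => g z.1).
  exact: (measurableT_comp mg measurable_fst).
have mH1 : measurable_fun setT H1.
  apply: (measurableT_comp mH); apply: measurable_fun_pair => //.
  exact: measurable_funD.
have mH2 : measurable_fun setT H2.
  apply: emeasurable_funM => //; apply/measurable_EFinP.
  apply: measurableT_comp => //; apply: measurable_funB.
    by apply: measurable_funM => //; exact: measurable_funM.
  by apply: measurable_funM => //; exact: measurable_funX.
have H10 z : 0 <= H1 z by exact: H0.
have H20 z : 0 <= H2 z by rewrite mule_ge0 // lee_fin expR_ge0.
apply: (etrans (integral_out_eps noise mH1 H10)); apply/esym.
apply: (etrans (integral_out_eps noise mH2 H20)).
apply: eq_integral => w _; apply/esym.
exact: (@normal_shift R v v0 (fun e => H (w, e)) (g w)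
  (@measurable_fun_pair2 _ _ _ _ _ _ H w mH) (fun e => H0 (w, e))).
Qed.

Lemma integral_mul_X i (G : T -> R) (phi : R -> R) (m : R) :
  measurable_fun setT (G : T_X i -> R) -> (forall w, 0 <= G w)%R ->
  measurable_fun setT phi -> (forall x, 0 <= phi x)%R ->
  \int[P]_w (phi (X i w))%:E <= m%:E ->
  \int[P]_w (G w * phi (X i w))%:E <= m%:E * \int[P]_w (G w)%:E.
Proof.
move=> mG G0 mphi phi0 phim.
pose H (z : T_X i * R) : \bar R := (G z.1 * phi z.2)%:E.
have mH : measurable_fun setT H.
  apply/measurable_EFinP; apply: measurable_funM.
    exact: (measurableT_comp mG measurable_fst).
  exact: (measurableT_comp mphi).
have H0 z : 0 <= H z by rewrite lee_fin mulr_ge0.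
have mGT : measurable_fun setT (fun w => (G w)%:E).
  apply/measurable_EFinP => _ A mA; have := mG measurableT A mA; rewrite !setTI.
  exact: sub_other_measurable.
pose U := uniform_prob (@ltr01 R).
have mp : measurable_fun setT (fun x : R => (phi x)%:E) by exact/measurable_EFinP.
have p0 (x : R) : 0 <= (phi x)%:E by rewrite lee_fin.
have Um : \int[U]_x (phi x)%:E <= m%:E.
  apply: le_trans phim.
  rewrite -(@integral_display_change R U (distribution P (X i)) (fun x => (phi x)%:E)) //.
    by rewrite ge0_integral_distribution.
  by case: noise => hX _ _; exact: hX.
have m0 : 0 <= m%:E by apply: le_trans Um; exact: integral_ge0.
rewrite (integral_out_X noise mH H0).
have HE w : \int[U]_x H (w, x) = (G w)%:E * \int[U]_x (phi x)%:E.
  have Gw : 0 <= (G w)%:E by rewrite lee_fin.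
  rewrite -(ge0_integralZl U measurableT mp (fun x _ => p0 x) Gw).
  by apply: eq_integral => x _; rewrite /H /= EFinM.
under eq_integral do rewrite HE.
rewrite ge0_integralZr // ?integral_ge0 //; last by move=> w _; rewrite lee_fin.
rewrite muleC lee_wpmul2r //.
by apply: integral_ge0 => w _; rewrite lee_fin.
Qed.

Variables (Delta : R -> R) (k n : nat).
Hypothesis mDelta : measurable_fun setT Delta.

Definition likelihood_factor i (w : T) : R := shift_density v (Delta (X i w)) (eps i w).

Definition likelihood_ratio j (w : T) : R := (\prod_(l < j) likelihood_factor (k + l)%N w)%R.

Lemma likelihood_ratio_gt0 j w : (0 < likelihood_ratio j w)%R.
Proof. by apply: prodr_gt0 => l _; exact: expR_gt0. Qed.

Let measurable_factor d' (S : measurableType d') (x e : S -> R) :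
  measurable_fun setT x -> measurable_fun setT e ->
  measurable_fun setT (fun w => shift_density v (Delta (x w)) (e w)).
Proof.
move=> mx me.
have mD : measurable_fun setT (fun w => Delta (x w)) by exact: measurableT_comp.
apply: measurableT_comp => //; apply: measurable_funB.
  by apply: measurable_funM => //; exact: measurable_funM.
by apply: measurable_funM => //; exact: measurable_funX.
Qed.

Lemma measurable_likelihood_ratio j : measurable_fun setT (likelihood_ratio j).
Proof.
apply: measurable_prod => l _.
by apply: measurable_factor; exact: measurable_funP.
Qed.

Let measurable_ratio_eps j : measurable_fun setT (likelihood_ratio j : T_eps (k + j)%N -> R).
Proof.
apply: (measurable_prod (T := T_eps (k + j)%N)) => l _.
apply: (measurable_factor (S := T_eps (k + j)%N)); first exact: measurable_other_eps_X.
by apply: measurable_other_eps_eps; rewrite eqn_add2l ltn_eqF.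
Qed.

Let measurable_ratio_X j : measurable_fun setT (likelihood_ratio j : T_X (k + j)%N -> R).
Proof.
apply: (measurable_prod (T := T_X (k + j)%N)) => l _.
apply: (measurable_factor (S := T_X (k + j)%N)).
  by apply: measurable_other_X_X; rewrite eqn_add2l ltn_eqF.
exact: measurable_other_X_eps.
Qed.

(* The shifts are removed one observation after the other. *)
Lemma integral_change_of_measure j (F : (nat -> R) -> (nat -> R) -> R) :
  (forall d' (S : measurableType d') (x e : nat -> S -> R),
    (forall i, measurable_fun setT (x i)) -> (forall i, measurable_fun setT (e i)) ->
    measurable_fun setT (fun w => F (x ^~ w) (e ^~ w))) ->
  (forall x e, 0 <= F x e)%R ->
  \int[P]_w (F (X ^~ w) (fun i => eps i w +
      if (k <= i < k + j)%N then Delta (X i w) else 0)%R)%:E =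
    \int[P]_w (F (X ^~ w) (eps ^~ w) * likelihood_ratio j w)%:E.
Proof.
elim: j F => [|j IH] F mF F0.
  apply: eq_integral => w _; rewrite /likelihood_ratio big_ord0 mulr1.
  congr (F _ _)%:E; apply/funext => i; rewrite addn0 ltnNge andbN addr0 //.
pose i := (k + j)%N.
pose sh l w : R := if (k <= l < k + j)%N then Delta (X l w) else 0%R.
pose H (z : T_eps i * R) : \bar R :=
  (F (X ^~ z.1) (fun l => if l == i then z.2 else eps l z.1 + sh l z.1)%R)%:E.
have mXi l : measurable_fun setT (X l : T_eps i -> R) by exact: measurable_other_eps_X.
have msh l : measurable_fun setT (sh l : T_eps i -> R).
  rewrite /sh; case: (_ && _); last exact: measurable_cst.
  exact: (measurableT_comp mDelta (mXi l)).
have mH : measurable_fun setT H.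
  apply/measurable_EFinP.
  (* The measurability hypothesis ranges over all spaces for the sake of this product space. *)
  apply: (mF _ (T_eps i * R)%type (fun l (z : T_eps i * R) => X l z.1)
    (fun l (z : T_eps i * R) => if l == i then z.2 else eps l z.1 + sh l z.1)%R) => l.
    exact: (measurableT_comp (mXi l) measurable_fst).
  case: eqVneq => li; first exact: measurable_snd.
  have ml := @measurable_other_eps_eps _ _ _ P X eps i l li.
  exact: (measurableT_comp (measurable_funD ml (msh l)) measurable_fst).
have H0 z : 0 <= H z by rewrite lee_fin.
have mg : measurable_fun setT ((fun w => Delta (X i w)) : T_eps i -> R).
  exact: (measurableT_comp mDelta (mXi i)).
(* The density of the observation just treated is absorbed into the functional, to which the
   induction hypothesis then applies. *)
pose F' (x e : nat -> R) := (F x e * shift_density v (Delta (x i)) (e i))%R.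
transitivity (\int[P]_w H (w, eps i w + Delta (X i w))%R).
  apply: eq_integral => w _; congr (F _ _)%:E; apply/funext => l.
  case: eqVneq => [->|li]; first by rewrite leq_addr addnS ltnS leqnn.
  by rewrite /sh addnS ltnS (leq_eqVlt l) (negbTE li).
rewrite (integral_shift_eps mH H0 mg).
transitivity (\int[P]_w (F' (X ^~ w) (fun l => eps l w + sh l w)%R)%:E).
  apply: eq_integral => w _; rewrite /H /F' EFinM /=; congr (_ * _).
    congr (F _ _)%:E; apply/funext => l; case: eqVneq => // ->.
    by rewrite /sh ltnn andbF addr0.
  by rewrite /sh ltnn andbF addr0.
rewrite /sh (IH F').
- apply: eq_integral => w _; congr _%:E.
  by rewrite /F' /likelihood_ratio big_ord_recr /= /likelihood_factor -/i; ring.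
- move=> d' S x e mx me; apply: measurable_funM; first exact: mF.
  exact: measurable_factor.
- by move=> x e; rewrite mulr_ge0 // expR_ge0.
Qed.

Lemma integral_likelihood_ratio j : \int[P]_w (likelihood_ratio j w)%:E = 1.
Proof.
have := @integral_change_of_measure j (fun _ _ => 1%R)
  (fun _ _ _ _ _ _ => measurable_cst _) (fun _ _ => ler01).
under [X in _ = X -> _]eq_integral do rewrite mul1r.
by move=> <-; rewrite integral_probability_cst.
Qed.

(** The last observation is peeled off: integrating out its error turns the squared factor into
    exp(Delta^2 / v^2), and integrating out its design point costs a factor m. *)
Lemma integral_likelihood_ratio_sqr (m : R) j :
  (forall i, \int[P]_w (expR (Delta (X i w) ^+ 2 / v ^+ 2))%:E <= m%:E) ->
  \int[P]_w (likelihood_ratio j w ^+ 2)%:E <= (m ^+ j)%:E.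
Proof.
move=> hm.
have mphi : measurable_fun setT (fun x => expR (Delta x ^+ 2 / v ^+ 2)).
  by apply: measurableT_comp => //; apply: measurable_funM => //; exact: measurable_funX.
have m0 : (0 <= m)%R.
  by rewrite -lee_fin (le_trans _ (hm 0%N)) // integral_ge0 // => w _; rewrite lee_fin expR_ge0.
elim: j => [|j IH].
  rewrite expr0; under eq_integral do rewrite /likelihood_ratio big_ord0 expr1n.
  by rewrite integral_probability_cst.
pose i := (k + j)%N.
pose H (z : T_eps i * R) : \bar R :=
  (likelihood_ratio j z.1 ^+ 2 * shift_density v (Delta (X i z.1)) z.2 ^+ 2)%:E.
have mXi : measurable_fun setT (X i : T_eps i -> R) by exact: measurable_other_eps_X.
have mH : measurable_fun setT H.
  apply/measurable_EFinP; apply: measurable_funM; apply: measurable_funX.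
    exact: (measurableT_comp (@measurable_ratio_eps j) measurable_fst).
  apply: measurable_factor; last exact: measurable_snd.
  exact: (measurableT_comp mXi measurable_fst).
have H0 z : 0 <= H z by rewrite lee_fin mulr_ge0 // sqr_ge0.
rewrite (_ : (fun w => _) = fun w => H (w, eps i w)); last first.
  by apply/funext => w; rewrite /H /likelihood_ratio big_ord_recr /= exprMn.
rewrite (integral_out_eps noise mH H0).
rewrite (_ : (fun w => _) = fun w =>
    (likelihood_ratio j w ^+ 2 * expR (Delta (X i w) ^+ 2 / v ^+ 2))%:E); last first.
  apply/funext => w; rewrite EFinM -(integral_shift_density_sqr v0).
  rewrite -ge0_integralZl //.
  - by apply/measurable_EFinP; apply: measurable_funX; exact: measurable_shift_density.
  - by move=> e _; rewrite lee_fin sqr_ge0.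
  - by rewrite lee_fin sqr_ge0.
apply: (le_trans (integral_mul_X (G := fun w => (likelihood_ratio j w ^+ 2)%R) _ _ mphi _ (hm i))).
- by apply: measurable_funX; exact: measurable_ratio_X.
- by move=> w; exact: sqr_ge0.
- by move=> x; exact: expR_ge0.
by rewrite exprS EFinM lee_wpmul2l ?lee_fin.
Qed.

End change_of_measure.

Section two_points.
Context {R : realType} {d : measure_display} {T : measurableType d}.
Variables (P : probability T R) (X eps : nat -> {RV P >-> R}) (v : R).
Hypothesis v0 : 0 < v.
Hypothesis noise : regression_noise v X eps.
Local Open Scope ereal_scope.

Lemma ge0_integral_fin_D (f g : T -> R) :
  measurable_fun setT f -> (forall w, 0 <= f w)%R ->
  measurable_fun setT g -> (forall w, 0 <= g w)%R ->
  \int[P]_w (f w + g w)%:E = \int[P]_w (f w)%:E + \int[P]_w (g w)%:E.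
Proof.
move=> mf f0 mg g0; under eq_integral do rewrite EFinD.
by rewrite ge0_integralD // => [w _||w _|]; rewrite ?lee_fin //; exact/measurable_EFinP.
Qed.

Lemma ge0_integral_fin_Z (f : T -> R) (z : R) :
  measurable_fun setT f -> (forall w, 0 <= f w)%R -> (0 <= z)%R ->
  \int[P]_w (z * f w)%:E = z%:E * \int[P]_w (f w)%:E.
Proof.
move=> mf f0 z0; under eq_integral do rewrite EFinM.
by rewrite ge0_integralZl // => [|w _]; rewrite ?lee_fin //; exact/measurable_EFinP.
Qed.

Variables (Delta : R -> R) (k n : nat) (F : (nat -> R) -> (nat -> R) -> R).
Hypothesis mDelta : measurable_fun setT Delta.
Hypothesis mF : forall d' (S : measurableType d') (x e : nat -> S -> R),
  (forall i, measurable_fun setT (x i)) -> (forall i, measurable_fun setT (e i)) ->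
  measurable_fun setT (fun w => F (x ^~ w) (e ^~ w)).
Hypothesis F01 : forall x e, (0 <= F x e <= 1)%R.

Definition shifted_value (w : T) : R := F (X ^~ w)
  (fun i => eps i w + if (k <= i < k + n)%N then Delta (X i w) else 0)%R.

Definition base_value (w : T) : R := F (X ^~ w) (eps ^~ w).

Let Lam := likelihood_ratio X eps v Delta k n.

Let mB : measurable_fun setT base_value.
Proof. by apply: (mF (x := fun i => X i) (e := fun i => eps i)) => i; exact: measurable_funP. Qed.

Let mL : measurable_fun setT Lam. Proof. exact: measurable_likelihood_ratio. Qed.

Let L0 w : (0 <= Lam w)%R. Proof. exact/ltW/likelihood_ratio_gt0. Qed.

Let B0 w : (0 <= base_value w)%R. Proof. by case/andP: (F01 (X ^~ w) (eps ^~ w)). Qed.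

Variables (theta alpha K q : R).
Hypothesis theta0 : (0 <= theta)%R.
Hypothesis alpha0 : (0 < alpha)%R.
Hypothesis riskK : \int[P]_w ((base_value w - theta) ^+ 2)%:E <= K%:E.
Hypothesis Lq : \int[P]_w (Lam w ^+ 2)%:E <= (1 + q)%:E.

Let A w : R := (base_value w * Lam w)%R.

Let shiftedE : \int[P]_w (shifted_value w)%:E = \int[P]_w (A w)%:E.
Proof.
apply: (integral_change_of_measure v0 noise k mDelta n mF) => x e.
by case/andP: (F01 x e).
Qed.

(* AM-GM: twice the covariance of the estimator and the likelihood ratio is at
   most alpha times the risk plus the chi-square divergence over alpha. *)
Let bracket : R := (alpha / 2 * K + q / (2 * alpha))%R.

Let integral_le1 (f : T -> R) : measurable_fun setT f -> (forall w, 0 <= f w <= 1)%R ->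
  \int[P]_w (f w)%:E \is a fin_num.
Proof.
move=> mf f01; rewrite ge0_fin_numE; last first.
  by apply: integral_ge0 => w _; rewrite lee_fin; case/andP: (f01 w).
apply: le_lt_trans (ltry 1); rewrite -(integral_probability_cst P 1).
apply: ge0_le_integral => //.
- by move=> w _; rewrite lee_fin; case/andP: (f01 w).
- exact/measurable_EFinP.
- by move=> w _; rewrite lee_fin; case/andP: (f01 w).
Qed.

Lemma base_fin : \int[P]_w (base_value w)%:E \is a fin_num.
Proof. by apply: integral_le1 => // w; exact: F01. Qed.

Lemma shifted_fin : \int[P]_w (shifted_value w)%:E \is a fin_num.
Proof.
apply: integral_le1 => [|w]; last exact: F01.
apply: (mF (x := fun i => X i)
  (e := fun i w => eps i w + if (k <= i < k + n)%N then Delta (X i w) else 0)%R) => i.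
  exact: measurable_funP.
apply: measurable_funD; first exact: measurable_funP.
case: (_ && _); last exact: measurable_cst.
by apply: measurableT_comp => //; exact: measurable_funP.
Qed.

Let U w : R := (alpha / 2 * (base_value w - theta) ^+ 2)%R.
Let C w : R := ((2 * alpha)^-1 * (Lam w ^+ 2))%R.

Let mA : measurable_fun setT A. Proof. exact: measurable_funM. Qed.
Let A0 w : (0 <= A w)%R. Proof. exact: mulr_ge0. Qed.
Let mU : measurable_fun setT U.
Proof. by apply: measurable_funM => //; apply: measurable_funX; exact: measurable_funB. Qed.
Let U0 w : (0 <= U w)%R. Proof. by rewrite mulr_ge0 ?sqr_ge0 // divr_ge0 // ltW. Qed.
Let mC : measurable_fun setT C.
Proof. by apply: measurable_funM => //; exact: measurable_funX. Qed.
Let C0 w : (0 <= C w)%R. Proof. by rewrite mulr_ge0 ?sqr_ge0 // invr_ge0 mulr_ge0 // ltW. Qed.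

Let IU : \int[P]_w (U w)%:E <= (alpha / 2 * K)%:E.
Proof.
rewrite ge0_integral_fin_Z.
- by rewrite [leRHS]EFinM lee_wpmul2l // lee_fin divr_ge0 // ltW.
- by apply: measurable_funX; exact: measurable_funB.
- by move=> w; exact: sqr_ge0.
- by rewrite divr_ge0 // ltW.
Qed.

Let IC : \int[P]_w (C w)%:E <= ((2 * alpha)^-1 * (1 + q))%:E.
Proof.
rewrite ge0_integral_fin_Z.
- by rewrite [leRHS]EFinM lee_wpmul2l // lee_fin invr_ge0 mulr_ge0 // ltW.
- exact: measurable_funX.
- by move=> w; exact: sqr_ge0.
- by rewrite invr_ge0 mulr_ge0 // ltW.
Qed.

Let IL (z : R) : (0 <= z)%R -> \int[P]_w (z * Lam w)%:E = z%:E.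
Proof.
by move=> z0; rewrite ge0_integral_fin_Z // /Lam (integral_likelihood_ratio v0 noise k mDelta) mule1.
Qed.

Let half0 : (0 <= (2 * alpha)^-1)%R. Proof. by rewrite invr_ge0 mulr_ge0 // ltW. Qed.

(** Expanded squares with every term moved to the side where it is nonnegative, so that monotonicity
    and additivity apply; the likelihood ratio integrates to 1. *)
Let compare (f g : T -> R) (F1 G1 : R) :
  measurable_fun setT f -> (forall w, 0 <= f w)%R ->
  measurable_fun setT g -> (forall w, 0 <= g w)%R ->
  \int[P]_w (f w)%:E = F1%:E -> \int[P]_w (g w)%:E = G1%:E ->
  (forall w, f w + alpha^-1 * Lam w <= g w + (U w + (C w + (2 * alpha)^-1)))%R ->
  (F1 <= G1 + bracket)%R.
Proof.
move=> mf f0 mg g0 If Ig fg.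
have ai0 : (0 <= alpha^-1)%R by rewrite invr_ge0 ltW.
have mCc : measurable_fun setT (fun w => C w + (2 * alpha)^-1)%R by exact: measurable_funD.
have Cc0 w : (0 <= C w + (2 * alpha)^-1)%R by rewrite addr_ge0.
have mUC : measurable_fun setT (fun w => U w + (C w + (2 * alpha)^-1))%R by exact: measurable_funD.
have UC0 w : (0 <= U w + (C w + (2 * alpha)^-1))%R by rewrite addr_ge0.
have mLz : measurable_fun setT (fun w => alpha^-1 * Lam w)%R by exact: measurable_funM.
have : \int[P]_w (f w + alpha^-1 * Lam w)%:E <=
    \int[P]_w (g w + (U w + (C w + (2 * alpha)^-1)))%:E.
  apply: ge0_le_integral => //.
  - by move=> w _; rewrite lee_fin addr_ge0 // mulr_ge0.
  - by apply/measurable_EFinP; exact: measurable_funD.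
  - by apply/measurable_EFinP; exact: measurable_funD.
  - by move=> w _; rewrite lee_fin.
rewrite ge0_integral_fin_D // => [|w]; last by rewrite mulr_ge0.
rewrite (ge0_integral_fin_D mg) // (ge0_integral_fin_D mU) // (ge0_integral_fin_D mC) //.
rewrite integral_probability_cst If Ig IL //.
move=> /le_trans => h.
have : F1%:E + alpha^-1%:E <=
    G1%:E + ((alpha / 2 * K)%:E + (((2 * alpha)^-1 * (1 + q))%:E + (2 * alpha)^-1%:E)).
  by apply: h; rewrite leeD2l // leeD // leeD2r.
rewrite -!EFinD lee_fin /bracket => {}h.
have e : ((2 * alpha)^-1 * (1 + q) + (2 * alpha)^-1 = alpha^-1 + q / (2 * alpha))%R.
  by field; rewrite gt_eqF.
lra.
Qed.

(** The difference is the expectation of (estimator - theta)(ratio - 1), where theta enters freely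
    since the ratio has mean 1. The squares of alpha (estimator - theta) minus and plus (ratio - 1)
    bound it from above and below. *)
Lemma two_point_bound :
  (`|fine (\int[P]_w (shifted_value w)%:E)%E - fine (\int[P]_w (base_value w)%:E)%E| <=
    bracket)%R.
Proof.
set E1 := fine (\int[P]_w (shifted_value w)%:E).
set E0 := fine (\int[P]_w (base_value w)%:E).
have I1 : \int[P]_w (A w)%:E = E1%:E by rewrite -shiftedE /E1 fineK // shifted_fin.
have I0 : \int[P]_w (base_value w)%:E = E0%:E by rewrite /E0 fineK // base_fin.
have mtL : measurable_fun setT (fun w => theta * Lam w)%R by exact: measurable_funM.
have tL0 w : (0 <= theta * Lam w)%R by rewrite mulr_ge0.
have mAt : measurable_fun setT (fun w => A w + theta)%R by exact: measurable_funD.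
have At0 w : (0 <= A w + theta)%R by rewrite addr_ge0.
have mBt : measurable_fun setT (fun w => base_value w + theta * Lam w)%R by exact: measurable_funD.
have Bt0 w : (0 <= base_value w + theta * Lam w)%R by rewrite addr_ge0.
have IA : \int[P]_w (A w + theta)%:E = (E1 + theta)%:E.
  by rewrite ge0_integral_fin_D // integral_probability_cst I1 -EFinD.
have IB : \int[P]_w (base_value w + theta * Lam w)%:E = (E0 + theta)%:E.
  by rewrite ge0_integral_fin_D // IL // I0 -EFinD.
have p1 w : (A w + theta + alpha^-1 * Lam w <=
    base_value w + theta * Lam w + (U w + (C w + (2 * alpha)^-1)))%R.
  rewrite -subr_ge0.
  rewrite (_ : (_ - _ = ((alpha * (base_value w - theta) - (Lam w - 1)) ^+ 2) / (2 * alpha))%R).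
    by rewrite mulr_ge0 ?sqr_ge0.
  by rewrite /A /U /C; field; rewrite gt_eqF.
have p2 w : (base_value w + theta * Lam w + alpha^-1 * Lam w <=
    A w + theta + (U w + (C w + (2 * alpha)^-1)))%R.
  rewrite -subr_ge0.
  rewrite (_ : (_ - _ = ((alpha * (base_value w - theta) + (Lam w - 1)) ^+ 2) / (2 * alpha))%R).
    by rewrite mulr_ge0 ?sqr_ge0.
  by rewrite /A /U /C; field; rewrite gt_eqF.
have h1 := compare mAt At0 mBt Bt0 IA IB p1.
have h2 := compare mBt Bt0 mAt At0 IB IA p2.
rewrite ler_norml; move: h1 h2; lra.
Qed.

End two_points.

(** * Bump perturbations of the regression function *)

Section local_perturbation.
Variable R : realType.
Implicit Types (f g : R -> R) (c d t s x y : R) (D : set R).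

Lemma quadratic_has_derivative_within D f f' (C : R) :
  (forall s t, D s -> D t -> `|f s - f t - f' t * (s - t)| <= C * (s - t) ^+ 2) ->
  has_derivative_within D f f'.
Proof.
move=> fC t Dt; apply/cvgrPdist_lt => e e0.
have C1 : 0 < `|C| + 1 by rewrite ltr_pwDr.
rewrite near_withinE /dnbhs near_withinE; apply/nbhs_ballP.
exists (e / (`|C| + 1)) => /=; first exact: divr_gt0.
move=> s /= ts st Ds.
have st0 : 0 < `|s - t| by rewrite normr_gt0 subr_eq0.
rewrite distrC -(ltr_pM2r st0) -normrM mulrBl divfK ?subr_eq0 //.
apply: (le_lt_trans (fC s t Ds Dt)).
rewrite -[_ ^+ 2]ger0_norm ?sqr_ge0 // normrX expr2 mulrA ltr_pM2r //.
move: ts; rewrite /ball /= distrC ltr_pdivlMr // => /(le_lt_trans _); apply.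
by rewrite mulrC ler_pM2l // ler_wpDr // ler_norm.
Qed.

Lemma has_derivative_within_eq D f g f' : (forall t, D t -> f t = g t) ->
  has_derivative_within D f f' -> has_derivative_within D g f'.
Proof.
move=> fg hf t Dt; apply: cvg_trans (hf t Dt); apply: near_eq_cvg.
rewrite near_withinE; apply: nearW => s Ds.
by rewrite !fg.
Qed.

Lemma has_derivative_withinD D f g f' g' :
  has_derivative_within D f f' -> has_derivative_within D g g' ->
  has_derivative_within D (f \+ g) (f' \+ g').
Proof.
move=> hf hg t Dt; apply: cvg_trans (cvgD (hf t Dt) (hg t Dt)).
apply: near_eq_cvg; apply: nearW => s /=.
by rewrite opprD addrACA mulrDl.
Qed.

(** Clamping leaves [0, 1] untouched and yields a Borel representative of a function that is
    otherwise arbitrary outside. *)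
Lemma smooth_nonincreasing_clamp c d f :
  smooth_nonincreasing c d f -> smooth_nonincreasing c d (f \o @clamp01 R).
Proof.
move=> [fc fni [f' [hf f'c f'cd]]].
have E t : t \in `[0, 1] -> f t = (f \o @clamp01 R) t.
  by rewrite in_itv => /= t01; rewrite clamp01_id.
split.
- apply: subspace_eq_continuous fc => t; rewrite inE => t01.
  exact: E.
- by move=> x y x01 y01 xy; rewrite -!E //; exact: fni.
- by exists f'; split => //; apply: has_derivative_within_eq hf => t /E.
Qed.

Lemma measurable_smooth_clamp c d f :
  smooth_nonincreasing c d f -> measurable_fun setT (f \o @clamp01 R).
Proof.
move=> [fc _ _].
have mI : measurable ([set` `[0, 1]] : set R) by exact: measurable_itv.
apply: (measurable_comp mI).
- by move=> _ [t _ <-] /=; rewrite in_itv /= clamp01_itv.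
- exact: subspace_continuous_measurable_fun.
- exact: measurable_clamp01.
Qed.

Variables (x0 h kappa : R).
Hypotheses (x001 : 0 < x0 < 1) (h0 : 0 < h) (kappa0 : 0 < kappa).

(** With s = (t - x0) / h this is kappa h times the squared positive part of 1 - s^2: continuously
    differentiable, with a slope bound 4 kappa independent of h. *)
Definition bump t : R := kappa / h ^+ 3 * Num.max 0 (h ^+ 2 - (t - x0) ^+ 2) ^+ 2.

Definition bump_derivative t : R :=
  - (4 * (kappa / h ^+ 3) * (t - x0) * Num.max 0 (h ^+ 2 - (t - x0) ^+ 2)).

Let A := kappa / h ^+ 3.
Let A0 : 0 < A. Proof. by rewrite divr_gt0 // exprn_gt0. Qed.
Let Ah : A * h ^+ 3 = kappa. Proof. by rewrite divfK // gt_eqF // exprn_gt0. Qed.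

Let outside t : h <= `|t - x0| -> Num.max 0 (h ^+ 2 - (t - x0) ^+ 2) = 0.
Proof.
move=> ht; apply: max_l; rewrite subr_le0 -[leRHS]real_normK ?num_real //.
by rewrite ler_sqr ?nnegrE ?normr_ge0 ?(ltW h0) ?(ltW ht).
Qed.

Let inside t : `|t - x0| < h ->
  Num.max 0 (h ^+ 2 - (t - x0) ^+ 2) = h ^+ 2 - (t - x0) ^+ 2.
Proof.
move=> ht; apply: max_r; rewrite subr_ge0 -[leLHS]real_normK ?num_real //.
by rewrite ler_sqr ?nnegrE ?normr_ge0 ?(ltW h0) ?(ltW ht).
Qed.

Lemma bump_outside t : h <= `|t - x0| -> bump t = 0.
Proof. by move=> ht; rewrite /bump outside // expr0n mulr0. Qed.

Lemma bump_derivative_outside t : h <= `|t - x0| -> bump_derivative t = 0.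
Proof. by move=> ht; rewrite /bump_derivative outside // mulr0 oppr0. Qed.

Lemma bump_center : bump x0 = kappa * h.
Proof.
rewrite /bump inside ?subrr ?normr0 // expr0n subr0 -/A -Ah.
by rewrite -[RHS]mulrA -exprSr -exprM.
Qed.

Lemma bump_itv t : 0 <= bump t <= kappa * h.
Proof.
have k0 := ltW kappa0; have hh := ltW h0.
have [ht|ht] := ltP `|t - x0| h; last by rewrite bump_outside // lexx mulr_ge0.
rewrite /bump inside // mulr_ge0 ?sqr_ge0 ?(ltW A0) //=.
have -> : kappa * h = A * (h ^+ 2) ^+ 2.
  by rewrite -Ah -[LHS]mulrA -exprSr -exprM.
rewrite ler_pM2l // ler_sqr ?nnegrE ?sqr_ge0 //.
  by rewrite gerBl sqr_ge0.
rewrite subr_ge0 -[leLHS]real_normK ?num_real //.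
by rewrite ler_sqr ?nnegrE ?normr_ge0 ?(ltW h0) ?(ltW ht).
Qed.

Lemma bump_derivative_le t : `|bump_derivative t| <= 4 * kappa.
Proof.
have [ht|ht] := ltP `|t - x0| h; last first.
  by rewrite bump_derivative_outside // normr0 mulr_ge0 // ltW.
rewrite /bump_derivative inside // -/A normrN 3!normrM normr_nat.
rewrite (gtr0_norm A0) -Ah -[leLHS]mulrA (_ : 4 * (A * h ^+ 3) = 4 * A * h ^+ 3); last by rewrite mulrA.
rewrite ler_pM2l; last exact: mulr_gt0.
rewrite exprS; apply: ler_pM => //; first exact: ltW.
rewrite ger0_norm ?gerBl ?sqr_ge0 // subr_ge0 -[leLHS]real_normK ?num_real //.
by rewrite ler_sqr ?nnegrE ?normr_ge0 ?(ltW h0) ?(ltW ht).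
Qed.

(** The squared positive part has derivative twice the positive part, with a quadratic remainder
    even across the kink. *)
Let positive_part_sqr (p q : R) :
  0 <= Num.max 0 q ^+ 2 - Num.max 0 p ^+ 2 - 2 * Num.max 0 p * (q - p) <= (q - p) ^+ 2.
Proof.
have sp := sqr_ge0 p; have sq := sqr_ge0 q; have spq := sqr_ge0 (q - p).
have [p0|p0] := leP 0 p; have [q0|q0] := leP 0 q; rewrite ?expr0n ?mulr0 ?mul0r ?subr0 ?sub0r.
- by rewrite (_ : _ - _ = (q - p) ^+ 2) ?spq ?lexx //; ring.
- have pq : p * q <= 0 by rewrite mulr_ge0_le0 // ltW.
  by apply/andP; split; rewrite -subr_ge0; nra.
- have pq : p * q <= 0 by rewrite mulr_le0_ge0 // ltW.
  by apply/andP; split; rewrite -subr_ge0; nra.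
- by rewrite lexx.
Qed.

Lemma bump_has_derivative : has_derivative_within [set` `[0, 1]] bump bump_derivative.
Proof.
(* The 4 bounds (s + t - 2 x0)^2 on [0, 1]; the 2 h^2 comes from the second-order term of the inner
   polynomial. *)
apply: (@quadratic_has_derivative_within _ _ _ (A * (4 + 2 * h ^+ 2))) => s t /=.
rewrite !in_itv /= => /andP[s0 s1] /andP[t0 t1].
move: x001 => /andP[x0_gt0 x0_lt1].
pose p := h ^+ 2 - (t - x0) ^+ 2; pose q := h ^+ 2 - (s - x0) ^+ 2.
have /andP[h1 h2] := positive_part_sqr p q.
set r := _ - _ - _ in h1 h2.
have -> : bump s - bump t - bump_derivative t * (s - t) =
    A * (r - 2 * Num.max 0 p * (s - t) ^+ 2).
  by rewrite /bump /bump_derivative -/A /r /p /q; ring.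
rewrite normrM (gtr0_norm A0) -[leRHS]mulrA ler_pM2l //.
have mp : 0 <= Num.max 0 p <= h ^+ 2.
  by rewrite le_max lexx /= ge_max sqr_ge0 /= gerBl sqr_ge0.
have rs : r <= 4 * (s - t) ^+ 2.
  apply: (le_trans h2).
  have -> : (q - p) ^+ 2 = (s + t - 2 * x0) ^+ 2 * (s - t) ^+ 2 by rewrite /p /q; ring.
  rewrite ler_wpM2r ?sqr_ge0 //.
  rewrite (_ : 4 = 2 ^+ 2 :> R) -?natrX // -[leLHS]real_normK ?num_real // natrX.
  rewrite ler_sqr ?nnegrE // ler_norml; lra.
have := sqr_ge0 (s - t); move: mp => /andP[mp1 mp2] st.
have h3 : 0 <= Num.max 0 p * (s - t) ^+ 2 <= h ^+ 2 * (s - t) ^+ 2.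
  by rewrite mulr_ge0 //= ler_wpM2r.
rewrite ler_norml; move: h3 => /andP[]; lra.
Qed.

Let continuous_positive : continuous (fun t : R => Num.max 0 (h ^+ 2 - (t - x0) ^+ 2)).
Proof.
move=> t; apply: (@continuous_max _ _ (cst 0) (fun t => h ^+ 2 - (t - x0) ^+ 2)).
  exact: cvg_cst.
apply: cvgB; first exact: cvg_cst.
by rewrite expr2; apply: cvgM; apply: cvgB => //; exact: cvg_cst.
Qed.

Lemma continuous_bump : continuous bump.
Proof.
move=> t; apply: cvgM; first exact: cvg_cst.
by rewrite expr2; apply: cvgM; exact: continuous_positive.
Qed.

Lemma continuous_bump_derivative : continuous bump_derivative.
Proof.
move=> t; apply: cvgN; apply: cvgM; last exact: continuous_positive.
by apply: cvgM; [exact: cvg_cst|apply: cvgB => //; exact: cvg_cst].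
Qed.

Lemma bump_lipschitz x y : 0 <= x -> x < y -> y <= 1 ->
  bump y - bump x <= 4 * kappa * (y - x).
Proof.
move=> x_ge0 xy y1.
have df z : z \in `]x, y[ -> is_derive z 1 bump (bump_derivative z).
  rewrite in_itv /= => /andP[xz zy]; apply: is_derive_within bump_has_derivative.
  by rewrite (le_lt_trans x_ge0 xz) (lt_le_trans zy y1).
have [z _ ->] := MVT xy df (continuous_subspaceT continuous_bump).
by rewrite ler_pM2r ?subr_gt0 // (le_trans (ler_norm _)) // bump_derivative_le.
Qed.

End local_perturbation.

Section perturbed_class.
Variables (R : realType) (c d x0 : R) (f : R -> R).
Hypotheses (x001 : 0 < x0 < 1) (c0 : 0 < c) (fs : smooth_nonincreasing c d f).

(** The slope bounds at x0 are strict, with margin 2 eta. Continuity of the derivative uses up eta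
    near x0 and the bump at most 4 kappa <= eta; 4 kappa <= c preserves monotonicity. Neither kappa
    nor delta depends on h. *)
Lemma smooth_nonincreasing_bump : exists2 kappa : R, 0 < kappa &
  exists2 delta : R, 0 < delta & forall h, 0 < h < delta ->
    smooth_nonincreasing c d (f \+ bump x0 h kappa).
Proof.
have [fc fni [f' [hf f'c f'cd]]] := fs.
have x0I : x0 \in `[0, 1] by move: x001; rewrite in_itv /= => /andP[? ?]; rewrite !ltW.
have /andP[fx1 fx2] := f'cd x0 x0I.
pose eta := Num.min (`|f' x0| - c) (d - `|f' x0|) / 2.
have eta0 : 0 < eta by rewrite divr_gt0 // lt_min !subr_gt0 fx1.
have eta1 : 2 * eta <= `|f' x0| - c.
  by rewrite /eta mulrC divfK // ge_min lexx.
have eta2 : 2 * eta <= d - `|f' x0|.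
  by rewrite /eta mulrC divfK // ge_min lexx orbT.
pose kappa := Num.min eta c / 4.
have kappa0 : 0 < kappa by rewrite divr_gt0 // lt_min eta0.
have k1 : 4 * kappa <= eta by rewrite /kappa mulrC divfK // ge_min lexx.
have k2 : 4 * kappa <= c by rewrite /kappa mulrC divfK // ge_min lexx orbT.
exists kappa => //.
have f'x0 : {for x0, continuous f'}.
  by apply: within_continuous_continuous f'c _ => //; rewrite in_itv /= x001.
move/cvgrPdist_lt : f'x0 => /(_ eta eta0)/nbhs_ballP[delta /= delta0 near_x0].
exists delta => // h /andP[h0 hdelta].
split.
- apply: within_continuousD => //.
  apply: continuous_subspaceT; exact: continuous_bump.
- move=> x y xI yI; rewrite le_eqVlt => /predU1P[->//|xy].
  move: xI yI; rewrite !in_itv /= => /andP[x_ge0 _] /andP[_ y1].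
  have /andP[sl _] := smooth_slope c0 fs x_ge0 xy y1.
  have bl := bump_lipschitz x001 h0 kappa0 x_ge0 xy y1.
  have : 4 * kappa * (y - x) <= c * (y - x) by rewrite ler_pM2r ?subr_gt0.
  lra.
- exists (f' \+ bump_derivative x0 h kappa); split.
  + by apply: has_derivative_withinD => //; exact: bump_has_derivative.
  + apply: within_continuousD => //.
    apply: continuous_subspaceT; exact: continuous_bump_derivative.
  + move=> t tI /=; have [ht|ht] := ltP `|t - x0| h; last first.
      by rewrite bump_derivative_outside // addr0; exact: f'cd.
    have := near_x0 t; rewrite /ball /= distrC => /(_ (lt_trans ht hdelta)) ft.
    have bt := bump_derivative_le x0 h0 kappa0 t.
    have e : `|(f' t + bump_derivative x0 h kappa t) - f' x0| < 2 * eta.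
      rewrite addrAC; apply: (le_lt_trans (ler_normD _ _)).
      rewrite distrC in ft; lra.
    have := ler_dist_dist (f' t + bump_derivative x0 h kappa t) (f' x0).
    move/le_lt_trans => /(_ _ e); rewrite ltr_norml; lra.
Qed.

End perturbed_class.

(** * Bias of the averaged estimator *)

Section bias_lower_bound.
Context {R : realType} {dsp : measure_display} {T : measurableType dsp}.
Variable P : probability T R.

(** Integrates (g - theta)^2 >= 2 b (g - theta) - b^2, or its mirror image, arranged so that all
    integrands are nonnegative. *)
Lemma integral_sqr_ge_bias (g : T -> R) (G theta b : R) :
  measurable_fun setT g -> (forall w, 0 <= g w) -> 0 <= theta -> 0 <= b ->
  (\int[P]_w (g w)%:E = G%:E)%E -> b <= `|G - theta| ->
  ((b ^+ 2)%:E <= \int[P]_w ((g w - theta) ^+ 2)%:E)%E.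
Proof.
move=> mg g0 theta0 b0 Ig bG.
have msq : measurable_fun setT (fun w => (g w - theta) ^+ 2).
  by apply: measurable_funX; exact: measurable_funB.
have sq0 w : 0 <= (g w - theta) ^+ 2 by exact: sqr_ge0.
have mbg : measurable_fun setT (fun w => 2 * b * g w) by exact: measurable_funM.
have bg0 w : 0 <= 2 * b * g w by rewrite !mulr_ge0.
have Ibg : (\int[P]_w (2 * b * g w)%:E = (2 * b * G)%:E)%E.
  by rewrite ge0_integral_fin_Z ?mulr_ge0 // Ig -EFinM.
have bt0 : 0 <= 2 * b * theta + b ^+ 2 by rewrite addr_ge0 ?sqr_ge0 ?mulr_ge0.
have [Gt|Gt] := leP theta G.
- rewrite ger0_norm ?subr_ge0 // in bG.
  have : (\int[P]_w (2 * b * g w)%:E <=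
      \int[P]_w ((g w - theta) ^+ 2 + (2 * b * theta + b ^+ 2))%:E)%E.
    apply: ge0_le_integral => //.
    - by move=> w _; rewrite lee_fin.
    - exact/measurable_EFinP.
    - by apply/measurable_EFinP; exact: measurable_funD.
    - move=> w _; rewrite lee_fin -subr_ge0.
      rewrite (_ : _ - _ = (g w - theta - b) ^+ 2) ?sqr_ge0 //; ring.
  rewrite Ibg ge0_integral_fin_D // integral_probability_cst -leeBlDr // -EFinB.
  apply: le_trans; rewrite lee_fin.
  have : 2 * b * (theta + b) <= 2 * b * G by rewrite ler_wpM2l ?mulr_ge0 //; lra.
  rewrite expr2; lra.
- rewrite ltr0_norm ?subr_lt0 // in bG.
  have mgb : measurable_fun setT (fun w => 2 * b * g w + b ^+ 2) by exact: measurable_funD.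
  have gb0 w : 0 <= 2 * b * g w + b ^+ 2 by rewrite addr_ge0 ?sqr_ge0.
  have : (\int[P]_w (2 * b * theta)%:E <=
      \int[P]_w ((g w - theta) ^+ 2 + (2 * b * g w + b ^+ 2))%:E)%E.
    apply: ge0_le_integral => //.
    - by move=> w _; rewrite lee_fin !mulr_ge0.
    - by apply/measurable_EFinP; exact: measurable_funD.
    - move=> w _; rewrite lee_fin -subr_ge0.
      rewrite (_ : _ - _ = (g w - theta + b) ^+ 2) ?sqr_ge0 //; ring.
  rewrite integral_probability_cst ge0_integral_fin_D // (ge0_integral_fin_D P mbg) ?sqr_ge0 //.
  rewrite Ibg integral_probability_cst -EFinD -leeBlDr // -EFinB.
  apply: le_trans; rewrite lee_fin.
  have : 2 * b * (G + b) <= 2 * b * theta by rewrite ler_wpM2l ?mulr_ge0 //; lra.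
  rewrite expr2; lra.
Qed.

Lemma integral_average (m : nat) (g : 'I_m -> T -> R) (G : 'I_m -> R) :
  (forall j, measurable_fun setT (g j)) -> (forall j w, 0 <= g j w) ->
  (forall j, (\int[P]_w (g j w)%:E = (G j)%:E)%E) ->
  (\int[P]_w (m%:R^-1 * \sum_j g j w)%:E = (m%:R^-1 * \sum_j G j)%:E)%E.
Proof.
move=> mg g0 IG.
rewrite ge0_integral_fin_Z; first last.
- by rewrite invr_ge0; exact: ler0n.
- by move=> w; apply: sumr_ge0 => j _.
- exact: measurable_sum.
rewrite EFinM; congr (_ * _)%E.
under eq_integral do rewrite -sumEFin.
rewrite ge0_integral_sum //; last by move=> j w _; rewrite lee_fin.
  by rewrite -sumEFin; apply: eq_bigr => j _; exact: IG.
by move=> j; exact/measurable_EFinP.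
Qed.

Lemma expR_le1D2 (y : R) : 0 <= y <= 2^-1 -> expR y <= 1 + 2 * y.
Proof.
move=> /andP[y0 y1].
have h : 1 - y <= expR (- y) by rewrite -[1 - y]/(1 + - y) expR_ge1Dx.
have y2 : 0 < 1 - y by lra.
rewrite -[y]opprK expRN opprK; apply: (@le_trans _ _ (1 - y)^-1).
  by rewrite lef_pV2 // posrE expR_gt0.
by rewrite -[leLHS]mul1r ler_pdivrMr //; nra.
Qed.

Lemma shifted_observations (x e : nat -> R) (f b : R -> R) k n :
  [seq (x i, f (x i) + (e i + if (k <= i < k + n)%N then b (x i) else 0)) | i <- iota k n] =
  [seq (x i, f (x i) + b (x i) + e i) | i <- iota k n].
Proof.
by apply/eq_in_map => i; rewrite mem_iota => ->; rewrite [e i + _]addrC addrA.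
Qed.

Variables (X eps : nat -> {RV P >-> R}) (v : R).
Hypothesis v0 : 0 < v.
Hypothesis noise : regression_noise v X eps.

Variables (c d x0 : R) (f : R -> R).
Hypotheses (c0 : 0 < c) (d0 : 0 < d) (x001 : 0 < x0 < 1).
Hypothesis fs : smooth_nonincreasing c d f.
Hypothesis mf : measurable_fun setT f.
Variables (kappa h : R).
Hypotheses (kappa0 : 0 < kappa) (h0 : 0 < h).
Let g := f \+ bump x0 h kappa.
Hypothesis gs : smooth_nonincreasing c d g.
Let a := f x0.

Lemma measurable_bump : measurable_fun setT (bump x0 h kappa).
Proof. by apply: continuous_measurable_fun; exact: continuous_bump. Qed.

Lemma gen_inv_center_le : gen_inv f a <= x0.
Proof.
have x0I : x0 \in `[0, 1] by move: x001; rewrite in_itv /= => /andP[? ?]; rewrite !ltW.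
apply: ge_sup; first by exists x0.
move=> t /= [+ at_]; rewrite in_itv /= => /andP[t0 t1].
rewrite leNgt; apply/negP => x0t.
have /andP[+ _] := smooth_slope c0 fs (ltW (andP x001).1) x0t t1.
have : 0 < c * (t - x0) by rewrite mulr_gt0 // subr_gt0.
rewrite /a in at_; lra.
Qed.

Lemma gen_inv_bump_ge : kappa * h <= d * (1 - x0) ->
  x0 + kappa * h / d <= gen_inv g a.
Proof.
move=> hd; set t := x0 + _.
have kh : 0 < kappa * h / d by rewrite divr_gt0 // mulr_gt0.
have x0t : x0 < t by rewrite /t ltrDl.
have t1 : t <= 1.
  by rewrite /t addrC -lerBrDr ler_pdivrMr // [leRHS]mulrC.
apply: ub_le_sup; first by exists 1 => x /= [+ _]; rewrite in_itv /= => /andP[].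
split; first by rewrite /= in_itv /= t1 (le_trans _ (ltW x0t)) // ltW // (andP x001).1.
have /andP[_] := smooth_slope c0 gs (ltW (andP x001).1) x0t t1.
have -> : g x0 = a + kappa * h by rewrite /g /= bump_center.
have -> : d * (t - x0) = kappa * h by rewrite /t; field; rewrite gt_eqF.
lra.
Qed.

(** The exponent is at most u on a window of length 2 h and 0 elsewhere; exp(y) <= 1 + 2 y then
    gives 1 + 2 u * 2 h. *)
Lemma integral_exp_bump_le i : (kappa * h / v) ^+ 2 <= 2^-1 ->
  (\int[P]_w (expR (bump x0 h kappa (X i w) ^+ 2 / v ^+ 2))%:E <=
   (1 + 4 * kappa ^+ 2 * h ^+ 3 / v ^+ 2)%:E)%E.
Proof.
set u := _ ^+ 2 => u1.
have u0 : 0 <= u by exact: sqr_ge0.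
pose D w : R := (X i w \in Interval (BLeft (x0 - h)) (BRight (x0 + h)))%:R.
have D0 w : 0 <= D w by rewrite /D; exact: ler0n.
have mD : measurable_fun setT D.
  rewrite /D; apply: (@measurableT_comp _ _ _ _ _ _ (fun t : R => (t \in `[x0 - h, x0 + h])%:R : R)).
    rewrite (_ : (fun _ => _) = \1_[set` `[x0 - h, x0 + h]]).
      by apply: measurable_indic; exact: measurable_itv.
    by apply/funext => t; rewrite indicE mem_setE.
  exact: measurable_funP.
apply: (@le_trans _ _ (\int[P]_w (2 * u * D w + 1)%:E)%E).
  apply: ge0_le_integral => //.
  - apply/measurable_EFinP.
    apply: (@measurableT_comp _ _ _ _ _ _ (fun t : R => expR (bump x0 h kappa t ^+ 2 / v ^+ 2))).
      apply: measurableT_comp; first exact: measurable_expR.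
      by apply: measurable_funM => //; apply: measurable_funX; exact: measurable_bump.
    exact: measurable_funP.
  - by apply/measurable_EFinP; apply: measurable_funD => //; exact: measurable_funM.
  move=> w _; rewrite lee_fin.
  have [hX|hX] := ltP `|X i w - x0| h; last first.
    rewrite bump_outside // expr0n mul0r expR0 lerDr; apply: mulr_ge0 => //.
    exact: mulr_ge0.
  have -> : D w = 1.
    rewrite /D in_itv /=; move: hX; rewrite ltr_norml => /andP[h1 h2].
    by rewrite (_ : _ && _ = true) //; apply/andP; split; lra.
  have /andP[b1 b2] := bump_itv x0 h0 kappa0 (X i w).
  have bu : 0 <= bump x0 h kappa (X i w) ^+ 2 / v ^+ 2 <= u.
    rewrite -expr_div_n sqr_ge0 /= ler_sqr ?nnegrE ?ler_pM2r ?invr_gt0 //.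
      by rewrite divr_ge0 // ltW.
    by rewrite divr_ge0 ?mulr_ge0 // ltW.
  move: bu => /andP[bu0 bu1].
  rewrite mulr1 [leRHS]addrC; apply: le_trans (expR_le1D2 _) _; last by rewrite lerD2l; exact: ler_wpM2l.
  by rewrite bu0 (le_trans bu1).
rewrite ge0_integral_fin_D //; [|exact: measurable_funM|by move=> w; apply: mulr_ge0 (mulr_ge0 _ u0) (D0 w)].
rewrite integral_probability_cst ge0_integral_fin_Z //; last exact: mulr_ge0.
apply: (@le_trans _ _ ((2 * u)%:E * (x0 + h - (x0 - h))%:E + 1%:E)%E).
  rewrite leeD2r // lee_wpmul2l // ?lee_fin; first exact: mulr_ge0 _ u0.
  by apply: (integral_indicator_X_le noise i true false); rewrite ltrD2l gtrN.
rewrite -EFinM -EFinD lee_fin le_eqVlt; apply/orP; left; apply/eqP.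
by rewrite /u; field; rewrite gt_eqF.
Qed.

Variables (beta r : R) (n : nat).
Hypotheses (beta0 : 0 < beta) (r0 : 0 < r) (n0 : (0 < n)%N) (rn : r ^+ 3 * n%:R = 1).
Hypothesis hE : h = beta ^+ 2 * r.
Hypothesis h1 : kappa * h <= d * (1 - x0).
Hypothesis h2 : (kappa * h / v) ^+ 2 <= 2^-1.
Hypothesis beta1 : 4 * kappa ^+ 2 * beta ^+ 6 / v ^+ 2 <= 2^-1.
Let K : R := 1 + 4 * slice_constant v c.
Hypothesis beta2 : beta * (K / 2 + 4 * kappa ^+ 2 / v ^+ 2) <= kappa / (2 * d).

Let F k (x e : nat -> R) : R :=
  gen_inv (mu_hat [seq (x i, f (x i) + e i) | i <- iota k n]) a.

Let F01 k x e : 0 <= F k x e <= 1. Proof. exact: gen_inv_itv. Qed.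

Let mF k d' (S : measurableType d') (x e : nat -> S -> R) :
  (forall i, measurable_fun setT (x i)) -> (forall i, measurable_fun setT (e i)) ->
  measurable_fun setT (fun w => F k (x ^~ w) (e ^~ w)).
Proof.
move=> mx me.
apply: (@measurable_gen_inv_mu_hat _ _ _ x (fun i w => f (x i w) + e i w)) => // i.
by apply: measurable_funD => //; exact: measurableT_comp.
Qed.

Let est mu k w := gen_inv (mu_hat (sample X eps mu w k n)) a.

Let estE1 k w : est g k w = shifted_value X eps (bump x0 h kappa) k n (F k) w.
Proof.
by rewrite /est /shifted_value /F shifted_observations.
Qed.

Let shiftedE k : (\int[P]_w (shifted_value X eps (bump x0 h kappa) k n (F k) w)%:E =
  \int[P]_w (est g k w)%:E)%E.
Proof. by apply: eq_integral => w _; rewrite estE1. Qed.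

(** As n h^3 = beta^6, the power (1 + q0)^n is at most exp(q1) with q1 free of n, and q1 <= 1/2
    linearizes the exponential. *)
Let Lq k : (\int[P]_w (likelihood_ratio X eps v (bump x0 h kappa) k n w ^+ 2)%:E <=
  (1 + 8 * kappa ^+ 2 * beta ^+ 6 / v ^+ 2)%:E)%E.
Proof.
apply: le_trans (integral_likelihood_ratio_sqr v0 noise k measurable_bump n
  (fun i => @integral_exp_bump_le i h2)) _.
rewrite lee_fin.
set q0 := 4 * kappa ^+ 2 * h ^+ 3 / v ^+ 2.
have q00 : 0 <= q0 by rewrite /q0 divr_ge0 ?mulr_ge0 ?exprn_ge0 ?sqr_ge0 ?(ltW h0) ?(ltW kappa0) ?(ltW v0).
have q12 := beta1; set q1 := 4 * kappa ^+ 2 * beta ^+ 6 / v ^+ 2 in q12.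
have qn : n%:R * q0 = q1.
  rewrite /q0 /q1 hE.
  have -> : n%:R * (4 * kappa ^+ 2 * (beta ^+ 2 * r) ^+ 3 / v ^+ 2) =
    4 * kappa ^+ 2 * beta ^+ 6 / v ^+ 2 * (r ^+ 3 * n%:R) by ring.
  by rewrite rn mulr1.
apply: (@le_trans _ _ (expR q0 ^+ n)).
  by rewrite lerXn2r ?nnegrE ?expR_ge0 ?expR_ge1Dx // addr_ge0.
rewrite -expRM_natl qn.
have -> : 1 + 8 * kappa ^+ 2 * beta ^+ 6 / v ^+ 2 = 1 + 2 * q1 by rewrite /q1; ring.
by apply: expR_le1D2; rewrite q12 andbT -qn mulr_ge0.
Qed.

Let B k := fine (\int[P]_w (base_value X eps (F k) w)%:E)%E.
Let S k := fine (\int[P]_w (shifted_value X eps (bump x0 h kappa) k n (F k) w)%:E)%E.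

Let close k : `|S k - B k| <= kappa * beta ^+ 2 * r / (2 * d).
Proof.
have th := gen_inv_itv f a.
have /andP[th0 th1] := th.
have slope x y : 0 <= x -> x < y -> y <= 1 -> c * (y - x) <= f x - f y.
  by move=> ? ? ?; case/andP: (@smooth_slope _ c d f x y c0 fs ltac:(by []) ltac:(by []) ltac:(by [])).
have riskK : (\int[P]_w ((base_value X eps (F k) w - gen_inv f a) ^+ 2)%:E <= (K * r ^+ 2)%:E)%E.
  have := inverse_risk_le v0 noise k c0 th n0 r0 rn (gen_inv_drift c0 slope) (ler01 : 0 <= 1 :> R).
  by under eq_integral do rewrite mul1r; rewrite mul1r.
(* With alpha = beta^3 / r both terms of the two-point bound are multiples of beta^3 r. *)
have al0 : 0 < beta ^+ 3 / r by rewrite divr_gt0 // exprn_gt0.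
have := two_point_bound v0 noise measurable_bump (@mF k) (F01 k) th0 al0 riskK (Lq k).
move/le_trans; apply.
have -> : beta ^+ 3 / r / 2 * (K * r ^+ 2) +
    8 * kappa ^+ 2 * beta ^+ 6 / v ^+ 2 / (2 * (beta ^+ 3 / r)) =
    beta ^+ 2 * r * (beta * (K / 2 + 4 * kappa ^+ 2 / v ^+ 2)).
  by field; rewrite !gt_eqF.
have -> : kappa * beta ^+ 2 * r / (2 * d) = beta ^+ 2 * r * (kappa / (2 * d)).
  by field; rewrite gt_eqF.
by rewrite ler_pM2l // mulr_gt0 // exprn_gt0.
Qed.

Let mest0 k : measurable_fun setT (est f k).
Proof. by apply: (@mF k _ _ (fun i => X i) (fun i => eps i)) => i; exact: measurable_funP. Qed.

Let mest1 k : measurable_fun setT (est g k).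
Proof.
apply: measurable_gen_inv_mu_hat => i; first exact: measurable_funP.
apply: measurable_funD; last exact: measurable_funP.
apply: measurableT_comp; last exact: measurable_funP.
by apply: measurable_funD => //; exact: measurable_bump.
Qed.

(** The targets are at least 4 b apart and the two expectations at most 2 b, so one of them misses
    its target by b. Averaging enters only through linearity of the expectation. *)
Lemma theta_bar_risk_ge (m : nat) (z : R) : (0 < m)%N -> 0 <= z ->
  exists2 mu, mu = f \/ mu = g &
    ((z * (kappa * beta ^+ 2 * r / (4 * d)) ^+ 2)%:E <=
     \int[P]_w (z * (theta_bar X eps a m n mu w - gen_inv mu a) ^+ 2)%:E)%E.
Proof.
move=> m0 z0; set b := kappa * beta ^+ 2 * r / (4 * d).
have b0 : 0 <= b by rewrite /b divr_ge0 ?mulr_ge0 ?sqr_ge0 // ltW.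
have est0 mu k w : 0 <= est mu k w by case/andP: (gen_inv_itv (mu_hat (sample X eps mu w k n)) a).
have IG0 (j : 'I_m) : (\int[P]_w (est f (j * n) w)%:E = (B (j * n))%:E)%E.
  by rewrite /B fineK //; exact: (base_fin X eps (@mF _) (F01 _)).
have IG1 (j : 'I_m) : (\int[P]_w (est g (j * n) w)%:E = (S (j * n))%:E)%E.
  have fS := shifted_fin X eps (j * n) n measurable_bump (@mF (j * n)) (F01 (j * n)).
  exact: etrans (esym (shiftedE (j * n))) (esym (fineK fS)).
have I0 := integral_average (fun j => mest0 (j * n)) (fun j => est0 f (j * n)%N) IG0.
have I1 := integral_average (fun j => mest1 (j * n)) (fun j => est0 g (j * n)%N) IG1.
set B0 := m%:R^-1 * _ in I0; set B1 := m%:R^-1 * _ in I1.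
have B10 : `|B1 - B0| <= 2 * b.
  rewrite /B1 /B0 -mulrBr -sumrB normrM normfV normr_nat.
  rewrite ler_pdivrMl ?ltr0n //; apply: le_trans (ler_norm_sum _ _ _) _.
  apply: (@le_trans _ _ (\sum_(j < m) 2 * b)).
    apply: ler_sum => j _; apply: le_trans (close _) _.
    by rewrite /b le_eqVlt; apply/orP; left; apply/eqP; field; rewrite gt_eqF.
  by rewrite sumr_const card_ord [leRHS]mulr_natl.
have th0 := gen_inv_center_le; have th1 := gen_inv_bump_ge h1.
have h4 : kappa * h / d = 4 * b by rewrite /b hE; field; rewrite gt_eqF.
have th : 4 * b <= gen_inv g a - gen_inv f a by lra.
have conclude mu G : measurable_fun setT (theta_bar X eps a m n mu) ->
    (\int[P]_w (theta_bar X eps a m n mu w)%:E = G%:E)%E -> b <= `|G - gen_inv mu a| ->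
    ((z * b ^+ 2)%:E <=
     \int[P]_w (z * (theta_bar X eps a m n mu w - gen_inv mu a) ^+ 2)%:E)%E.
  move=> mtb IB bB; rewrite ge0_integral_fin_Z //.
  - rewrite EFinM lee_wpmul2l ?lee_fin //; apply: integral_sqr_ge_bias IB bB => //.
      move=> w; apply: mulr_ge0; first by rewrite invr_ge0; exact: ler0n.
      by apply: sumr_ge0 => j _; exact: est0.
    by case/andP: (gen_inv_itv mu a).
  - by apply: measurable_funX; exact: measurable_funB.
  - by move=> w; exact: sqr_ge0.
have mtb mu : (forall k, measurable_fun setT (est mu k)) -> measurable_fun setT (theta_bar X eps a m n mu).
  move=> me; apply: measurable_funM => //; apply: measurable_sum => j.
  exact: me.
have [h3|h3] := leP b `|B0 - gen_inv f a|.
  by exists f; [left|exact: conclude (mtb _ mest0) I0 h3].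
exists g; [by right|apply: conclude (mtb _ mest1) I1 _].
move: h3 B10; rewrite ltr_norml ler_norml => /andP[? ?] /andP[? ?].
by rewrite ler_normr; apply/orP; right; lra.
Qed.

End bias_lower_bound.

(** * Rates, limits and the choice of constants *)

Section limits_and_rates.
Context {R : realType}.

Lemma limn_esup_le (u : (\bar R)^nat) (l : \bar R) (N : nat) :
  (forall n, (N <= n)%N -> (u n <= l)%E) -> (limn_esup u <= l)%E.
Proof.
move=> ul; apply: (@le_trans _ _ (ereal_sup (u @` [set n | (N <= n)%N]))).
  apply: ereal_inf_lbound; exists [set n | (N <= n)%N] => //.
  exact: nbhs_infty_ge.
by apply: ge_ereal_sup => _ [n /= Nn <-]; exact: ul.
Qed.

Lemma limn_einf_ge (u : (\bar R)^nat) (l : \bar R) (N : nat) :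
  (forall n, (N <= n)%N -> (l <= u n)%E) -> (l <= limn_einf u)%E.
Proof.
move=> ul; rewrite /limn_einf leeNr; apply: (@limn_esup_le _ _ N) => n Nn.
by rewrite leeN2 ul.
Qed.

Definition cube_rate (n : nat) : R := n%:R `^ (- (1 / 3)).

Lemma cube_rate_gt0 n : (0 < n)%N -> 0 < cube_rate n.
Proof. by move=> n0; rewrite powR_gt0 // ltr0n. Qed.

Lemma cube_rate_exp3 n : (0 < n)%N -> cube_rate n ^+ 3 * n%:R = 1.
Proof.
move=> n0; have nR : 0 < n%:R :> R by rewrite ltr0n.
rewrite -powR_mulrn ?powR_ge0 // -powRrM (_ : - (1 / 3) * 3%:R = -1); last by field.
by rewrite powR_inv1 ?ltW // mulVf // gt_eqF.
Qed.

Lemma powR_cube_rate m n : (0 < n)%N ->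
  (m * n)%:R `^ (2 / 3) * cube_rate n ^+ 2 = m%:R `^ (2 / 3) :> R.
Proof.
move=> n0; have nR : 0 < n%:R :> R by rewrite ltr0n.
rewrite natrM powRM ?(ltW nR) //.
rewrite -mulrA -powR_mulrn ?powR_ge0 // -powRrM -powRD; last by rewrite (gt_eqF nR) implybT.
by rewrite (_ : 2 / 3 + _ = 0) ?powRr0 ?mulr1 //; field.
Qed.

Lemma cube_rate_small (b : R) : 0 < b ->
  exists N : nat, forall n, (N <= n)%N -> (0 < n)%N /\ cube_rate n <= b.
Proof.
move=> b0; exists (Num.truncn (b ^- 3)).+1 => n Nn.
have n0 : (0 < n)%N by apply: leq_trans Nn.
split => //; rewrite leNgt; apply/negP => bn.
have b3 : 0 < b ^+ 3 by rewrite exprn_gt0.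
have : b ^- 3 < n%:R.
  by apply: (lt_le_trans (truncnS_gt _)); rewrite ler_nat.
rewrite -(ltr_pM2l b3) divff ?gt_eqF // -[ltLHS](cube_rate_exp3 n0) ltr_pM2r ?ltr0n //.
by rewrite ltNge lerXn2r ?nnegrE ?(ltW b0) ?(ltW bn) // (le_trans (ltW b0)) // ltW.
Qed.

End limits_and_rates.

Section minimax_bounds.
Context {R : realType} {disp : measure_display} {T : measurableType disp}.
Variables (P : probability T R) (X eps : nat -> {RV P >-> R}).
Variables (c d v x0 eps0 : R) (mu0 : R -> R).
Hypotheses (c0 : 0 < c) (v0 : 0 < v) (noise : regression_noise v X eps).

Lemma pooled_risk_le (a : R) (N : nat) : (0 < N)%N ->
  (max_risk P (local_class c d mu0 x0 eps0) a N (theta_hat X eps a N) <=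
   (1 + 4 * slice_constant v c)%:E)%E.
Proof.
move=> N0; apply: ge_ereal_sup => _ [mu [mus _] <-].
rewrite unlock.
have slope x y : 0 <= x -> x < y -> y <= 1 -> c * (y - x) <= mu x - mu y.
  by move=> h1 h2 h3; case/andP: (smooth_slope c0 mus h1 h2 h3).
apply: le_trans (inverse_risk_le v0 noise 0 c0 (gen_inv_itv mu a) N0
  (cube_rate_gt0 N0) (cube_rate_exp3 N0) (gen_inv_drift c0 slope) (powR_ge0 _ _)) _.
have := powR_cube_rate (R := R) 1 N0; rewrite mul1n powR1 => NE.
by rewrite lee_fin mulrCA NE mulr1.
Qed.

Hypotheses (mu0s : smooth_nonincreasing c d mu0) (x001 : 0 < x0 < 1) (eps00 : 0 < eps0).

(** Neither C nor the threshold N depends on m, so the bound also applies along a sequence m_n. *)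
Lemma divided_risk_ge : exists2 C : R, 0 < C & exists N : nat,
  forall m n, (0 < m)%N -> (N <= n)%N ->
  ((m%:R `^ (2 / 3) * C)%:E <=
   max_risk P (local_class c d mu0 x0 eps0) (mu0 x0) (m * n)
     (theta_bar X eps (mu0 x0) m n))%E.
Proof.
have [_ _ [f' [_ _ f'cd]]] := mu0s.
have x0I : x0 \in `[0, 1] by move: x001; rewrite in_itv /= => /andP[? ?]; rewrite !ltW.
have d0 : 0 < d.
  have /andP[h1 h2] := f'cd x0 x0I.
  exact: lt_trans c0 (lt_trans h1 h2).
pose f := mu0 \o @clamp01 R.
have fE t : t \in `[0, 1] -> f t = mu0 t by rewrite in_itv /= => t01; rewrite /f /= clamp01_id.
have fs : smooth_nonincreasing c d f := smooth_nonincreasing_clamp mu0s.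
have mf : measurable_fun setT f := measurable_smooth_clamp mu0s.
have [kappa kappa0 [delta delta0 gs]] := smooth_nonincreasing_bump x001 c0 fs.
pose K : R := 1 + 4 * slice_constant v c.
have K0 : 0 < K / 2 + 4 * kappa ^+ 2 / v ^+ 2.
  rewrite ltr_pwDr //; first by rewrite divr_gt0 ?mulr_gt0 ?exprn_gt0.
  apply: divr_ge0 => //; apply: addr_ge0 => //; apply: mulr_ge0 => //.
  exact: slice_constant_ge0.
(* The bounds ensure, in turn, beta^6 <= beta, a change of expectation small against the target
   shift, and a small chi-square divergence. *)
pose beta := Num.min 1 (Num.min (kappa / (2 * d) / (K / 2 + 4 * kappa ^+ 2 / v ^+ 2))
  (v ^+ 2 / (8 * kappa ^+ 2))).
have beta0 : 0 < beta.
  by rewrite !lt_min ltr01 !divr_gt0 ?mulr_gt0 ?exprn_gt0.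
have beta1 : beta <= 1 by rewrite /beta ge_min lexx.
have beta2 : beta * (K / 2 + 4 * kappa ^+ 2 / v ^+ 2) <= kappa / (2 * d).
  by rewrite -ler_pdivlMr // /beta !ge_min lexx orbT.
have beta3 : 4 * kappa ^+ 2 * beta ^+ 6 / v ^+ 2 <= 2^-1.
  have b6 : beta ^+ 6 <= v ^+ 2 / (8 * kappa ^+ 2).
    apply: (@le_trans _ _ beta); last by rewrite /beta !ge_min lexx !orbT.
    by rewrite -[leRHS]expr1 ler_wiXn2l // ltW.
  apply: (@le_trans _ _ (4 * kappa ^+ 2 * (v ^+ 2 / (8 * kappa ^+ 2)) / v ^+ 2)).
    by rewrite ler_pM2r ?invr_gt0 ?exprn_gt0 // ler_pM2l // mulr_gt0 ?exprn_gt0.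
  by rewrite le_eqVlt; apply/orP; left; apply/eqP; field; rewrite !gt_eqF.
(* In turn: the slope bounds survive, the bump stays where the class allows changes, the shifted
   target stays in [0, 1], and the exponent of the squared ratio is at most 1/2. *)
pose hmax := Num.min (Num.min (delta / 2) eps0)
  (Num.min (d * (1 - x0) / kappa) (v / (2 * kappa))).
have x01 : 0 < 1 - x0 by rewrite subr_gt0 (andP x001).2.
have hmax0 : 0 < hmax.
  by rewrite !lt_min eps00 !divr_gt0 ?mulr_gt0.
have [N NN] := cube_rate_small hmax0.
pose C := kappa * beta ^+ 2 / (4 * d).
exists (C ^+ 2); first by rewrite exprn_gt0 // divr_gt0 ?mulr_gt0 ?exprn_gt0.
exists N => m n m0 /NN[n0 rh].
set r := cube_rate n in rh.
have r0 : 0 < r := cube_rate_gt0 n0.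
pose h := beta ^+ 2 * r.
have h0 : 0 < h by rewrite mulr_gt0 ?exprn_gt0.
have hh : h <= hmax.
  apply: le_trans rh; rewrite /h ger_pMl // exprn_ile1 //; exact: ltW.
move: hh; rewrite !le_min => /andP[/andP[h1 h2] /andP[h3 h4]].
have hd : 0 < h < delta by rewrite h0; lra.
have kh1 : kappa * h <= d * (1 - x0) by rewrite mulrC -ler_pdivlMr.
have kh2 : (kappa * h / v) ^+ 2 <= 2^-1.
  have k0 : 0 <= kappa * h / v by rewrite divr_ge0 ?mulr_ge0 // ltW.
  have k1 : kappa * h / v <= 2^-1.
    move: h4; rewrite ler_pdivlMr ?mulr_gt0 // ler_pdivrMr // => h4; lra.
  by rewrite expr2; nra.
have [mu mufg risk] := @theta_bar_risk_ge _ _ _ _ _ _ _ v0 noise _ _ _ _ c0 d0 x001 fs mf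
  _ _ kappa0 h0 (gs h hd) beta r n beta0 r0 n0 (cube_rate_exp3 n0) (erefl h) kh1 kh2
  beta3 beta2 m ((m * n)%:R `^ (2 / 3)) m0 (powR_ge0 _ _).
have ax : f x0 = mu0 x0 by exact: fE.
rewrite ax in risk.
apply: (le_trans _ (le_trans risk _)).
  rewrite lee_fin -[X in _ <= _ * X ^+ 2]/(kappa * beta ^+ 2 * r / (4 * d)).
  rewrite (_ : kappa * beta ^+ 2 * r / (4 * d) = C * r); last by rewrite /C mulrAC.
  by rewrite [in leRHS]exprMn [leRHS]mulrCA /r powR_cube_rate // mulrC.
apply: ereal_sup_ubound; exists mu; last by rewrite unlock.
split.
  by case: mufg => ->; [exact: fs|exact: gs].
move=> t t01 tout.
have far : h <= `|t - x0|.
  apply: le_trans h2 _; rewrite leNgt; apply/negP; rewrite ltr_norml => /andP[t1 t2].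
  by move: tout; rewrite in_itv /= => /negP; apply; apply/andP; split; lra.
by case: mufg => ->; rewrite /= ?bump_outside ?addr0 // -/(f t) fE.
Qed.

End minimax_bounds.

Theorem theorem6p1 (R : realType)
    (disp : measure_display) (T : measurableType disp) (P : probability T R)
    (X eps : nat -> {RV P >-> R}) (c d v x0 eps0 : R) (mu0 : R -> R)
    (hc : 0 < c) (hcd : c < d)
    (hmu0 : smooth_nonincreasing c d mu0)
    (hx0 : 0 < x0 < 1)
    (heps0 : 0 < eps0)
    (hsub : forall t, x0 - eps0 < t < x0 + eps0 -> 0 < t < 1)
    (hv : 0 < v)
    (hnoise : regression_noise v X eps) :
  let a := mu0 x0 in
  let M0 := local_class c d mu0 x0 eps0 in
  let E := limn_esup (fun N => max_risk P M0 a N (theta_hat X eps a N)) in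
  let E_ (m : nat) := limn_einf (fun n =>
    max_risk P M0 a (m * n) (theta_bar X eps a m n)) in
  [/\ (E < +oo)%E,
      exists2 c0 : R, 0 < c0 &
        forall m : nat, (0 < m)%N -> ((m%:R `^ (2 / 3) * c0)%:E <= E_ m)%E &
      forall m : nat -> nat, m n @[n --> \oo] --> \oo ->
        limn_einf (fun n =>
          max_risk P M0 a (m n * n) (theta_bar X eps a (m n) n)) = +oo%E].
Proof.
move=> a M0 E E_.
have [C C0 [N risk]] := divided_risk_ge hc hv hnoise hmu0 hx0 heps0.
split.
- apply: le_lt_trans (ltry (1 + 4 * slice_constant v c)).
  by apply: (@limn_esup_le _ _ _ 1%N) => n n0; exact: pooled_risk_le.
- exists C => // m m0; apply: (@limn_einf_ge _ _ _ N) => n Nn.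
  exact: risk.
- move=> m minf; apply/eqyP => A A0.
  have [q qE] : exists q : nat, A <= q%:R `^ (2 / 3) * C.
    pose y := A / C; have y0 : 0 < y by rewrite divr_gt0.
    exists (Num.truncn (y `^ (3 / 2))).+1.
    rewrite -ler_pdivrMr // -/y.
    have {1}-> : y = (y `^ (3 / 2)) `^ (2 / 3).
      by rewrite -powRrM (_ : 3 / 2 * (2 / 3) = 1) ?powRr1 ?ltW //; field.
    apply: ge0_ler_powR; rewrite ?nnegrE ?powR_ge0 //.
    exact: ltW (truncnS_gt _).
  (* The maximum with 1 keeps m_n positive, as the risk bound requires. *)
  have [N' _ mN'] := minf _ (nbhs_infty_ge (maxn 1 q)).
  apply: (@limn_einf_ge _ _ _ (maxn N N')) => n; rewrite geq_max => /andP[Nn N'n].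
  have := mN' n N'n; rewrite /= geq_max => /andP[m1 qm].
  apply: le_trans (risk _ _ m1 Nn); rewrite lee_fin (le_trans qE) //.
  by rewrite ler_pM2r // ge0_ler_powR ?nnegrE // ler_nat.
Qed.
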